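(* Let $A\subset\mathbb{R}^2$ be a bounded contractible polygonal domain with a conforming triangulation $\mathcal{T}_h$, let $p\ge3$ be an integer, $t>0$ and $g\in L^2(A)$. Set $X_h^p(A)=U_h^p(A)\times[D_h^{p-1}(A)]^2$, $Y_h^{p-1}(A)=D_h^{p-1}(A)\times[D_h^{p-1}(A)]^2$ and $Z_h^p(A)=\mathcal{HZ}_h^p(A)\times\mathcal{RT}_h^{p-1}(A)$. Then both of the following discrete problems are well-posed (they have exactly one solution, depending continuously on the load $g$). (1) Three-field formulation: find $\{w^h,\phi^h,M^h\}\in X_h^p(A)\times\mathcal{HZ}_h^p(A)$ such that $$\int_A\langle\delta M,\mathbb{A}M^h\rangle+\langle\mathrm{Div}\,\delta M,\phi^h\rangle\,dA=0\qquad\forall\,\delta M\in\mathcal{HZ}_h^p(A),$$ $$\int_A\langle\delta\phi,\mathrm{Div}\,M^h\rangle-\frac{k_s\mu}{t^2}\langle\nabla\delta w-\delta\phi,\nabla w^h-\phi^h\rangle\,dA=-\int_A\delta w\,g\,dA\qquad\forall\,\{\delta w,\delta\phi\}\in X_h^p(A).$$ (2) Quad-field formulation: find $\{w^h,\phi^h,M^h,q^h\}\in Y_h^{p-1}(A)\times Z_h^p(A)$ such that $$\int_A\langle\delta M,\mathbb{A}M^h\rangle+\frac{t^2}{k_s\mu}\langle\delta q,q^h\rangle+\langle\mathrm{Div}\,\delta M,\phi^h\rangle-(\mathrm{div}\,\delta q)\,w^h-\langle\delta q,\phi^h\rangle\,dA=0\qquad\forall\,\{\delta M,\delta q\}\in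 Z_h^p(A),$$ $$\int_A\langle\delta\phi,\mathrm{Div}\,M^h\rangle-\delta w\,(\mathrm{div}\,q^h)-\langle\delta\phi,q^h\rangle\,dA=-\int_A\delta w\,g\,dA\qquad\forall\,\{\delta w,\delta\phi\}\in Y_h^{p-1}(A).$$
   Context: Notation: $\langle\cdot,\cdot\rangle$ is the Euclidean inner product of vectors or the Frobenius inner product of matrices; $\mathrm{Div}$ is the row-wise divergence of matrix fields; $H^{\mathrm{sym}}(\mathrm{Div},A)=\{M\in[L^2(A)]^{2\times2}: M=M^T,\ \mathrm{Div}\,M\in[L^2(A)]^2\}$ and $H(\mathrm{div},A)=\{v\in[L^2(A)]^2:\mathrm{div}\,v\in L^2(A)\}$. $P^k(T)$ denotes polynomials of total degree at most $k$ on a triangle $T$ and $\mathrm{Sym}(2)$ the symmetric $2\times2$ real matrices. Finite element spaces on $\mathcal{T}_h$: - $U_h^p(A)=\{u\in C^0(\overline A): u|_T\in P^p(T)\ \forall T\in\mathcal{T}_h,\ u=0\text{ on }\partial A\}\subset H_0^1(A)$. - $D_h^{k}(A)=\{u\in L^2(A): u|_T\in P^{k}(T)\ \forall T\in\mathcal{T}_h\}$ (discontinuous piecewise polynomials). - $\mathcal{HZ}_h^p(A)$ is the Hu–Zhang space, $p\ge3$: all $M\in H^{\mathrm{sym}}(\mathrm{Div},A)$ with $M|_T\in P^p(T)\otimes\mathrm{Sym}(2)$ for all $T\in\mathcal{T}_h$ that are continuous (all components) at every vertex of $\mathcal{T}_h$. Equivalently: full continuity at vertices, continuity of $Mn$ across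 edges, while the tangential-tangential component may jump across edges. No boundary conditions are imposed. - $\mathcal{RT}_h^{p-1}(A)=\{v\in H(\mathrm{div},A): v|_T\in[P^{p-1}(T)]^2+x\,P^{p-1}(T)\ \forall T\in\mathcal{T}_h\}$ is the Raviart–Thomas space, where $x$ is the position vector. No boundary conditions are imposed. Material constants: $k_s\mu>0$ is a constant. The compliance tensor acts on symmetric $2\times2$ matrices by $\mathbb{A}S=\frac{12}{E}\left[(1+\nu)S-\nu\,\mathrm{tr}(S)\,I\right]$, with Young's modulus $E$ and Poisson ratio $\nu$ such that $\mathbb{A}$ is positive definite: there are $k_A,c_A>0$ with $k_A\|S\|^2\le\langle S,\mathbb{A}S\rangle\le c_A\|S\|^2$ for all symmetric $S$. *)

(* Defs.v *)
From HB Require Import structures.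
From mathcomp Require Import all_boot all_order all_algebra.
From mathcomp Require Import all_classical all_reals all_analysis.

Set Implicit Arguments.
Unset Strict Implicit.
Unset Printing Implicit Defensive.

Import Order.TTheory GRing.Theory Num.Theory.
Import numFieldNormedType.Exports.

Local Open Scope classical_set_scope.
Local Open Scope ring_scope.

(* Points of the plane are pairs, so that the plane carries the product of two
   Lebesgue measures; values of vector and matrix fields are 'rV_2 and 'M_2.
   A Notation, so that the measure structure of the product is inferred. *)
Notation leb2 R :=
  (product_measure1 (@lebesgue_measure R) (@lebesgue_measure R)).

(** * Plane geometry *)

Definition segment (R : realType) (a b : R * R) : set (R * R) :=
  [set x | exists2 s : R, 0 <= s <= 1 &
    x = ((1 - s) * a.1 + s * b.1, (1 - s) * a.2 + s * b.2)].

Definition boundary (R : realType) (A : set (R * R)) : set (R * R) :=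
  closure A `\` A°.

(* (closure A)° = A rules out slits. *)
Definition polygonal_domain (R : realType) (A : set (R * R)) : Prop :=
  [/\ open A, A !=set0, connected A, (closure A)° = A &
      exists (m : nat) (a b : 'I_m -> R * R),
        boundary A = \bigcup_(i in [set: 'I_m]) segment (a i) (b i)].

Definition contractible (R : realType) (A : set (R * R)) : Prop :=
  exists2 a : R * R, A a &
  exists H : R * (R * R) -> R * R,
    [/\ {within [set s | (0 <= s.1 <= 1) /\ A s.2], continuous H},
        (forall s x, 0 <= s <= 1 -> A x -> A (H (s, x))),
        (forall x, A x -> H (0, x) = x) &
        (forall x, A x -> H (1, x) = a)].

(* Convex hull of the vertices v i, i in S, of a triangle v (empty if S is). *)
Definition face (R : realType) (v : 'I_3 -> R * R) (S : {set 'I_3}) :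
    set (R * R) :=
  [set x | exists l : 'I_3 -> R,
    [/\ forall i, 0 <= l i, forall i, i \notin S -> l i = 0, \sum_i l i = 1 &
        x = (\sum_i l i * (v i).1, \sum_i l i * (v i).2)]].

Definition triangle (R : realType) (v : 'I_3 -> R * R) : set (R * R) :=
  face v [set: 'I_3].

Definition nondegenerate (R : realType) (v : 'I_3 -> R * R) : Prop :=
  let v0 := v 0 in let v1 := v 1 in let v2 := v 2%:R in
  (v1.1 - v0.1) * (v2.2 - v0.2) - (v2.1 - v0.1) * (v1.2 - v0.2) != 0.

(* Two distinct triangles meet in a common proper face: the empty set, a common
   vertex or a common edge. *)
Definition conforming_triangulation (R : realType) (A : set (R * R))
    (n : nat) (T : 'I_n -> 'I_3 -> R * R) : Prop :=
  [/\ forall k, nondegenerate (T k),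
      closure A = \bigcup_(k in [set: 'I_n]) triangle (T k) &
      forall k l, k != l -> exists S S' : {set 'I_3},
        [/\ (#|S| <= 2)%N, (#|S'| <= 2)%N,
            triangle (T k) `&` triangle (T l) = face (T k) S &
            triangle (T k) `&` triangle (T l) = face (T l) S']].

(** * Lebesgue spaces and weak derivatives *)

(* Euclidean inner product (on rows) and Frobenius inner product. *)
Definition ip (R : realType) (m n : nat) (S T : 'M[R]_(m, n)) : R :=
  \sum_i \sum_j S i j * T i j.

Definition L2 (R : realType) (A : set (R * R)) (f : R * R -> R) : Prop :=
  measurable_fun (A : set (measurableTypeR R * measurableTypeR R)) f /\
  (leb2 R).-integrable A (fun x => (f x ^+ 2)%:E).

Definition L2mx (R : realType) (A : set (R * R)) (m n : nat)
    (f : R * R -> 'M[R]_(m, n)) : Prop :=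
  forall i j, L2 A (fun x => f x i j).

Definition L2norm (R : realType) (A : set (R * R)) (f : R * R -> R) : R :=
  Num.sqrt (\int[leb2 R]_(x in A) (f x ^+ 2)).

Definition L2mxnorm (R : realType) (A : set (R * R)) (m n : nat)
    (f : R * R -> 'M[R]_(m, n)) : R :=
  Num.sqrt (\int[leb2 R]_(x in A) ip (f x) (f x)).

Definition ae_eq_on (R : realType) (A : set (R * R)) (V : Type)
    (f g : R * R -> V) : Prop :=
  {ae leb2 R, forall x, A x -> f x = g x}.

Definition unitv (R : realType) (i : 'I_2) : R * R :=
  ((i == 0)%:R, (i == 1)%:R).

Definition partial (R : realType) (i : 'I_2) (f : R * R -> R) : R * R -> R :=
  fun x => 'D_(unitv R i) f x.

Definition smooth (R : realType) (f : R * R -> R) : Prop :=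
  forall s : seq 'I_2, let h := foldr (@partial R) f s in
    continuous h /\ forall x i, derivable h x (unitv R i).

(* C_c^infinity (A) *)
Definition test_function (R : realType) (A : set (R * R)) (f : R * R -> R) :
    Prop :=
  smooth f /\
  exists K : set (R * R), [/\ compact K, K `<=` A & forall x, ~ K x -> f x = 0].

Definition classical_grad (R : realType) (f : R * R -> R) (x : R * R) :
    'rV[R]_2 := \row_i partial i f x.

Definition is_weak_grad (R : realType) (A : set (R * R)) (u : R * R -> R)
    (d : R * R -> 'rV[R]_2) : Prop :=
  L2mx A d /\
  forall f, test_function A f -> forall i,
    \int[leb2 R]_(x in A) (u x * partial i f x) =
    - \int[leb2 R]_(x in A) (d x 0 i * f x).

Definition is_weak_div (R : realType) (A : set (R * R))
    (v : R * R -> 'rV[R]_2) (d : R * R -> R) : Prop :=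
  L2 A d /\
  forall f, test_function A f ->
    \int[leb2 R]_(x in A) ip (v x) (classical_grad f x) =
    - \int[leb2 R]_(x in A) (d x * f x).

(* Representatives of the weak gradient and divergence (unique up to null
   sets), and 0 when there is no square-integrable one. *)
Definition wgrad (R : realType) (A : set (R * R)) (u : R * R -> R) :
    R * R -> 'rV[R]_2 := xget (fun=> 0) [set d | is_weak_grad A u d].

Definition wdiv (R : realType) (A : set (R * R)) (v : R * R -> 'rV[R]_2) :
    R * R -> R := xget (fun=> 0) [set d | is_weak_div A v d].

Definition wDiv (R : realType) (A : set (R * R)) (M : R * R -> 'M[R]_2) :
    R * R -> 'rV[R]_2 :=
  fun x => \row_i wdiv A (fun y => row i (M y)) x.

Definition Hdiv (R : realType) (A : set (R * R)) (v : R * R -> 'rV[R]_2) :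
    Prop := L2mx A v /\ exists d, is_weak_div A v d.

Definition HsymDiv (R : realType) (A : set (R * R)) (M : R * R -> 'M[R]_2) :
    Prop :=
  [/\ L2mx A M, ae_eq_on A (fun x => (M x)^T) M &
      forall i, exists d, is_weak_div A (fun x => row i (M x)) d].

Definition H1norm (R : realType) (A : set (R * R)) (u : R * R -> R) : R :=
  Num.sqrt (L2norm A u ^+ 2 + L2mxnorm A (wgrad A u) ^+ 2).

Definition Hdivnorm (R : realType) (A : set (R * R))
    (v : R * R -> 'rV[R]_2) : R :=
  Num.sqrt (L2mxnorm A v ^+ 2 + L2norm A (wdiv A v) ^+ 2).

Definition HDivnorm (R : realType) (A : set (R * R))
    (M : R * R -> 'M[R]_2) : R :=
  Num.sqrt (L2mxnorm A M ^+ 2 + L2mxnorm A (wDiv A M) ^+ 2).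

(** * Finite element spaces *)

(* Polynomial functions of total degree at most k. *)
Definition poly2 (R : realType) (k : nat) (f : R * R -> R) : Prop :=
  exists c : nat -> nat -> R, forall x,
    f x = \sum_(i < k.+1) \sum_(j < (k - i).+1) c i j * x.1 ^+ i * x.2 ^+ j.

Definition Uh (R : realType) (A : set (R * R)) (n : nat)
    (T : 'I_n -> 'I_3 -> R * R) (p : nat) (u : R * R -> R) : Prop :=
  [/\ {within closure A, continuous u},
      forall k, exists2 P, poly2 p P & forall x, triangle (T k) x -> u x = P x &
      forall x, boundary A x -> u x = 0].

Definition Dh (R : realType) (A : set (R * R)) (n : nat)
    (T : 'I_n -> 'I_3 -> R * R) (k : nat) (u : R * R -> R) : Prop :=
  L2 A u /\
  forall l, exists2 P, poly2 k P & ae_eq_on (triangle (T l)) u P.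

Definition Dh2 (R : realType) (A : set (R * R)) (n : nat)
    (T : 'I_n -> 'I_3 -> R * R) (k : nat) (v : R * R -> 'rV[R]_2) : Prop :=
  forall j, Dh A T k (fun x => v x 0 j).

(* Hu-Zhang space. M is an L^2 class: its values at vertices are those of its
   polynomial restrictions P k, on which continuity at vertices is imposed. *)
Definition HZh (R : realType) (A : set (R * R)) (n : nat)
    (T : 'I_n -> 'I_3 -> R * R) (p : nat) (M : R * R -> 'M[R]_2) : Prop :=
  HsymDiv A M /\
  exists P : 'I_n -> R * R -> 'M[R]_2,
    [/\ forall k i j, poly2 p (fun x => P k x i j),
        forall k x, (P k x)^T = P k x,
        forall k, ae_eq_on (triangle (T k)) M (P k) &
        forall k l a b, T k a = T l b -> P k (T k a) = P l (T l b)].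

(* RTh k is the space whose local shape functions are [P^k]^2 + x P^k. *)
Definition RTh (R : realType) (A : set (R * R)) (n : nat)
    (T : 'I_n -> 'I_3 -> R * R) (k : nat) (v : R * R -> 'rV[R]_2) : Prop :=
  Hdiv A v /\
  forall l, exists (P : R * R -> 'rV[R]_2) (Q : R * R -> R),
    [/\ forall j, poly2 k (fun x => P x 0 j), poly2 k Q &
        ae_eq_on (triangle (T l)) v
          (fun x => P x + Q x *: \row_j (if j == 0 then x.1 else x.2))].

(** * The discrete problems *)

Definition compliance (R : realType) (E nu : R) (S : 'M[R]_2) : 'M[R]_2 :=
  (12%:R / E) *: ((1 + nu) *: S - (nu * \tr S)%:M).

(* The solution map is Lipschitz from L^2(A); "same" identifies functions that
   are equal as elements of the solution space. *)
Definition well_posed (R : realType) (A : set (R * R)) (V : zmodType)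
    (same : V -> V -> Prop) (nrm : V -> R)
    (solution : (R * R -> R) -> V -> Prop) : Prop :=
  [/\ forall g, L2 A g -> exists s, solution g s,
      forall g s s', L2 A g -> solution g s -> solution g s' -> same s s' &
      exists2 C : R, 0 <= C &
        forall g g' s s', L2 A g -> L2 A g' ->
          solution g s -> solution g' s' ->
          nrm (s - s') <= C * L2norm A (g - g')].

Definition three_type (R : realType) : zmodType :=
  ((R * R -> R) * (R * R -> 'rV[R]_2) * (R * R -> 'M[R]_2))%type.

Definition three_same (R : realType) (A : set (R * R)) (s s' : three_type R) :
    Prop :=
  let: (w, phi, M) := s in let: (w', phi', M') := s' in
  [/\ forall x, closure A x -> w x = w' x,
      ae_eq_on A phi phi' & ae_eq_on A M M'].

Definition three_norm (R : realType) (A : set (R * R)) (s : three_type R) : R :=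
  let: (w, phi, M) := s in
  H1norm A w + L2mxnorm A phi + HDivnorm A M.

Definition three_field_solution (R : realType) (A : set (R * R)) (n : nat)
    (T : 'I_n -> 'I_3 -> R * R) (p : nat) (E nu ksmu t : R)
    (g : R * R -> R) (s : three_type R) : Prop :=
  let: (w, phi, M) := s in
  [/\ [/\ Uh A T p w, Dh2 A T p.-1 phi & HZh A T p M],
      forall dM, HZh A T p dM ->
        \int[leb2 R]_(x in A)
          (ip (dM x) (compliance E nu (M x)) + ip (wDiv A dM x) (phi x)) = 0 &
      forall dw dphi, Uh A T p dw -> Dh2 A T p.-1 dphi ->
        \int[leb2 R]_(x in A)
          (ip (dphi x) (wDiv A M x)
           - ksmu / t ^+ 2
             * ip (wgrad A dw x - dphi x) (wgrad A w x - phi x)) =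
        - \int[leb2 R]_(x in A) (dw x * g x)].

Definition quad_type (R : realType) : zmodType :=
  ((R * R -> R) * (R * R -> 'rV[R]_2) * (R * R -> 'M[R]_2)
   * (R * R -> 'rV[R]_2))%type.

Definition quad_same (R : realType) (A : set (R * R)) (s s' : quad_type R) :
    Prop :=
  let: (w, phi, M, q) := s in let: (w', phi', M', q') := s' in
  [/\ ae_eq_on A w w', ae_eq_on A phi phi', ae_eq_on A M M' & ae_eq_on A q q'].

Definition quad_norm (R : realType) (A : set (R * R)) (s : quad_type R) : R :=
  let: (w, phi, M, q) := s in
  L2norm A w + L2mxnorm A phi + HDivnorm A M + Hdivnorm A q.

Definition quad_field_solution (R : realType) (A : set (R * R)) (n : nat)
    (T : 'I_n -> 'I_3 -> R * R) (p : nat) (E nu ksmu t : R)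
    (g : R * R -> R) (s : quad_type R) : Prop :=
  let: (w, phi, M, q) := s in
  [/\ [/\ Dh A T p.-1 w, Dh2 A T p.-1 phi, HZh A T p M & RTh A T p.-1 q],
      forall dM dq, HZh A T p dM -> RTh A T p.-1 dq ->
        \int[leb2 R]_(x in A)
          (ip (dM x) (compliance E nu (M x)) + t ^+ 2 / ksmu * ip (dq x) (q x)
           + ip (wDiv A dM x) (phi x) - wdiv A dq x * w x
           - ip (dq x) (phi x)) = 0 &
      forall dw dphi, Dh A T p.-1 dw -> Dh2 A T p.-1 dphi ->
        \int[leb2 R]_(x in A)
          (ip (dphi x) (wDiv A M x) - dw x * wdiv A q x - ip (dphi x) (q x)) =
        - \int[leb2 R]_(x in A) (dw x * g x)].

(* Main.v *)
(** Both problems are symmetric linear problems on finite-dimensional spaces, so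
    existence and continuous dependence follow from uniqueness. Testing a
    homogeneous solution with itself and using the coercivity of the compliance,
    one gets [M = 0] and a vanishing shear.

    In the three-field problem the rotation is then the gradient of [w], and the
    test tensor [w I], which is a Hu-Zhang field, gives [grad w = 0]; integrating
    the derivative of [w ^ 2 x1] gives [w = 0].

    In the quad-field problem it remains to show that a piecewise polynomial
    rotation orthogonal to all [Div dM], and a deflection orthogonal to all
    [div dq], vanish; no inf-sup constant is needed. Fields supported on one
    triangle, [dM = lam_i lam_j q t t^T] with [t] the edge from [v_i] to [v_j], have
    continuous normal components, and force the rotation to be a rigid motion on
    each triangle; similarly the deflection is constant on each triangle. Fields
    [lam_i ^ 2 lam_j S] with [S] constant, supported on the triangles sharing an
    edge, give two equations in the values at the ends of the edge, whose matrix
    with entries 3, 2, 2, 3 is nonsingular: if the solution vanishes on the other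
    triangles of the edge, it also does on this one. If it did not vanish
    identically, take a generic horizontal line through a triangle on which it does
    not vanish, and among such triangles the one that the line leaves last: the
    solution vanishes beyond the edge of exit, a contradiction.

    All integrations by parts reduce to: if a piecewise C1 function on
    non-overlapping triangles, extended by 0, is continuous on every generic line
    of direction [t], then the integrals of its derivative along [t] add up to 0
    (Fubini and the fundamental theorem of calculus on each line). *)

Require Import Defs.
From mathcomp Require Import all_boot all_order all_algebra.
From mathcomp Require Import all_classical all_reals all_analysis.
From mathcomp Require Import measurable_realfun.
From mathcomp Require Import ring lra.

Set Implicit Arguments.
Unset Strict Implicit.
Unset Printing Implicit Defensive.

Import Order.TTheory GRing.Theory Num.Theory.
Import numFieldNormedType.Exports.

Local Open Scope classical_set_scope.
Local Open Scope ring_scope.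

(** * Measure and continuity in the plane *)

(** Most unknowns are functions known only up to null sets, and [wdiv] and [wgrad] pick
    representatives; linearity and uniqueness of weak derivatives thus hold only almost everywhere,
    through the fundamental lemma of the calculus of variations. The algebra is arranged around
    this: the form sees an element only through L^2 products of finitely many scalar functions, and
    the Gram matrix is that of a family spanning modulo null elements. It may be singular; the
    system is solvable because the load annihilates its kernel.

    Continuity is asked on generic lines of direction [t], not across edges: the bubble lam_i lam_j
    q t t^T does jump across its edge, but the lines parallel to that edge do not cross it.

    The entries 3 and 2 are, up to a factor 60, the moments of s and 1 - s on an edge against the
    weight s^2 (1 - s). The weight has to vanish at both ends; a quadratic one would be symmetric
    and give one equation, while the cubic one gives a second equation when the ends are
    exchanged. *)

Notation plane R := (measurableTypeR R * measurableTypeR R)%type.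

Section RealContinuity.
Context {R : realType} {U : topologicalType}.
Implicit Types f g : U -> R.

Lemma continuousD_fun f g :
  continuous f -> continuous g -> continuous (fun x => f x + g x).
Proof. by move=> cf cg x; apply: cvgD; [exact: cf|exact: cg]. Qed.

Lemma continuousB_fun f g :
  continuous f -> continuous g -> continuous (fun x => f x - g x).
Proof. by move=> cf cg x; apply: cvgB; [exact: cf|exact: cg]. Qed.

Lemma continuousM_fun f g :
  continuous f -> continuous g -> continuous (fun x => f x * g x).
Proof. by move=> cf cg x; apply: cvgM; [exact: cf|exact: cg]. Qed.

Lemma continuousZ_fun (c : R) f :
  continuous f -> continuous (fun x => c * f x).
Proof. by move=> cf x; apply: cvgM; [exact: cvg_cst|exact: cf]. Qed.

Lemma continuous_sum (I : Type) (r : seq I) (P : pred I) (F : I -> U -> R) :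
  (forall i, continuous (F i)) ->
  continuous (fun x => \sum_(i <- r | P i) F i x).
Proof.
move=> cF; elim: r => [|i r IH].
  under eq_fun do rewrite big_nil; exact: cst_continuous.
under eq_fun do rewrite big_cons.
by case: (P i) => //; exact: continuousD_fun.
Qed.

End RealContinuity.

Section PlaneMeasure.
Context {R : realType}.

Definition open_box (a b : R * R) : set (R * R) :=
  [set x | (a.1 < x.1 < b.1) && (a.2 < x.2 < b.2)].

Definition closed_box (a b : R * R) : set (R * R) :=
  [set x | (a.1 <= x.1 <= b.1) && (a.2 <= x.2 <= b.2)].

Lemma open_box_closed (a b : R * R) : open_box a b `<=` closed_box a b.
Proof. by move=> x /andP[/andP[? ?] /andP[? ?]]; rewrite /closed_box /= !ltW. Qed.

Lemma open_boxE (a b : R * R) :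
  open_box a b = `]a.1, b.1[%classic `*` `]a.2, b.2[%classic.
Proof.
by apply/seteqP; split=> -[x y] /=; rewrite !in_itv /= /open_box /=;
  [move/andP|case=> -> ->].
Qed.

Lemma measurable_open_box (a b : R * R) :
  measurable (open_box a b : set (plane R)).
Proof. by rewrite open_boxE; apply: measurableX; exact: measurable_itv. Qed.

Lemma nbhs_open_box (x : R * R) (U : set (R * R)) : nbhs x U ->
  exists2 e : R, 0 < e & forall y, `|x.1 - y.1| < e -> `|x.2 - y.2| < e -> U y.
Proof.
move=> /nbhs_ballP[e /= e0 xeU]; exists e => // y y1 y2.
by apply: xeU; split.
Qed.

(** There are countably many boxes with rational corners. The closed box has to lie in [U] so that
    the bump functions of the open box have compact support in [U]. *)
Lemma open_rat_box (U : set (R * R)) : open U ->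
  U = \bigcup_(q : (rat * rat) * (rat * rat))
     (let B := open_box (ratr q.1.1, ratr q.1.2) (ratr q.2.1, ratr q.2.2) in
      if `[< closed_box (ratr q.1.1, ratr q.1.2) (ratr q.2.1, ratr q.2.2) `<=` U >]
      then B else set0).
Proof.
move=> oU; apply/seteqP; split=> [x Ux|x [q _] /=]; last first.
  by case: asboolP => // + /open_box_closed; apply.
have [e e0 H] := nbhs_open_box (open_nbhs_nbhs (conj oU Ux)).
have lo (c : R) : exists q : rat, c - e < ratr q < c.
  have /rat_in_itvoo[q] : c - e < c by rewrite ltrBlDr ltrDl.
  by rewrite in_itv /= => ?; exists q.
have hi (c : R) : exists q : rat, c < ratr q < c + e.
  have /rat_in_itvoo[q] : c < c + e by rewrite ltrDl.
  by rewrite in_itv /= => ?; exists q.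
have [a /andP[a1 a2]] := lo x.1; have [b /andP[b1 b2]] := lo x.2.
have [c /andP[c1 c2]] := hi x.1; have [d /andP[d1 d2]] := hi x.2.
exists ((a, b), (c, d)) => //=; case: asboolP => [_|].
  by rewrite /open_box /= a2 b2 c1 d1.
case=> y /andP[/= /andP[y1 y2] /andP[y3 y4]].
by apply: H; rewrite ltr_norml; lra.
Qed.

Lemma open_measurable2 (U : set (R * R)) :
  open U -> measurable (U : set (plane R)).
Proof.
move=> /open_rat_box ->; apply: countable_bigcupT_measurable => // q /=.
by case: ifP => _; [exact: measurable_open_box|exact: measurable0].
Qed.

Lemma closed_measurable2 (U : set (R * R)) :
  closed U -> measurable (U : set (plane R)).
Proof. by move=> /closed_openC/open_measurable2/measurableC; rewrite setCK. Qed.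

Lemma continuous_measurable2 (f : R * R -> R) :
  continuous f -> measurable_fun setT (f : plane R -> R).
Proof.
move=> /continuousP cf; apply: (measurability _ (RGenOpens.measurableE R)).
move=> _ [_ [a [b ->] <-]]; rewrite setTI; apply: open_measurable2.
exact/cf/interval_open.
Qed.

End PlaneMeasure.

Section BoundedSets.
Context {R : realType}.
Notation mu := (leb2 R).

Definition box (r : R) : set (R * R) :=
  [set x | (`|x.1| <= r) /\ (`|x.2| <= r)].

Lemma boxE (r : R) : box r = `[- r, r]%classic `*` `[- r, r]%classic.
Proof.
by apply/seteqP; split=> -[x y]; rewrite /box /= !in_itv /= -!ler_norml.
Qed.

Lemma box_compact (r : R) : compact (box r).
Proof. by rewrite boxE; apply: compact_setX; exact: segment_compact. Qed.

Lemma bounded_set_box (D : set (R * R)) :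
  bounded_set D -> exists2 r, 0 < r & D `<=` box r.
Proof.
move=> [M [Mr HM]]; exists (`|M| + 1) => [|x Dx].
  by rewrite (lt_le_trans ltr01)// lerDr.
have /HM /(_ x Dx) : M < `|M| + 1 by rewrite (le_lt_trans (ler_norm M))// ltrDl.
by rewrite /box /= prod_normE ge_max => /andP[].
Qed.

Lemma box_bounded (r : R) : bounded_set (box r).
Proof. exact/compact_bounded/box_compact. Qed.

Lemma measurable_box (r : R) : measurable (box r : set (plane R)).
Proof. by rewrite boxE; apply: measurableX; exact: measurable_itv. Qed.

Lemma mu_box_lty (r : R) : (mu (box r) < +oo)%E.
Proof.
rewrite boxE [X in (X < _)%E]product_measure1E//=.
rewrite lebesgue_measure_itv /= lte_fin.
by case: ifP => _; rewrite ?mul0e// -EFinD -EFinM ltry.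
Qed.

Lemma mu_bounded_lty (D : set (R * R)) :
  measurable (D : set (plane R)) -> bounded_set D -> (mu D < +oo)%E.
Proof.
move=> mD /bounded_set_box[r r0 Dr]; apply: le_lt_trans (mu_box_lty r).
by apply: le_measure => //; rewrite inE //; exact: measurable_box.
Qed.

Lemma continuous_bounded_box (f : R * R -> R) (r : R) : continuous f ->
  exists M, forall x, box r x -> `|f x| <= M.
Proof.
move=> cf; have /compact_bounded : compact (f @` box r).
  by apply: continuous_compact (@box_compact r); exact: continuous_subspaceT.
move=> [M [Mr HM]]; exists (M + 1) => x xr; apply: (HM (M + 1)).
  by rewrite ltrDl.
by exists x.
Qed.

Lemma integrable_continuous (D : set (R * R)) (f : R * R -> R) :
  measurable (D : set (plane R)) -> bounded_set D -> continuous f ->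
  mu.-integrable D (EFin \o f).
Proof.
move=> mD bD cf; apply: measurable_bounded_integrable => //.
- exact: mu_bounded_lty.
- by apply: measurable_funTS; exact: continuous_measurable2.
- have [r r0 Dr] := bounded_set_box bD.
  have [M HM] := continuous_bounded_box r cf.
  exists M; split; first exact: num_real.
  by move=> N MN x /Dr /HM /le_trans; apply; exact: ltW.
Qed.

(** A neighbourhood contains a box of positive measure, which no null set can contain. This turns
    almost everywhere identities of continuous functions into pointwise ones. *)
Lemma open_not_negligible (N U : set (R * R)) (x : R * R) :
  mu.-negligible N -> nbhs x U -> exists2 y, U y & ~ N y.
Proof.
move=> [B [mB B0 NB]] /nbhs_open_box[e e0 xeU]; apply: contrapT => H.
pose Q := open_box (x.1 - e, x.2 - e) (x.1 + e, x.2 + e).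
have QB : Q `<=` B.
  move=> y /andP[/= /andP[y1 y2] /andP[y3 y4]]; apply: NB.
  apply: contrapT => Ny; apply: H; exists y => //.
  by apply: xeU; rewrite ltr_norml; lra.
have : (mu Q <= mu B)%E.
  by apply: le_measure => //; rewrite inE //; exact: measurable_open_box.
rewrite B0 /Q open_boxE [X in (X <= _)%E]product_measure1E//= !lebesgue_measure_itv /=.
rewrite !lte_fin !ifT; [|lra|lra].
by rewrite -!EFinD -EFinM lee_fin leNgt mulr_gt0//; lra.
Qed.

End BoundedSets.

Section Lines.
Context {R : realType}.
Notation mu := (leb2 R).
Notation leb := (@lebesgue_measure R).

Definition shear (c : R) (x : R * R) : R * R := (x.1, x.2 + c * x.1).

Lemma measurable_shear (c : R) :
  measurable_fun setT (shear c : plane R -> plane R).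
Proof.
apply/measurable_fun_pairP; split; first exact: measurable_fst.
apply: measurable_funD; first exact: measurable_snd.
by apply: measurable_funM => //; exact: measurable_fst.
Qed.

Lemma measurable_shift (c : R) :
  measurable_fun setT ((fun x => x + c) : measurableTypeR R -> measurableTypeR R).
Proof. exact: measurable_funD. Qed.

Lemma lebesgue_shift (c : R) (A : set (measurableTypeR R)) : measurable A ->
  leb [set x | A (x + c)] = leb A.
Proof.
move=> mA.
pose f : measurableTypeR R -> measurableTypeR R := fun x => x + c.
pose F : {mfun measurableTypeR R >-> measurableTypeR R} := 
  MeasurableFun.Pack (MeasurableFun.Class (isMeasurableFun.Build _ _ _ _ f (measurable_shift c))).
rewrite -[LHS]/(pushforward leb F A).
symmetry; apply: (@lebesgue_measure_unique _ (pushforward leb F)) => // X.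
case=> -[a b] /= _ <-.
rewrite /pushforward.
have -> : F @^-1` `]a, b]%classic = `]a - c, b - c]%classic.
  by apply/seteqP; split=> x /=; rewrite !in_itv /= /f ltrBlDr lerBrDr.
rewrite !lebesgue_measure_itv /= !lte_fin ltrD2r; case: ifP => // _.
by rewrite -!EFinD; congr (_%:E); ring.
Qed.

(** A product measure is determined by its values on rectangles, and the vertical sections of a
    sheared rectangle are translates of one of its sides. *)
Lemma mu_shear (c : R) (A : set (R * R)) : measurable (A : set (plane R)) ->
  mu [set x | A (shear c x)] = mu A.
Proof.
move=> mA.
pose F : {mfun plane R >-> plane R} := 
  MeasurableFun.Pack (MeasurableFun.Class (isMeasurableFun.Build _ _ _ _ _ (measurable_shear c))).
rewrite -[LHS]/(pushforward mu F A).
symmetry; apply: (@product_measure_unique _ _ _ _ R leb leb (pushforward mu F)) => // X Y mX mY.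
rewrite /pushforward /product_measure1.
transitivity (\int[leb]_x ((\1_X x)%:E * leb Y))%E.
  apply: eq_integral => x _ /=; rewrite indicE.
  case: (boolP (x \in X)) => xX; rewrite ?mul1e ?mul0e.
    rewrite -(lebesgue_shift (c * x) mY); congr (leb _).
    apply/seteqP; split=> y; rewrite /xsection /= inE /=.
      by case.
    by rewrite inE in xX; split.
  rewrite (_ : xsection _ _ = set0) ?measure0//; apply/seteqP; split => // y.
  by rewrite /xsection /= inE /= => -[xX' _]; move: xX; rewrite notin_setE.
rewrite ge0_integralZr ?integral_indic ?setIT//; exact: measurableT_comp.
Qed.

(** The shear carries horizontal lines to lines of slope [c], so that Fubini applies along these
    without a general change of variables. *)
Lemma integral_shear (c : R) (g : R * R -> \bar R) :
  mu.-integrable setT g ->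
  mu.-integrable setT (g \o shear c) /\
  (\int[mu]_x g x = \int[mu]_x (g (shear c x)))%E.
Proof.
move=> ig; have mg : measurable_fun setT (g : plane R -> _) by exact: measurable_int ig.
pose F : {mfun plane R >-> plane R} := 
  MeasurableFun.Pack (MeasurableFun.Class (isMeasurableFun.Build _ _ _ _ _ (measurable_shear c))).
have E (h : plane R -> \bar R) : (\int[pushforward mu F]_x h x = \int[mu]_x h x)%E.
  by apply: eq_measure_integral => A mA _; exact: mu_shear.
have igs : mu.-integrable setT (g \o shear c).
  apply/integrableP; split.
    by apply: measurableT_comp => //; exact: measurable_shear.
  have /integrableP[_] := ig; rewrite -E ge0_integral_pushforward//.
  exact: measurableT_comp.
split => //; rewrite -E integral_pushforward//.
Qed.

Lemma negligible_line (t : R * R) (c : R) : t != 0 ->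
  mu.-negligible [set z : R * R | t.1 * z.2 - t.2 * z.1 = c].
Proof.
move=> t0.
have mL : measurable ([set z : R * R | t.1 * z.2 - t.2 * z.1 = c] : set (plane R)).
  apply: closed_measurable2.
  have cf : continuous (fun z : R * R => t.1 * z.2 - t.2 * z.1).
    by move=> z; apply: cvgB; (apply: cvgM; first exact: cvg_cst);
     [exact: cvg_snd|exact: cvg_fst].
  rewrite -[X in closed X]/((fun z : R * R => t.1 * z.2 - t.2 * z.1) @^-1` [set c]).
  by apply: closed_comp => [x _|]; [exact: cf|exact: closed_eq].
apply/negligibleP => //.
have [t1|t1] := eqVneq t.1 0.
  have t2 : t.2 != 0.
    apply: contra_neq t0 => t2; case: (t) t1 t2 => a b /= -> -> //.
  rewrite (_ : mkset _ = [set - c / t.2] `*` setT); last first.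
    apply/seteqP; split=> -[x y] /=; rewrite t1 mul0r sub0r.
      by move=> <-; split => //; rewrite opprK mulrAC divff// mul1r.
    by move=> [-> _]; rewrite mulrCA divff// mulr1 opprK.
  by rewrite [LHS]product_measure1E//= lebesgue_measure_set1 mul0e.
rewrite /= /product_measure1 integral0_eq// => x _ /=.
rewrite (_ : xsection _ _ = [set (c + t.2 * x) / t.1]) ?lebesgue_measure_set1//.
apply/seteqP; split=> y; rewrite /xsection /= inE /=.
  by move=> <-; rewrite subrK mulrAC divff// mul1r.
by move=> ->; rewrite mulrCA divff// mulr1 addrK.
Qed.

(* [t.1 * z.2 - t.2 * z.1] identifies the line of direction [t] through [z]. *)
Lemma integral_lines0 (t : R * R) (F : set R) (g : R * R -> R) :
  t.1 = 1 \/ t = (0, 1) -> finite_set F ->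
  mu.-integrable setT (EFin \o g) ->
  (forall z, ~ F (t.1 * z.2 - t.2 * z.1) ->
    (\int[leb]_s (g (z.1 + s * t.1, z.2 + s * t.2)%R)%:E = 0)%E) ->
  (\int[mu]_x (g x)%:E = 0)%E.
Proof.
move=> tE fF ig H.
(* Fubini leaves an inner integral that vanishes for all but finitely many lines, hence for almost
   all of them. *)
have null (f : measurableTypeR R -> \bar R) (G : set R) :
    finite_set G -> measurable_fun setT f -> (forall y, ~ G y -> f y = 0) ->
    (\int[leb]_y f y = 0)%E.
  move=> fG mf Gf; have cG := finite_set_countable fG.
  rewrite (@ae_eq_integral _ _ _ leb setT (cst 0%E))//; first exact: integral0.
  exists G; split; [exact: countable_measurable cG|exact: countable_lebesgue_measure0|].
  by move=> y /= H'; apply: contrapT => /Gf /esym ?; apply: H'.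
case: tE => [t1|tE].
  have [igs ->] := integral_shear t.2 ig.
  rewrite -[LHS]integral21_prod_meas1//.
  apply: (null _ F) => //; first exact: (measurable_fubini_G igs).
  move=> y Fy; rewrite -[RHS](H (0, y)); last by rewrite t1 mul1r mulr0 subr0.
  by apply: eq_integral => s _; rewrite /= /shear /= t1 add0r mulr1 mulrC.
rewrite -[LHS]integral12_prod_meas1//.
apply: (null _ (-%R @` F)); first exact: finite_image.
  exact: (measurable_fubini_F ig).
move=> x Fx; rewrite -[RHS](H (x, 0)); rewrite tE /=.
  by apply: eq_integral => s _; rewrite mulr0 addr0 mulr1 add0r.
by rewrite mul0r mul1r sub0r => Fx'; apply: Fx; exists (- x) => //; rewrite opprK.
Qed.

End Lines.

(** * Functions of one real variable *)

Section RealLine.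
Context {R : realType}.
Notation leb := (@lebesgue_measure R).

Lemma exists_notin_finite (Z : set R) (a b : R) : a < b -> finite_set Z ->
  exists2 c, a < c < b & ~ Z c.
Proof.
move=> ab fZ; apply: contrapT => H.
have cZ := finite_set_countable fZ.
have mZ : measurable (Z : set (measurableTypeR R)) by exact: countable_measurable.
have : (leb `]a, b[%classic <= leb Z)%E.
  apply: le_measure; rewrite ?inE//.
  move=> c /=; rewrite in_itv /= => abc; apply: contrapT => Zc.
  by apply: H; exists c.
rewrite [leRHS]countable_lebesgue_measure0// [leLHS]lebesgue_measure_itv /= lte_fin ab.
by rewrite -EFinD lee_fin; lra.
Qed.

Lemma constant_off_finite (K : R -> R) (Z : set R) : finite_set Z ->
  continuous K -> (forall x, ~ Z x -> \forall y \near x, K y = K x) ->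
  forall x y, K x = K y.
Proof.
move=> fZ cK lK.
suff H x y : x <= y -> K x = K y.
  by move=> x y; case: (leP x y) => [|/ltW] /H.
move=> xy; have [//|Kxy] := eqVneq (K x) (K y).
have mM : Num.min (K x) (K y) < Num.max (K x) (K y).
  by case: (ltgtP (K x) (K y)) Kxy.
have [c /andP[c1 c2] Zc] := exists_notin_finite mM (finite_image K fZ).
have [s _ Ksc] : exists2 s, s \in `[x, y] & K s = c.
  apply: IVT => //; first exact: continuous_subspaceT.
  by rewrite !ltW.
have KcE : K @^-1` [set c] = [set: R].
  have /(_ (K @^-1` [set c])) H : connected [set: R].
    by apply/connected_intervalP => ? ? _ _ ? _.
  apply: H; first by exists s.
    exists (K @^-1` [set c]); last by rewrite setTI.
    rewrite openE => u /= Kuc; rewrite /interior /=.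
    have Zu : ~ Z u by move=> Zu; apply: Zc; exists u.
    by apply: filterS (lK u Zu) => w /= ->.
  exists (K @^-1` [set c]); last by rewrite setTI.
  by apply: closed_comp => [? _|]; [exact: cK|exact: closed_eq].
have Kx : K x = c by rewrite -[_ = _]/((K @^-1` [set c]) x) KcE.
have Ky : K y = c by rewrite -[_ = _]/((K @^-1` [set c]) y) KcE.
by rewrite Kx Ky.
Qed.

Lemma FTC_segment (H D : R -> R) (a b : R) : a <= b ->
  (forall s : R, is_derive s 1 H (D s)) -> continuous D ->
  (\int[leb]_(s in `[a, b]) (D s)%:E = (H b - H a)%:E)%E.
Proof.
move=> ab dH cD; move: ab; rewrite le_eqVlt => /predU1P[->|ab].
  by rewrite subrr set_itv1 integral_set1.
have cH : continuous H.
  by move=> s; apply: differentiable_continuous; apply/derivable1_diffP.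
rewrite (@continuous_FTC2 _ D H a b ab)//.
- exact: continuous_subspaceT.
- split=> //; [exact/cvg_at_right_filter/cH|exact/cvg_at_left_filter/cH].
- by move=> s _; rewrite derive1E derive_val.
Qed.

Definition clamp (a b x : R) := Num.min (Num.max x a) b.

Lemma continuous_clamp (a b : R) : continuous (clamp a b).
Proof.
move=> x; apply: (@continuous_min _ _ (fun x => Num.max x a) (cst b)).
  by apply: (@continuous_max _ _ id (cst a)) => //; exact: cvg_cst.
exact: cvg_cst.
Qed.

Lemma clamp_near (a b x : R) : a <= b -> x != a -> x != b ->
  \forall y \near x, clamp a b y = if a < x < b then y else clamp a b x.
Proof.
move=> ab xa xb.
have [ax|xa'] := ltP a x.
  have [bx|xb'] := ltP x b.
    near=> y; rewrite /clamp /=.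
    have ya : a < y by near: y; exact: lt_nbhsr.
    have yb : y < b by near: y; exact: lt_nbhsl.
    by rewrite (max_idPl _) ?ltW// (min_idPl _) ?ltW.
  near=> y.
  have yb : b < y by near: y; apply: lt_nbhsr; rewrite lt_neqAle eq_sym xb.
  rewrite /clamp /= (max_idPl _) ?(le_trans ab (ltW yb))//.
  by rewrite (min_idPr _) ?ltW// (max_idPl _) ?ltW// (min_idPr _).
near=> y.
have ya : y < a by near: y; apply: lt_nbhsl; rewrite lt_neqAle xa.
by rewrite /clamp /= (max_idPr _) ?ltW// (max_idPr _).
Unshelve. all: by end_near. Qed.

Lemma near_ord (n : nat) (x : R) (P : 'I_n -> R -> Prop) :
  (forall k, \forall y \near x, P k y) -> \forall y \near x, forall k, P k y.
Proof. by move=> H; exact: (@filter_forall _ 'I_n P (nbhs x) _ H). Qed.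

(** Let [G x] be the sum of the increments of [F] over the parts of the intervals to the left of
    [x]. Then [F - G] is locally constant away from the end points, hence constant, and [F] vanishes
    far to the left and far to the right. No ordering of the intervals is required. *)
Lemma telescope_intervals (n : nat) (a b : 'I_n -> R) (F : R -> R) :
  continuous F ->
  (forall s, (forall k, ~~ (a k <= s <= b k)) -> F s = 0) ->
  (forall k l s s', k != l -> a k <= s <= b k -> a l <= s <= b l ->
    a k <= s' <= b k -> a l <= s' <= b l -> s = s') ->
  \sum_(k | a k <= b k) (F (b k) - F (a k)) = 0.
Proof.
move=> cF F0 disj.
pose G x := \sum_(k | a k <= b k) (F (clamp (a k) (b k) x) - F (a k)).
have cG : continuous G.
  apply: continuous_sum => k; apply: continuousB_fun; last exact: cst_continuous.
  by move=> x; apply: continuous_comp; [exact: continuous_clamp|exact: cF].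
pose K x := F x - G x.
have cK : continuous K by move=> x; apply: cvgB; [exact: cF|exact: cG].
pose Z := [set x | exists k, x = a k \/ x = b k].
have fZ : finite_set Z.
  rewrite (_ : Z = range a `|` range b); last first.
    apply/seteqP; split=> x /=.
      by move=> [k [->|->]]; [left; exists k|right; exists k].
    by move=> [[k _ <-]|[k _ <-]]; exists k; [left|right].
  by rewrite finite_setU; split; exact: finite_image.
have lK x : ~ Z x -> \forall y \near x, K y = K x.
  move=> Zx.
  have xa k : x != a k by apply: contra_notN Zx => /eqP->; exists k; left.
  have xb k : x != b k by apply: contra_notN Zx => /eqP->; exists k; right.
  have clampN : \forall y \near x, forall k, a k <= b k ->
      clamp (a k) (b k) y = if a k < x < b k then y else clamp (a k) (b k) x.
    apply: near_ord => k; case: (boolP (a k <= b k)) => [akb|_].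
      by apply: filterS (clamp_near akb (xa k) (xb k)) => y ->.
    by near=> y.
  (* Either [x] is interior to exactly one interval, and [F] and [G] vary together, or to none, and
     near [x] the function [F] is 0 and [G] is constant. *)
  have [[k0 /andP[ak0 bk0]]|noin] := pselect (exists k, a k < x < b k).
    have uniq l : l != k0 -> ~~ (a l < x < b l).
      move=> lk; apply/negP => /andP[al bl].
      (* The smaller right end and [x] would be two distinct common points of the intervals. *)
      have [e1 e1E] : exists e, e = Num.min (b l) (b k0) by eexists.
      have xe1 : x < e1 by rewrite e1E lt_min bl bk0.
      have : x = e1.
        apply: (disj l k0) => //; rewrite ?(ltW al) ?(ltW bl) ?(ltW ak0) ?(ltW bk0)//=.
          by rewrite (le_trans (ltW al) (ltW xe1)) e1E ge_min lexx.
        by rewrite (le_trans (ltW ak0) (ltW xe1)) e1E ge_min lexx orbT.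
      by move: xe1 => /[swap] <-; rewrite ltxx.
    have akb0 : a k0 <= b k0 by rewrite ltW// (lt_trans ak0).
    near=> y; rewrite /K /G (bigD1 k0)//= [in RHS](bigD1 k0)//=.
    have cN : forall k, a k <= b k ->
      clamp (a k) (b k) y = if a k < x < b k then y else clamp (a k) (b k) x.
      by near: y.
    rewrite cN// ak0 bk0 /=.
    have -> : clamp (a k0) (b k0) x = x.
      by rewrite /clamp (max_idPl _) ?ltW// (min_idPl _) ?ltW.
    under eq_bigr => k /andP[akb kk0] do rewrite cN// (negbTE (uniq k kk0)).
    by rewrite !opprD !addrA !subrr.
  have no k : ~~ (a k < x < b k) by apply/negP => kx; apply: noin; exists k.
  near=> y; rewrite /K /G.
  have cN : forall k, a k <= b k ->
      clamp (a k) (b k) y = if a k < x < b k then y else clamp (a k) (b k) x.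
    by near: y.
  congr (_ - _); last first.
    by apply: eq_bigr => k akb; rewrite cN// (negbTE (no k)).
  rewrite [in RHS]F0; last first.
    by move=> k; have := no k; rewrite !lt_neqAle (eq_sym _ x) xa xb.
  apply: F0; near: y; apply: near_ord => k.
  have := no k; rewrite !lt_neqAle (eq_sym _ x) xa xb /= negb_and -!ltNge.
  case/orP => xk; near=> y; rewrite negb_and -!ltNge; apply/orP.
    by left; near: y; exact: lt_nbhsl.
  by right; near: y; exact: lt_nbhsr.
(* [m] and [M] lie to the left and to the right of all the intervals. *)
pose m := - \sum_k (`|a k| + `|b k|) - 1.
pose M := \sum_k (`|a k| + `|b k|) + 1.
have le_sum k : `|a k| + `|b k| <= \sum_k (`|a k| + `|b k|).
  by rewrite (bigD1 k)//= lerDl sumr_ge0// => l _; rewrite addr_ge0.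
have ma k : m < a k.
  have := le_sum k; have := normr_ge0 (b k); have := lerNnormlW (lexx `|a k|).
  by rewrite /m; lra.
have bM k : b k < M.
  have := le_sum k; have := normr_ge0 (a k); have := ler_norm (b k).
  by rewrite /M; lra.
have aM k : a k < M.
  have := le_sum k; have := normr_ge0 (b k); have := ler_norm (a k).
  by rewrite /M; lra.
have := constant_off_finite fZ cK lK m M.
rewrite /K (F0 m) ?(F0 M); last 2 first.
- by move=> k; rewrite negb_and -!ltNge bM orbT.
- by move=> k; rewrite negb_and -!ltNge ma.
rewrite !sub0r => /oppr_inj; rewrite {1}/G big1 => [|k akb]; last first.
  by rewrite /clamp (max_idPr _) ?(ltW (ma k))// (min_idPl _)// subrr.
move=> E; rewrite [RHS]E; apply: eq_bigr => k akb.
by rewrite /clamp (max_idPl _) ?(ltW (aM k))// (min_idPr _)// ltW.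
Unshelve. all: by end_near. Qed.

End RealLine.

(** * Barycentric coordinates *)

Notation nondeg := Defs.nondegenerate.

Section Triangles.
Context {R : realType}.
Notation mu := (leb2 R).
Implicit Types (v : 'I_3 -> R * R) (x y t : R * R).

Lemma ord3P (P : 'I_3 -> Prop) : P 0 -> P 1 -> P 2%:R -> forall i, P i.
Proof.
move=> P0 P1 P2 [[|[|[|//]]] i3].
- by rewrite (_ : Ordinal _ = 0)//; exact/val_inj.
- by rewrite (_ : Ordinal _ = 1)//; exact/val_inj.
- by rewrite (_ : Ordinal _ = 2%:R)//; exact/val_inj.
Qed.

Lemma sum3E (F : 'I_3 -> R) : \sum_i F i = F 0 + F 1 + F 2%:R.
Proof.
rewrite !big_ord_recr big_ord0 /= add0r.
by congr (F _ + F _ + F _); exact/val_inj.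
Qed.

Definition dot (x y : R * R) : R := x.1 * y.1 + x.2 * y.2.

(** Twice the signed area of the triangle. *)
Definition tdet v : R :=
  ((v 1).1 - (v 0).1) * ((v 2%:R).2 - (v 0).2)
  - ((v 2%:R).1 - (v 0).1) * ((v 1).2 - (v 0).2).

(* Barycentric coordinates of a triangle and their (constant) gradients. *)
Definition dlam v (i : 'I_3) : R * R :=
  let p := v (i + 1) in let q := v (i + 2%:R) in
  ((p.2 - q.2) / tdet v, (q.1 - p.1) / tdet v).

Definition lam v (i : 'I_3) x : R :=
  let p := v (i + 1) in let q := v (i + 2%:R) in
  (p.1 * q.2 - p.2 * q.1) / tdet v + dot (dlam v i) x.

Lemma ord3_add01 : (0 + 1 : 'I_3) = 1. Proof. exact/val_inj. Qed.
Lemma ord3_add02 : (0 + 2%:R : 'I_3) = 2%:R. Proof. exact/val_inj. Qed.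
Lemma ord3_add11 : (1 + 1 : 'I_3) = 2%:R. Proof. exact/val_inj. Qed.
Lemma ord3_add12 : (1 + 2%:R : 'I_3) = 0. Proof. exact/val_inj. Qed.
Lemma ord3_add21 : (2%:R + 1 : 'I_3) = 0. Proof. exact/val_inj. Qed.
Lemma ord3_add22 : (2%:R + 2%:R : 'I_3) = 1. Proof. exact/val_inj. Qed.
Definition ord3_add := (ord3_add01, ord3_add02, ord3_add11, ord3_add12,
  ord3_add21, ord3_add22).

Lemma lam_line v i x t (s : R) :
  lam v i (x.1 + s * t.1, x.2 + s * t.2) = lam v i x + s * dot (dlam v i) t.
Proof. by rewrite /lam /dot /=; ring. Qed.

Lemma lam_sub v i x y : lam v i y - lam v i x = dot (dlam v i) (y.1 - x.1, y.2 - x.2).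
Proof. by rewrite /lam /dot /=; ring. Qed.

Lemma continuous_lam v i : continuous (lam v i).
Proof.
apply: continuousD_fun; first exact: cst_continuous.
apply: continuousD_fun; apply: continuousZ_fun => x; [exact: cvg_fst|exact: cvg_snd].
Qed.

Lemma nondegP v : nondeg v = (tdet v != 0 : bool).
Proof. by []. Qed.

Lemma lam_sum v x : nondeg v -> \sum_i lam v i x = 1.
Proof.
rewrite nondegP => v0; rewrite sum3E /lam /dlam /dot !ord3_add /=.
by move: v0; rewrite /tdet => v0; field.
Qed.

Lemma dlam_sum v : nondeg v ->
  \sum_i (dlam v i).1 = 0 /\ \sum_i (dlam v i).2 = 0.
Proof.
rewrite nondegP => v0; rewrite !sum3E /dlam !ord3_add /=.
by move: v0; rewrite /tdet => v0; split; field.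
Qed.

Lemma lam_vertex v i j : nondeg v -> lam v i (v j) = (i == j)%:R.
Proof.
rewrite nondegP => v0; move: j; apply: ord3P; move: i; apply: ord3P;
  rewrite /lam /dlam /dot !ord3_add /=; move: v0; rewrite /tdet => v0; by field.
Qed.

Lemma lam_combination v x : nondeg v ->
  x = (\sum_i lam v i x * (v i).1, \sum_i lam v i x * (v i).2).
Proof.
rewrite nondegP => v0; rewrite !sum3E /lam /dlam /dot !ord3_add /=.
case: x => x1 x2 /=; move: v0; rewrite /tdet => v0.
by congr (_, _); field.
Qed.

Lemma lam_affine v i (l : 'I_3 -> R) (p : 'I_3 -> R * R) : \sum_j l j = 1 ->
  lam v i (\sum_j l j * (p j).1, \sum_j l j * (p j).2) = \sum_j l j * lam v i (p j).
Proof.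
rewrite !sum3E => l1; rewrite /lam /dot /=.
have -> : l 0 = 1 - l 1 - l 2%:R by rewrite -l1; ring.
ring.
Qed.

Lemma lam_unique v i (l : 'I_3 -> R) : nondeg v -> \sum_j l j = 1 ->
  lam v i (\sum_j l j * (v j).1, \sum_j l j * (v j).2) = l i.
Proof.
move=> v0 l1; rewrite lam_affine// (bigD1 i)//= big1 ?addr0.
  by rewrite lam_vertex// eqxx mulr1.
by move=> j ji; rewrite lam_vertex// eq_sym (negbTE ji) mulr0.
Qed.

Lemma lam_inj v x y : nondeg v -> (forall i, lam v i x = lam v i y) -> x = y.
Proof.
move=> v0 xy; rewrite (lam_combination x v0) (lam_combination y v0).
by under eq_bigr do rewrite xy; under [in X in (_, X)]eq_bigr do rewrite xy.
Qed.

Lemma faceE v (S : {set 'I_3}) : nondeg v ->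
  face v S = [set x | (forall i, 0 <= lam v i x) /\
                      (forall i, i \notin S -> lam v i x = 0)].
Proof.
move=> v0; apply/seteqP; split=> [x [l [l0 lS l1 ->]]|x [x0 xS]] /=.
  by split=> i; rewrite lam_unique//; exact: lS.
exists (fun i => lam v i x); split=> //; first exact: lam_sum.
exact: lam_combination.
Qed.

Lemma triangleE v : nondeg v ->
  triangle v = [set x | forall i, 0 <= lam v i x].
Proof.
move=> v0; rewrite /triangle faceE//; apply/seteqP; split=> [x []//|x x0].
by split=> // i; rewrite inE.
Qed.

Lemma vertex_triangle v i : nondeg v -> triangle v (v i).
Proof. by move=> v0; rewrite triangleE// => j; rewrite lam_vertex// ler0n. Qed.

Lemma continuous_pair (U : topologicalType) (f g : U -> R) :
  continuous f -> continuous g -> continuous (fun x : U => (f x, g x)).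
Proof. by move=> cf cg x; exact: (cvg_pair (cf x) (cg x)). Qed.

Lemma continuous_line x t :
  continuous (fun s : R => (x.1 + s * t.1, x.2 + s * t.2)).
Proof.
apply: continuous_pair; (apply: continuousD_fun; first exact: cst_continuous);
  by apply: continuousM_fun; [move=> s; exact: cvg_id|exact: cst_continuous].
Qed.

Lemma bounded_setS (A B : set (R * R)) :
  A `<=` B -> bounded_set B -> bounded_set A.
Proof.
by move=> AB [M [Mr HM]]; exists M; split=> // N MN x /AB; exact: HM.
Qed.

Lemma triangle_closed v : nondeg v -> closed (triangle v).
Proof.
move=> v0; rewrite triangleE//.
rewrite (_ : mkset _ = \bigcap_(i in [set: 'I_3]) (lam v i @^-1` [set y | 0 <= y])).
  apply: closed_bigI => i _; apply: closed_comp => [x _|]; [exact: continuous_lam|].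
  exact: closed_ge.
by apply/seteqP; split=> [x H i _|x H i]; [exact: (H i)|exact: (H i I)].
Qed.

Lemma measurable_triangle v : nondeg v ->
  measurable (triangle v : set (plane R)).
Proof. by move=> v0; exact: (closed_measurable2 (triangle_closed v0)). Qed.

Lemma triangle_bounded v : nondeg v -> bounded_set (triangle v).
Proof.
move=> v0; rewrite triangleE//.
pose r := \sum_i (`|(v i).1| + `|(v i).2|).
apply: bounded_setS (@box_bounded R r) => x /= x0.
have lam1 i : lam v i x <= 1.
  rewrite -(lam_sum x v0) (bigD1 i)//= lerDl; exact: sumr_ge0.
split.
  rewrite {1}(lam_combination x v0) /=; apply: (le_trans (ler_norm_sum _ _ _)).
  apply: ler_sum => i _; rewrite normrM ger0_norm// -[leRHS]addr0.
  apply: le_trans (_ : 1 * `|(v i).1| <= _); first exact: ler_wpM2r.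
  by rewrite mul1r addr0 lerDl.
rewrite {1}(lam_combination x v0) /=; apply: (le_trans (ler_norm_sum _ _ _)).
apply: ler_sum => i _; rewrite normrM ger0_norm//.
apply: le_trans (_ : 1 * `|(v i).2| <= _); first exact: ler_wpM2r.
by rewrite mul1r lerDr.
Qed.

Lemma triangle_interior v x : nondeg v -> (forall i, 0 < lam v i x) ->
  nbhs x (triangle v).
Proof.
move=> v0 x0; rewrite triangleE//.
have : forall i : 'I_3, nbhs x [set y | 0 <= lam v i y].
  move=> i; have /cvgr_gt /(_ _ (x0 i)) := @continuous_lam v i x.
  by apply: filterS => y; exact: ltW.
by move=> /(@filter_forall _ 'I_3 (fun i y => 0 <= lam v i y) (nbhs x) _).
Qed.

Definition center v : R * R :=
  (\sum_i 3^-1 * (v i).1, \sum_i 3^-1 * (v i).2).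

Lemma lam_center v i : nondeg v -> lam v i (center v) = 3^-1.
Proof.
move=> v0; rewrite (lam_unique i (l := fun=> 3^-1))// sum3E.
by field.
Qed.

Lemma triangle_convex v x y (s : R) : nondeg v -> triangle v x ->
  triangle v y -> 0 <= s <= 1 ->
  triangle v (x.1 + s * (y.1 - x.1), x.2 + s * (y.2 - x.2)).
Proof.
move=> v0; rewrite triangleE//= => x0 y0 /andP[s0 s1] i.
rewrite (lam_line v i x (y.1 - x.1, y.2 - x.2)) -lam_sub.
rewrite (_ : _ + _ = (1 - s) * lam v i x + s * lam v i y); last by ring.
by rewrite addr_ge0// mulr_ge0// subr_ge0.
Qed.

(* Every point of the triangle is a limit of interior points. *)
Lemma continuous_ae0_triangle v (F : R * R -> R) x : nondeg v ->
  continuous F -> ae_eq_on (triangle v) F (fun=> 0) -> triangle v x -> F x = 0.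
Proof.
move=> v0 cF F0 Tx.
pose u (s : R) := (x.1 + s * ((center v).1 - x.1), x.2 + s * ((center v).2 - x.2)).
have int0 s : 0 < s <= 1 -> F (u s) = 0.
  move=> /andP[s0 s1].
  have us i : 0 < lam v i (u s).
    rewrite (lam_line v i x ((center v).1 - x.1, (center v).2 - x.2)) -lam_sub.
    rewrite lam_center//; have := Tx; rewrite triangleE// => /(_ i).
    move=> lx; rewrite (_ : _ + _ = (1 - s) * lam v i x + s / 3); last by ring.
    by rewrite ltr_wpDl// ?mulr_ge0 ?divr_gt0// subr_ge0.
  apply/eqP; apply: contraT => Fu0.
  have nF : nbhs (u s) [set y | F y != 0].
    have o : open [set z : R | z != 0].
      rewrite (_ : mkset _ = ~` [set 0]); last by apply/seteqP; split=> z /= /eqP.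
      exact/closed_openC/closed_eq.
    by apply: open_nbhs_nbhs; split=> //; apply: open_comp o => z _; exact: cF.
  have [y [Ty Fy]] := open_not_negligible F0 (filterI (triangle_interior v0 us) nF).
  by move=> /contrapT /(_ Ty) /eqP; rewrite (negbTE Fy).
have cu : continuous (F \o u).
  move=> s; apply: continuous_comp; last exact: cF.
  exact: (@continuous_line x ((center v).1 - x.1, (center v).2 - x.2) s).
have <- : (F \o u) 0 = F x by rewrite /u /= !mul0r !addr0 -surjective_pairing.
apply: (@cvg_unique _ _ ((F \o u) s @[s --> 0^'+])) => //.
  exact/cvg_at_right_filter/cu.
apply: cvg_near_cst; near=> s.
by rewrite /= int0//; apply/andP; split; near: s; 
  [exact: nbhs_right_gt|exact: nbhs_right_le].
Unshelve. all: by end_near. Qed.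

End Triangles.

(** * Line integrals over families of triangles *)

Section LineIntegrals.
Context {R : realType}.
Notation mu := (leb2 R).
Notation leb := (@lebesgue_measure R).
Implicit Types (v : 'I_3 -> R * R) (x y z t : R * R).

Lemma integrable_sum_fin (D : set (R * R)) (I : Type) (r : seq I) (P : pred I)
    (F : I -> R * R -> R) : measurable (D : set (plane R)) ->
  (forall i, mu.-integrable D (EFin \o F i)) ->
  mu.-integrable D (EFin \o (fun x => \sum_(i <- r | P i) F i x)).
Proof.
move=> mD iF.
rewrite (_ : _ \o _ = fun x => (\sum_(i <- r | P i) (EFin \o F i) x)%E).
  by apply: (integrable_sum mD) => k _; exact: iF.
by apply/funext => x; rewrite /= sumEFin.
Qed.

Lemma Rintegral_sum_fin (D : set (R * R)) (I : Type) (r : seq I) (P : pred I)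
    (F : I -> R * R -> R) : measurable (D : set (plane R)) ->
  (forall i, mu.-integrable D (EFin \o F i)) ->
  \int[mu]_(x in D) (\sum_(i <- r | P i) F i x) =
  \sum_(i <- r | P i) \int[mu]_(x in D) F i x.
Proof.
move=> mD iF; elim: r => [|i r IH].
  rewrite big_nil (@eq_Rintegral _ _ _ _ _ (fun=> 0)).
    by rewrite /Rintegral integral0.
  by move=> x _; rewrite big_nil.
rewrite big_cons -IH; case: (boolP (P i)) => Pi.
  rewrite -RintegralD//; last exact: integrable_sum_fin.
  by apply: eq_Rintegral => x _; rewrite big_cons Pi.
by apply: eq_Rintegral => x _; rewrite big_cons (negbTE Pi).
Qed.

Definition line z t (s : R) : R * R := (z.1 + s * t.1, z.2 + s * t.2).

Definition cross t z : R := t.1 * z.2 - t.2 * z.1.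

(* [h1] and [h2] are continuous and [t.1 * h1 + t.2 * h2] is the derivative of
   [H] along every line of direction [t]. *)
Definition C1 (H h1 h2 : R * R -> R) : Prop :=
  [/\ continuous H, continuous h1, continuous h2 &
      forall z t (s : R), is_derive s 1 (H \o line z t)
        (t.1 * h1 (line z t s) + t.2 * h2 (line z t s))].

Lemma C1_cst (c : R) : C1 (fun=> c) (fun=> 0) (fun=> 0).
Proof.
split; try exact: cst_continuous.
by move=> z t s; rewrite !mulr0 addr0; exact: is_derive_cst.
Qed.

Lemma C1_fst : C1 fst (fun=> 1) (fun=> 0).
Proof.
split; try exact: cst_continuous; first by move=> x; exact: cvg_fst.
move=> z t s; rewrite mulr1 mulr0 addr0.
rewrite (_ : _ \o _ = fun s => z.1 + s * t.1)//.
by apply: is_derive_eq; rewrite /GRing.scale /=; ring.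
Qed.

Lemma C1_snd : C1 snd (fun=> 0) (fun=> 1).
Proof.
split; try exact: cst_continuous; first by move=> x; exact: cvg_snd.
move=> z t s; rewrite mulr1 mulr0 add0r.
rewrite (_ : _ \o _ = fun s => z.2 + s * t.2)//.
by apply: is_derive_eq; rewrite /GRing.scale /=; ring.
Qed.

Lemma C1D (H G h1 h2 g1 g2 : R * R -> R) : C1 H h1 h2 -> C1 G g1 g2 ->
  C1 (fun x => H x + G x) (fun x => h1 x + g1 x) (fun x => h2 x + g2 x).
Proof.
move=> [cH ch1 ch2 dH] [cG cg1 cg2 dG]; split; try exact: continuousD_fun.
move=> z t s; have ? := dH z t s; have ? := dG z t s.
rewrite (_ : _ \o _ = (H \o line z t) \+ (G \o line z t))//.
by apply: is_derive_eq; ring.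
Qed.

Lemma C1M (H G h1 h2 g1 g2 : R * R -> R) : C1 H h1 h2 -> C1 G g1 g2 ->
  C1 (fun x => H x * G x) (fun x => h1 x * G x + H x * g1 x)
     (fun x => h2 x * G x + H x * g2 x).
Proof.
move=> [cH ch1 ch2 dH] [cG cg1 cg2 dG]; split.
- exact: continuousM_fun.
- by apply: continuousD_fun; exact: continuousM_fun.
- by apply: continuousD_fun; exact: continuousM_fun.
move=> z t s; have ? := dH z t s; have ? := dG z t s.
rewrite (_ : _ \o _ = (H \o line z t) \* (G \o line z t))//.
by apply: is_derive_eq; rewrite /GRing.scale /=; ring.
Qed.

Lemma C1_eq (H h1 h2 H' h1' h2' : R * R -> R) : C1 H h1 h2 ->
  H =1 H' -> h1 =1 h1' -> h2 =1 h2' -> C1 H' h1' h2'.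
Proof. by move=> + /funext <- /funext <- /funext <-. Qed.

Lemma C1Z (c : R) (H h1 h2 : R * R -> R) : C1 H h1 h2 ->
  C1 (fun x => c * H x) (fun x => c * h1 x) (fun x => c * h2 x).
Proof.
move=> /(C1M (C1_cst c)) cH; apply: (C1_eq cH) => // x;
  by rewrite mul0r add0r.
Qed.

Lemma C1_sum (I : Type) (r : seq I) (P : pred I) (H h1 h2 : I -> R * R -> R) :
  (forall i, C1 (H i) (h1 i) (h2 i)) ->
  C1 (fun x => \sum_(i <- r | P i) H i x) (fun x => \sum_(i <- r | P i) h1 i x)
     (fun x => \sum_(i <- r | P i) h2 i x).
Proof.
move=> cH; elim: r => [|i r IH].
  apply: (C1_eq (C1_cst 0)) => x; by rewrite big_nil.
case: (boolP (P i)) => Pi.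
  apply: (C1_eq (C1D (cH i) IH)) => x; by rewrite big_cons Pi.
apply: (C1_eq IH) => x; by rewrite big_cons (negbTE Pi).
Qed.

Lemma C1_lam v i : C1 (lam v i) (fun=> (dlam v i).1) (fun=> (dlam v i).2).
Proof.
apply: (C1_eq (C1D (C1_cst _) (C1D (C1Z (dlam v i).1 C1_fst)
  (C1Z (dlam v i).2 C1_snd)))) => // x /=; ring.
Qed.

Lemma continuous_line2 z t : continuous (line z t).
Proof. exact: continuous_line. Qed.

Lemma triangle_section v z t : nondeg v -> t.1 = 1 \/ t = (0, 1) ->
  exists a b : R, forall s, triangle v (line z t s) <-> a <= s <= b.
Proof.
move=> v0 tE; pose S := [set s | triangle v (line z t s)].
have [[s0 Ss0]|S0] := pselect (S !=set0); last first.
  exists 1, 0; move=> s; split=> [Ts|/andP[s1 s0]].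
    by exfalso; apply: S0; exists s.
  by have := le_trans s1 s0; rewrite ler10.
have [r r0 Tr] := bounded_set_box (triangle_bounded v0).
have cS : compact S.
  (* In a normalised direction [s] is the difference of a coordinate of the point and one of [z],
     which bounds it. *)
  pose M := r + `|z.1| + `|z.2|.
  apply: (@subclosed_compact _ S `[- M, M]%classic).
  - rewrite -[S]/((line z t) @^-1` triangle v); apply: closed_comp.
      by move=> s _; exact: continuous_line2.
    exact: triangle_closed.
  - exact: segment_compact.
  - move=> s /Tr [/= b1 b2]; rewrite in_itv /= -ler_norml /M.
    case: tE b1 b2 => [-> b1 _|-> _ /= b2].
      rewrite (_ : s = (z.1 + s * 1) - z.1); last by ring.
      apply: (le_trans (ler_normB _ _)); have := normr_ge0 z.2; lra.
    rewrite (_ : s = (z.2 + s * 1) - z.2); last by ring.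
    apply: (le_trans (ler_normB _ _)); have := normr_ge0 z.1; lra.
have cid : {within S, continuous (id : R -> R)}.
  by apply: continuous_subspaceT => s; exact: cvg_id.
have S_ne : S !=set0 by exists s0.
have [a aS am] := compact_EVT_min S_ne cS cid.
have [b bS bM] := compact_EVT_max S_ne cS cid.
rewrite inE in aS; rewrite inE in bS.
exists a, b => s; split=> [Ss|/andP[as_ sb]].
  by rewrite am ?bM ?inE.
have [ab|ab] := eqVneq a b.
  by rewrite (_ : s = a)//; apply/eqP; rewrite eq_le as_ ab sb.
have ab' : 0 < b - a by rewrite subr_gt0 lt_neqAle ab (le_trans as_ sb).
have := triangle_convex (s := (s - a) / (b - a)) v0 aS bS.
rewrite /line /= => H.
rewrite (_ : z.1 + s * t.1 = (z.1 + a * t.1) + (s - a) / (b - a) * (z.1 + b * t.1 - (z.1 + a * t.1))).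
  rewrite (_ : z.2 + s * t.2 = (z.2 + a * t.2) + (s - a) / (b - a) * (z.2 + b * t.2 - (z.2 + a * t.2))).
    apply: H; apply/andP; split; last by rewrite ler_pdivrMr// mul1r lerD2r.
    by apply: divr_ge0; [rewrite subr_ge0|exact: ltW].
  by field; rewrite gt_eqF.
by field; rewrite gt_eqF.
Qed.

Lemma dlam_neq0 v m : nondeg v -> dlam v m != 0.
Proof.
move=> v0; apply/eqP => d0.
have := lam_sub v m (v (m + 1)) (v m).
rewrite d0 /dot /= !mul0r addr0 !lam_vertex// eqxx.
rewrite (_ : (m == m + 1) = false) ?subr0; last by move: m {d0}; apply: ord3P.
by move/eqP; rewrite oner_eq0.
Qed.

(** In the plane, two vectors orthogonal to the same nonzero vector are parallel. *)
Lemma cross_dot0 (d t w : R * R) : d != 0 -> dot d t = 0 -> dot d w = 0 ->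
  cross t w = 0.
Proof.
rewrite /dot /cross => d0 dt dw; apply/eqP; apply: contraTT isT => c0.
move: d0; rewrite (_ : d = 0) ?eqxx//.
have e1 : d.1 * (t.1 * w.2 - t.2 * w.1) = 0.
  rewrite (_ : _ * _ = w.2 * (d.1 * t.1 + d.2 * t.2) - t.2 * (d.1 * w.1 + d.2 * w.2)).
    by rewrite dt dw !mulr0 subr0.
  ring.
have e2 : d.2 * (t.1 * w.2 - t.2 * w.1) = 0.
  rewrite (_ : _ * _ = t.1 * (d.1 * w.1 + d.2 * w.2) - w.1 * (d.1 * t.1 + d.2 * t.2)).
    by rewrite dt dw !mulr0 subr0.
  ring.
move/eqP: e1; rewrite mulf_eq0 (negbTE c0) orbF => /eqP e1.
move/eqP: e2; rewrite mulf_eq0 (negbTE c0) orbF => /eqP e2.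
by rewrite (surjective_pairing d) e1 e2.
Qed.

(** An affine function with two zeros on a line vanishes on all of it; the line is then the one
    carrying the edge opposite to [m], and passes through the vertex [m + 1] of that edge. *)
Lemma lam_line_two_zeros v m z t (s s' : R) : nondeg v ->
  lam v m (line z t s) = 0 -> lam v m (line z t s') = 0 -> s != s' ->
  cross t (v (m + 1)) = cross t z.
Proof.
move=> v0; rewrite !lam_line => e e' ss'.
have dt : dot (dlam v m) t = 0.
  apply/eqP; have : (s - s') * dot (dlam v m) t = 0.
    by rewrite mulrBl; move: e e'; lra.
  by move/eqP; rewrite mulf_eq0 subr_eq0 (negbTE ss').
have lz : lam v m z = 0 by move: e; rewrite dt mulr0 addr0.
have := lam_sub v m (v (m + 1)) z.
rewrite lz lam_vertex// (_ : (m == m + 1) = false) ?subr0; last first.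
  by move: m {e e' dt lz}; apply: ord3P.
move/esym/(cross_dot0 (dlam_neq0 m v0) dt); rewrite /cross /= => /eqP h.
by apply/eqP; rewrite -subr_eq0; rewrite -oppr_eq0 -(eqP h); apply/eqP; ring.
Qed.

End LineIntegrals.

Section TriangleFamilies.
Context {R : realType}.
Notation mu := (leb2 R).
Notation leb := (@lebesgue_measure R).
Variables (n : nat) (T : 'I_n -> 'I_3 -> R * R).
Hypothesis T_nondeg : forall k, nondeg (T k).
(** Non-overlapping in the form suited to lines: the intersection lies on a single edge of the first
    triangle, whose index does not depend on the point. *)
Hypothesis T_disj : forall k l, k != l ->
  exists m, forall x, triangle (T k) x -> triangle (T l) x -> lam (T k) m x = 0.
Implicit Types (x y z t : R * R).

(** The line of direction [t] through [z] meets no vertex. Such a line cannot run along an edge, and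
    for each direction only finitely many lines are excluded. *)
Definition generic t z := forall k i, cross t (T k i) != cross t z.

Lemma generic_sections k l t z (s s' : R) : k != l -> generic t z ->
  triangle (T k) (line z t s) -> triangle (T l) (line z t s) ->
  triangle (T k) (line z t s') -> triangle (T l) (line z t s') -> s = s'.
Proof.
move=> kl gz ks ls ks' ls'; have [m Hm] := T_disj kl.
apply/eqP; apply: contraT => ss'.
have := lam_line_two_zeros (T_nondeg k) (Hm _ ks ls) (Hm _ ks' ls') ss'.
by move/eqP; rewrite (negbTE (gz k (m + 1))).
Qed.

Variables (H h1 h2 : 'I_n -> R * R -> R) (h : R * R -> R).
Hypothesis HC1 : forall k, C1 (H k) (h1 k) (h2 k).
Hypothesis hH : forall k x, triangle (T k) x -> h x = H k x.
Hypothesis h0 : forall x, (forall k, ~ triangle (T k) x) -> h x = 0.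

Lemma sum_triangles_lines_normalized t : t.1 = 1 \/ t = (0, 1) ->
  (forall z, generic t z -> continuous (h \o line z t)) ->
  \sum_k \int[mu]_(x in triangle (T k)) (t.1 * h1 k x + t.2 * h2 k x) = 0.
Proof.
move=> tE hc.
pose D k x := t.1 * h1 k x + t.2 * h2 k x.
have cD k : continuous (D k).
  by have [_ c1 c2 _] := HC1 k; apply: continuousD_fun; exact: continuousZ_fun.
pose g x := \sum_k (D k \_ (triangle (T k))) x.
have iD k : mu.-integrable setT (EFin \o (D k \_ (triangle (T k)))).
  rewrite -restrict_EFin; apply/(integrable_restrict _ (measurable_triangle (T_nondeg k))) => //.
  rewrite setTI; apply: integrable_continuous => //; first exact: measurable_triangle.
  exact: triangle_bounded.
have gE : EFin \o g = fun x => (\sum_k (EFin \o (D k \_ (triangle (T k)))) x)%E.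
  by apply/funext => x; rewrite /= /g -sumEFin.
have ig : mu.-integrable setT (EFin \o g).
  by rewrite gE; apply: (integrable_sum measurableT) => k _; exact: iD.
transitivity (\int[mu]_x g x).
  rewrite /g Rintegral_sum_fin//.
  by apply: eq_bigr => k _; rewrite [LHS]Rintegral_mkcond.
rewrite /Rintegral.
pose F := [set c | exists k i, c = cross t (T k i)].
have fF : finite_set F.
  rewrite (_ : F = range (fun ki : 'I_n * 'I_3 => cross t (T ki.1 ki.2))).
    exact: finite_image.
  by apply/seteqP; split=> [c [k [i ->]]|c [[k i] _ <-]]; [exists (k, i)|exists k, i].
rewrite (integral_lines0 tE fF ig)// => z Fz.
have gz : generic t z by move=> k i; apply: contra_notN Fz => /eqP e; exists k, i; rewrite e.
have sec k : {ab : R * R | forall s, triangle (T k) (line z t s) <-> ab.1 <= s <= ab.2}.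
  apply: cid; have [a [b ab]] := triangle_section z (T_nondeg k) tE.
  by exists (a, b).
pose a k := (sval (sec k)).1; pose b k := (sval (sec k)).2.
have secP k s : triangle (T k) (line z t s) <-> a k <= s <= b k.
  exact: (svalP (sec k)).
have Dl k : continuous (D k \o line z t).
  by move=> s; apply: continuous_comp; [exact: continuous_line2|exact: cD].
have iDk k : leb.-integrable setT (EFin \o ((D k \o line z t) \_ `[a k, b k])).
  rewrite -restrict_EFin; apply/integrable_restrict => //.
  rewrite setTI; apply: continuous_compact_integrable; first exact: segment_compact.
  exact: continuous_subspaceT.
transitivity (\int[leb]_s (\sum_k (EFin \o ((D k \o line z t) \_ `[a k, b k])) s))%E.
  apply: eq_integral => s _.
  rewrite /= /g -sumEFin; apply: eq_bigr => k _; congr (_%:E).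
  rewrite !patchE; congr (if _ then _ else _).
  by apply/idP/idP; rewrite !inE /= in_itv /= (secP k s).
rewrite (integral_sum measurableT)//.
(* On each crossed triangle the fundamental theorem of calculus gives an increment of [h] between
   the entry and the exit of the line; these increments telescope since sections of distinct
   triangles share at most one point. *)
transitivity ((\sum_(k | a k <= b k)
    ((h \o line z t) (b k) - (h \o line z t) (a k)))%:E).
  rewrite -sumEFin [RHS]big_mkcond; apply: eq_bigr => k _.
  rewrite -restrict_EFin -integral_mkcond; case: ifPn => ab.
    have dH (s : R) : is_derive s 1 (H k \o line z t) ((D k \o line z t) s).
      by have [_ _ _] := HC1 k; exact.
    rewrite [LHS](FTC_segment ab dH (Dl k)) /= -!hH//; apply/secP.
      by rewrite lexx.
    by rewrite lexx ab.
  by rewrite set_itv_ge ?integral_set0// -ltNge bnd_simp ltNge.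
rewrite telescope_intervals//; first exact: hc.
- by move=> s H0 /=; apply: h0 => k /secP; apply/negP.
- move=> k l s s' kl /secP ks /secP ls /secP ks' /secP ls'.
  exact: generic_sections kl gz ks ls ks' ls'.
Qed.

End TriangleFamilies.

Section EdgeBubbles.
Context {R : realType}.
Notation mu := (leb2 R).
Implicit Types (v : 'I_3 -> R * R) (x y z t : R * R).

Section GeneralDirection.
Variables (n : nat) (T : 'I_n -> 'I_3 -> R * R).
Hypothesis T_nondeg : forall k, nondeg (T k).
Hypothesis T_disj : forall k l, k != l ->
  exists m, forall x, triangle (T k) x -> triangle (T l) x -> lam (T k) m x = 0.
Variables (H h1 h2 : 'I_n -> R * R -> R) (h : R * R -> R).
Hypothesis HC1 : forall k, C1 (H k) (h1 k) (h2 k).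
Hypothesis hH : forall k x, triangle (T k) x -> h x = H k x.
Hypothesis h0 : forall x, (forall k, ~ triangle (T k) x) -> h x = 0.

(** The sum is homogeneous in [t], so the direction can be normalised; genericity and continuity
    along lines are unaffected by the scaling. *)
Lemma sum_triangles_lines t : t != 0 ->
  (forall z, generic T t z -> continuous (h \o line z t)) ->
  \sum_k \int[mu]_(x in triangle (T k)) (t.1 * h1 k x + t.2 * h2 k x) = 0.
Proof.
move=> t0 hc.
have [c [t' [c0 tE t'E]]] : exists c t', [/\ c != 0, t = (c * t'.1, c * t'.2) &
    t'.1 = 1 \/ t' = (0, 1)].
  have [t1|t1] := eqVneq t.1 0; last first.
    exists t.1, (1, t.2 / t.1); split=> //; last by left.
    by rewrite /= mulr1 mulrCA divff// mulr1 -surjective_pairing.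
  exists t.2, (0, 1); split=> /=; last by right.
    by apply: contra_neq t0 => t2; rewrite (surjective_pairing t) t1 t2.
  by rewrite mulr0 mulr1 -t1 -surjective_pairing.
have Z := sum_triangles_lines_normalized T_nondeg T_disj HC1 hH h0 t'E.
transitivity (c * \sum_k \int[mu]_(x in triangle (T k)) (t'.1 * h1 k x + t'.2 * h2 k x)); last first.
  rewrite Z ?mulr0//.
  move=> z gz.
  have -> : h \o line z t' = (h \o line z t) \o (fun s => c^-1 * s).
    apply/funext => s; rewrite /= /line tE /=; congr (h (_, _)).
      by field.
    by field.
  move=> s; apply: continuous_comp; last first.
    apply: hc => k i; have := gz k i; rewrite tE /cross /= -!mulrA -!mulrBr.
    by apply: contra_neq; exact: mulfI.
  by apply: continuousZ_fun => ?; exact: cvg_id.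
rewrite mulr_sumr; apply: eq_bigr => k _; rewrite -RintegralZl//.
- by apply: eq_Rintegral => x _; rewrite tE /=; ring.
- exact: measurable_triangle.
- apply: integrable_continuous; [exact: measurable_triangle|exact: triangle_bounded|].
  by have [_ c1 c2 _] := HC1 k; apply: continuousD_fun; exact: continuousZ_fun.
Qed.

End GeneralDirection.

Lemma ord3_third (i j : 'I_3) : i != j ->
  exists2 m : 'I_3, (m != i) && (m != j) & forall k, [|| k == i, k == j | k == m].
Proof.
by move: i j; apply: ord3P; apply: ord3P => // _;
  (exists 2%:R => //; apply: ord3P => //) || (exists 1 => //; apply: ord3P => //)
  || (exists 0 => //; apply: ord3P => //).
Qed.

Definition edge v i j : R * R := ((v j).1 - (v i).1, (v j).2 - (v i).2).

Lemma dlam_edge v m i j : nondeg v ->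
  dot (dlam v m) (edge v i j) = (m == j)%:R - (m == i)%:R.
Proof. by move=> v0; rewrite -lam_sub !lam_vertex. Qed.

(* The product of two barycentric coordinates vanishes at both ends of every
   chord parallel to the corresponding edge. *)
Lemma edge_bubble_integral0 v i j (H G g1 g2 : R * R -> R) :
  nondeg v -> i != j -> continuous H -> C1 G g1 g2 ->
  (forall x, G x = lam v i x * lam v j x * H x) ->
  \int[mu]_(x in triangle v)
    ((edge v i j).1 * g1 x + (edge v i j).2 * g2 x) = 0.
Proof.
move=> v0 ij cH cG GE.
have [m /andP[mi mj] third] := ord3_third ij.
pose t := edge v i j.
have dm : dot (dlam v m) t = 0 by rewrite dlam_edge// (negbTE mi) (negbTE mj) subrr.
have t0 : t != 0.
  apply/eqP => t0; have := dlam_edge i i j v0.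
  rewrite -/t t0 /dot !mulr0 addr0 eqxx (negbTE ij) sub0r => /eqP.
  by rewrite eq_sym oppr_eq0 oner_eq0.
pose h x := if `[< triangle v x >] then G x else 0.
(* The triangle alone is taken as a family, with [G] extended by 0. *)
have := @sum_triangles_lines 1 (fun=> v) _ _ (fun=> G) (fun=> g1) (fun=> g2) h _ _ _ t t0.
rewrite big_ord1; apply=> //.
- by move=> k l; rewrite !ord1 eqxx.
- by move=> _ x Tx; rewrite /h; case: asboolP.
- by move=> x /(_ ord0) Tx; rewrite /h; case: asboolP.
move=> z gz.
(* A line parallel to the edge keeps its distance to it; a generic one is not the line of the edge,
   so that [lam v m] is a nonzero constant on it. *)
have lm s : lam v m (line z t s) = lam v m z by rewrite lam_line dm mulr0 addr0.
have lm0 : lam v m z != 0.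
  apply: contra_neq (gz ord0 i) => lz.
  have := lam_sub v m (v i) z; rewrite lz lam_vertex// (negbTE mi) subr0.
  move=> /esym /(cross_dot0 (dlam_neq0 m v0) dm); rewrite /cross /=.
  by rewrite !mulrBr => /eqP; rewrite subr_eq0 => /eqP; move=> e; lra.
have [lzn|lzp] := ltP (lam v m z) 0.
  rewrite (_ : h \o _ = fun=> 0); first exact: cst_continuous.
  apply/funext => s /=; rewrite /h; case: asboolP => //.
  by rewrite triangleE// => /(_ m); rewrite /= lm leNgt lzn.
(* On such a line only the coordinates [i] and [j] can become negative, so cutting off outside the
   triangle amounts to taking their positive parts, which is continuous. *)
have -> : h \o line z t = fun s => Num.max 0 (lam v i (line z t s)) *
    Num.max 0 (lam v j (line z t s)) * H (line z t s).
  apply/funext => s /=; rewrite /h; case: asboolP => [|Ts].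
    by rewrite triangleE// => l0; rewrite GE (max_idPr (l0 i)) (max_idPr (l0 j)).
  have [li|li] := ltP (lam v i (line z t s)) 0; first by rewrite !mul0r.
  have [lj|lj] := ltP (lam v j (line z t s)) 0; first by rewrite mulr0 mul0r.
  exfalso; apply: Ts; rewrite triangleE// => k.
  by case/or3P: (third k) => /eqP -> //; rewrite lm.
have cl k : continuous (fun s => lam v k (line z t s)).
  by move=> s; apply: continuous_comp; [exact: continuous_line2|exact: continuous_lam].
have cm k : continuous (fun s => Num.max 0 (lam v k (line z t s))).
  move=> s; apply: (@continuous_max _ _ (cst 0) (fun s => lam v k (line z t s))).
    exact: cvg_cst.
  exact: cl.
apply: continuousM_fun; first exact: continuousM_fun.
by move=> s; apply: continuous_comp; [exact: continuous_line2|exact: cH].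
Qed.

End EdgeBubbles.

(** * Polynomial functions of two variables *)

Section Polynomials.
Context {R : realType}.
Implicit Types f g : R * R -> R.

Lemma poly2D k f g : poly2 k f -> poly2 k g -> poly2 k (fun x => f x + g x).
Proof.
move=> [c fE] [d gE]; exists (fun i j => c i j + d i j) => x.
rewrite fE gE -big_split /=; apply: eq_bigr => i _.
by rewrite -big_split /=; apply: eq_bigr => j _; rewrite !mulrDl.
Qed.

Lemma poly2Z k a f : poly2 k f -> poly2 k (fun x => a * f x).
Proof.
move=> [c fE]; exists (fun i j => a * c i j) => x; rewrite fE mulr_sumr.
by apply: eq_bigr => i _; rewrite mulr_sumr; apply: eq_bigr => j _; rewrite !mulrA.
Qed.

Lemma poly2_eq k f g : poly2 k f -> f =1 g -> poly2 k g.
Proof. by move=> + /funext <-. Qed.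

Lemma poly2_0 k : poly2 k (fun=> 0 : R).
Proof.
exists (fun _ _ => 0) => x; rewrite big1// => i _; rewrite big1// => j _.
by rewrite !mul0r.
Qed.

Lemma poly2_sum k (I : Type) (r : seq I) (P : pred I) (F : I -> R * R -> R) :
  (forall i, poly2 k (F i)) -> poly2 k (fun x => \sum_(i <- r | P i) F i x).
Proof.
move=> pF; elim: r => [|i r IH].
  by apply: (poly2_eq (poly2_0 k)) => x; rewrite big_nil.
case: (boolP (P i)) => Pi.
  by apply: (poly2_eq (poly2D (pF i) IH)) => x; rewrite big_cons Pi.
by apply: (poly2_eq IH) => x; rewrite big_cons (negbTE Pi).
Qed.

Lemma poly2_mono k i j : (i + j <= k)%N ->
  poly2 k (fun x : R * R => x.1 ^+ i * x.2 ^+ j).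
Proof.
move=> ijk; exists (fun a b => ((a == i) && (b == j))%:R) => x.
have ik : (i < k.+1)%N by rewrite ltnS (leq_trans _ ijk)// leq_addr.
have jk : (j < (k - i).+1)%N by rewrite ltnS leq_subRL// -ltnS.
rewrite (bigD1 (Ordinal ik))//= (bigD1 (Ordinal jk))//= !eqxx !mul1r.
rewrite big1 ?addr0 => [|b bj]; last first.
  rewrite (_ : (val b == j) = false) ?mul0r//; apply: negbTE; move: bj.
  by apply: contra_neq => bj; exact/val_inj.
rewrite big1 ?addr0// => a ai; rewrite big1// => b _.
rewrite (_ : (val a == i) = false) ?mul0r//; apply: negbTE; move: ai.
by apply: contra_neq => ai; exact/val_inj.
Qed.

Lemma poly2_ind k (P : (R * R -> R) -> Prop) :
  P (fun=> 0) -> (forall f g, P f -> P g -> P (fun x => f x + g x)) ->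
  (forall a f, P f -> P (fun x => a * f x)) ->
  (forall i j, (i + j <= k)%N -> P (fun x => x.1 ^+ i * x.2 ^+ j)) ->
  forall f, poly2 k f -> P f.
Proof.
move=> P0 PD PZ Pm f [c fE].
have Psum (I : Type) (r : seq I) (F : I -> R * R -> R) : (forall i, P (F i)) ->
    P (fun x => \sum_(i <- r) F i x).
  move=> PF; elim: r => [|i r IH].
    by rewrite (_ : (fun x => _) = fun=> 0)//; apply/funext => x; rewrite big_nil.
  rewrite (_ : (fun x => _) = fun x => F i x + \sum_(i <- r) F i x); first exact: PD.
  by apply/funext => x; rewrite big_cons.
rewrite (funext fE); apply: (@Psum) => i; apply: (@Psum) => j.
rewrite (_ : (fun x => _) = fun x => c i j * (x.1 ^+ i * x.2 ^+ j)).
  by apply/PZ/Pm; rewrite -leq_subRL -ltnS.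
by apply/funext => x; rewrite mulrA.
Qed.

Lemma poly2_le k l f : (k <= l)%N -> poly2 k f -> poly2 l f.
Proof.
move=> kl; apply: poly2_ind.
- exact: poly2_0.
- exact: poly2D.
- exact: poly2Z.
- by move=> i j ijk; apply: poly2_mono; exact: leq_trans kl.
Qed.

Lemma poly2_cst k (a : R) : poly2 k (fun=> a).
Proof.
apply: (poly2_eq (poly2Z a (poly2_mono (i := 0) (j := 0) (leq0n k)))) => x.
by rewrite !expr0 !mulr1.
Qed.

Lemma poly2M k l f g : poly2 k f -> poly2 l g -> poly2 (k + l) (fun x => f x * g x).
Proof.
move=> pf pg; move: f pf; apply: poly2_ind.
- by apply: (poly2_eq (poly2_0 _)) => x; rewrite mul0r.
- by move=> f h pf ph; apply: (poly2_eq (poly2D pf ph)) => x; rewrite mulrDl.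
- by move=> a f pf; apply: (poly2_eq (poly2Z a pf)) => x; rewrite mulrA.
move=> i j ijk; move: g pg; apply: poly2_ind.
- by apply: (poly2_eq (poly2_0 _)) => x; rewrite mulr0.
- by move=> f h pf ph; apply: (poly2_eq (poly2D pf ph)) => x; rewrite mulrDr.
- by move=> a f pf; apply: (poly2_eq (poly2Z a pf)) => x; rewrite mulrCA.
move=> i' j' ijl.
have H : (i + i' + (j + j') <= k + l)%N by rewrite addnACA leq_add.
by apply: (poly2_eq (poly2_mono H)) => x; rewrite !exprD; ring.
Qed.

Lemma poly2_fst : poly2 1 (fst : R * R -> R).
Proof.
by apply: (poly2_eq (poly2_mono (i := 1) (j := 0) (leqnn 1))) => x; rewrite expr0 expr1 mulr1.
Qed.

Lemma poly2_snd : poly2 1 (snd : R * R -> R).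
Proof.
by apply: (poly2_eq (poly2_mono (i := 0) (j := 1) (leqnn 1))) => x; rewrite expr0 expr1 mul1r.
Qed.

Lemma poly2_lam v i : poly2 1 (lam v i : R * R -> R).
Proof.
apply: poly2D; first exact: poly2_cst.
by apply: poly2D; apply: poly2Z; [exact: poly2_fst|exact: poly2_snd].
Qed.

Lemma C1_pow (h h1 h2 : R * R -> R) i : C1 h h1 h2 ->
  C1 (fun x => h x ^+ i) (fun x => i%:R * h x ^+ i.-1 * h1 x)
     (fun x => i%:R * h x ^+ i.-1 * h2 x).
Proof.
move=> ch; elim: i => [|i IH].
  by apply: (C1_eq (C1_cst 1)) => x /=; rewrite ?expr0 ?mul0r.
apply: (C1_eq (C1M ch IH)) => x /=; first by rewrite exprS.
  by case: i {IH} => [|i] /=; rewrite ?expr0 ?exprS -?natr1; ring.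
by case: i {IH} => [|i] /=; rewrite ?expr0 ?exprS -?natr1; ring.
Qed.

Lemma poly2_C1 k f : poly2 k f ->
  exists f1 f2, [/\ poly2 k.-1 f1, poly2 k.-1 f2 & C1 f f1 f2].
Proof.
move: f; apply: poly2_ind.
- by exists (fun=> 0), (fun=> 0); split; [exact: poly2_0|exact: poly2_0|exact: C1_cst].
- move=> f g [f1 [f2 [pf1 pf2 cf]]] [g1 [g2 [pg1 pg2 cg]]].
  exists (fun x => f1 x + g1 x), (fun x => f2 x + g2 x).
  by split; [exact: poly2D|exact: poly2D|exact: C1D].
- move=> a f [f1 [f2 [pf1 pf2 cf]]].
  exists (fun x => a * f1 x), (fun x => a * f2 x).
  by split; [exact: poly2Z|exact: poly2Z|exact: C1Z].
move=> i j ijk.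
exists (fun x => i%:R * (x.1 ^+ i.-1 * x.2 ^+ j)), (fun x => j%:R * (x.1 ^+ i * x.2 ^+ j.-1)).
split.
- case: i ijk => [|i] ijk.
    by apply: (poly2_eq (poly2_0 _)) => x; rewrite mul0r.
  by apply/poly2Z/poly2_mono => /=; rewrite -ltnS (leq_trans ijk)// leqSpred.
- case: j ijk => [|j] ijk.
    by apply: (poly2_eq (poly2_0 _)) => x; rewrite mul0r.
  apply/poly2Z/poly2_mono => /=; rewrite -ltnS -addnS (leq_trans ijk)//.
  exact: leqSpred.
apply: (C1_eq (C1M (C1_pow i C1_fst) (C1_pow j C1_snd))) => x /=; ring.
Qed.

Lemma poly2_continuous k f : poly2 k f -> continuous f.
Proof. by move=> /poly2_C1[f1 [f2 [_ _ []]]]. Qed.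

End Polynomials.

(** * Differentiability along lines of smooth functions *)

Section TestFunctions.
Context {R : realType}.
Implicit Types f g : R * R -> R.

Lemma mean_value_bound (phi phi' : R -> R) (a b c e : R) :
  (forall s : R, is_derive s 1 phi (phi' s)) ->
  (forall s, `|s - a| <= `|b - a| -> `|phi' s - c| <= e) ->
  `|phi b - phi a - c * (b - a)| <= e * `|b - a|.
Proof.
move=> dphi H.
have cphi : continuous phi.
  by move=> s; apply: differentiable_continuous; apply/derivable1_diffP.
have [ab|ba|->] := ltgtP a b; last by rewrite !subrr mulr0 subr0 normr0 mulr0.
  have [s /[!in_itv]/= /andP[as_ sb] ->] := @MVT _ phi phi' a b ab
    (fun s _ => dphi s) (continuous_subspaceT cphi).
  rewrite -mulrBl normrM ler_wpM2r// H// !ger0_norm; lra.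
have [s /[!in_itv]/= /andP[as_ sb] E] := @MVT _ phi phi' b a ba
    (fun s _ => dphi s) (continuous_subspaceT cphi).
rewrite -[phi b - phi a]opprB E -mulrN opprB -mulrBl normrM ler_wpM2r// H//.
by rewrite !ler0_norm; lra.
Qed.

(** [smooth] only provides derivatives along the axes. An increment along [t] is split into one
    along each axis, and each is compared by the mean value theorem with the partial derivative at
    the base point. *)
Lemma C1_of_partials f g1 g2 : continuous f -> continuous g1 -> continuous g2 ->
  (forall x y : R, is_derive x 1 (fun s => f (s, y)) (g1 (x, y))) ->
  (forall x y : R, is_derive y 1 (fun s => f (x, s)) (g2 (x, y))) ->
  C1 f g1 g2.
Proof.
move=> cf c1 c2 d1 d2; split=> // z t s.
pose p := line z t s.
have key : h^-1 * ((f \o line z t) (h + s) - (f \o line z t) s)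
    @[h --> 0^'] --> t.1 * g1 p + t.2 * g2 p.
  apply/cvgrPdist_le => e e0.
  (* Controls both components of the step; the 1 keeps it positive when [t] is 0. *)
  pose M := `|t.1| + `|t.2| + 1.
  have M0 : 0 < M by rewrite ltr_wpDl// addr_ge0.
  have eM : 0 < e / M by rewrite divr_gt0.
  have n1 : nbhs p [set y | `|g1 y - g1 p| <= e / M].
    by have /cvgrPdist_le /(_ _ eM) := c1 p; apply: filterS => y; rewrite distrC.
  have n2 : nbhs p [set y | `|g2 y - g2 p| <= e / M].
    by have /cvgrPdist_le /(_ _ eM) := c2 p; apply: filterS => y; rewrite distrC.
  have [d d0 Hd] := nbhs_open_box (filterI n1 n2).
  have dM : 0 < d / M by rewrite divr_gt0.
  near=> h.
  have h0 : h != 0 by near: h; exact: nbhs_dnbhs_neq.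
  have hd : `|h| < d / M.
    by near: h; apply: dnbhs0_lt.
  have hM : `|h| * M < d by rewrite -ltr_pdivlMr.
  have ht1 : `|h * t.1| < d.
    apply: le_lt_trans hM; rewrite normrM ler_wpM2l// /M -addrA lerDl.
    by rewrite addr_ge0.
  have ht2 : `|h * t.2| < d.
    apply: le_lt_trans hM; rewrite normrM ler_wpM2l// /M.
    by have := normr_ge0 t.1; lra.
  have b1 : `|f (p.1 + h * t.1, p.2 + h * t.2) - f (p.1, p.2 + h * t.2)
      - g1 p * (h * t.1)| <= e / M * `|h * t.1|.
    have := @mean_value_bound (fun u => f (u, p.2 + h * t.2))
      (fun u => g1 (u, p.2 + h * t.2)) p.1 (p.1 + h * t.1) (g1 p) (e / M)
      (fun u => d1 u _).
    rewrite (addrC p.1) addrK; apply => u up.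
    have [] := Hd (u, p.2 + h * t.2) => //=; first by rewrite distrC (le_lt_trans up).
    by rewrite opprD addNKr normrN.
  have b2 : `|f (p.1, p.2 + h * t.2) - f (p.1, p.2) - g2 p * (h * t.2)|
      <= e / M * `|h * t.2|.
    have := @mean_value_bound (fun u => f (p.1, u))
      (fun u => g2 (p.1, u)) p.2 (p.2 + h * t.2) (g2 p) (e / M)
      (fun u => d2 _ u).
    rewrite (addrC p.2) addrK; apply => u up.
    have [] := Hd (p.1, u) => //=; first by rewrite subrr normr0.
    by rewrite distrC (le_lt_trans up).
  have -> : (f \o line z t) (h + s) = f (p.1 + h * t.1, p.2 + h * t.2).
    by rewrite /= /line /p /=; congr (f (_, _)); ring.
  have -> : (f \o line z t) s = f (p.1, p.2) by rewrite -surjective_pairing.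
  rewrite -(@ler_pM2l _ `|h|) ?normr_gt0// -normrM mulrBr mulVKf//.
  rewrite (_ : _ - _ = - ((f (p.1 + h * t.1, p.2 + h * t.2) -
      f (p.1, p.2 + h * t.2) - g1 p * (h * t.1)) +
    (f (p.1, p.2 + h * t.2) - f (p.1, p.2) - g2 p * (h * t.2)))); last by ring.
  rewrite normrN; apply: (le_trans (ler_normD _ _)); apply: (le_trans (lerD b1 b2)).
  rewrite -mulrDr !normrM -mulrDr mulrCA ler_wpM2l// mulrAC.
  by rewrite ler_pdivrMr// ler_wpM2l ?ltW// /M; lra.
have := key; rewrite -[X in X -> _]/(_ --> _) => {}key.
apply: DeriveDef; first by apply/cvg_ex; exists (t.1 * g1 p + t.2 * g2 p);
  under eq_fun do rewrite [_%:A]mulr1; exact: key.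
apply/cvg_lim => //.
by under eq_fun do rewrite [_%:A]mulr1; exact: key.
Unshelve. all: by end_near. Qed.

Lemma is_derive_slice1 f : (forall x, derivable f x (unitv R 0)) ->
  forall x y : R, is_derive x 1 (fun s => f (s, y)) (partial 0 f (x, y)).
Proof.
move=> df x y.
have E : (fun h : R => h^-1 *: (((fun s => f (s, y)) \o shift x) (h *: 1) - f (x, y))) =
    (fun h : R => h^-1 *: ((f \o shift (x, y)) (h *: unitv R 0) - f (x, y))).
  apply/funext => h; rewrite /= /shift /unitv eqxx /=; congr (_ *: (f (_, _) - _)).
  by rewrite -[y in LHS]add0r -[X in X + _ = _](mulr0 h).
apply: DeriveDef; first by rewrite /derivable E; exact: df.
by rewrite /partial /derive E.
Qed.

Lemma is_derive_slice2 f : (forall x, derivable f x (unitv R 1)) ->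
  forall x y : R, is_derive y 1 (fun s => f (x, s)) (partial 1 f (x, y)).
Proof.
move=> df x y.
have E : (fun h : R => h^-1 *: (((fun s => f (x, s)) \o shift y) (h *: 1) - f (x, y))) =
    (fun h : R => h^-1 *: ((f \o shift (x, y)) (h *: unitv R 1) - f (x, y))).
  apply/funext => h; rewrite /= /shift /unitv eqxx /=; congr (_ *: (f (_, _) - _)).
  by rewrite -[x in LHS]add0r -[X in X + _ = _](mulr0 h).
apply: DeriveDef; first by rewrite /derivable E; exact: df.
by rewrite /partial /derive E.
Qed.

Lemma smooth_C1 f : smooth f -> C1 f (partial 0 f) (partial 1 f).
Proof.
move=> sf; have [cf df] := sf [::].
apply: C1_of_partials => //.
- by have [] := sf [:: 0].
- by have [] := sf [:: 1].
- by apply: is_derive_slice1 => x; exact: df.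
- by apply: is_derive_slice2 => x; exact: df.
Qed.

End TestFunctions.

(** * Piecewise fields and weak divergences *)

Section AlmostEverywhere.
Context {R : realType}.
Notation mu := (leb2 R).
Implicit Types (A D : set (R * R)) (f g : R * R -> R).

#[global] Instance plane_ae_filter : Filter (almost_everywhere mu).
Proof. exact: ae_filter_ringOfSetsType. Qed.

#[global] Instance plane_ae_nbhs_filter : Filter (nbhs (almost_everywhere mu)).
Proof. exact: ae_filter_ringOfSetsType. Qed.

Lemma aeon_refl A (V : Type) (f : R * R -> V) : ae_eq_on A f f.
Proof. by apply: filterE. Qed.

Lemma aeon_sym A (V : Type) (f g : R * R -> V) :
  ae_eq_on A f g -> ae_eq_on A g f.
Proof. by apply: filterS => x H /H. Qed.

Lemma aeon_trans A (V : Type) (f g h : R * R -> V) :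
  ae_eq_on A f g -> ae_eq_on A g h -> ae_eq_on A f h.
Proof. by apply: filterS2 => x H1 H2 Ax; rewrite H1// H2. Qed.

Lemma aeonW A (V : Type) (f g : R * R -> V) :
  (forall x, A x -> f x = g x) -> ae_eq_on A f g.
Proof. by move=> H; apply: filterE. Qed.

Lemma aeon_comp A (V W : Type) (f g : R * R -> V) (u v : R * R -> W)
    (op : V -> W) : ae_eq_on A f g -> (forall x, A x -> u x = op (f x)) ->
  (forall x, A x -> v x = op (g x)) -> ae_eq_on A u v.
Proof. by move=> + uE vE; apply: filterS => x H Ax; rewrite uE// vE// H. Qed.

Lemma aeon_cover A (n : nat) (B : 'I_n -> set (R * R)) (V : Type)
    (f g : R * R -> V) : A `<=` \bigcup_k B k ->
  (forall k, ae_eq_on (B k) f g) -> ae_eq_on A f g.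
Proof.
move=> AB H; have := @filter_forall _ 'I_n _ (almost_everywhere mu) plane_ae_filter H.
by apply: filterS => x Hx /AB[k _ Bkx]; exact: Hx Bkx.
Qed.

Lemma eq_Rintegral_ae A f g : measurable (A : set (plane R)) ->
  measurable_fun (A : set (plane R)) f -> measurable_fun (A : set (plane R)) g ->
  ae_eq_on A f g -> \int[mu]_(x in A) f x = \int[mu]_(x in A) g x.
Proof.
move=> mA mf mg fg; rewrite /Rintegral; congr fine; apply: ae_eq_integral => //.
- exact/measurable_EFinP.
- exact/measurable_EFinP.
- by apply: filterS fg => x H Ax; rewrite H.
Qed.

Lemma Rintegral_eq0_ae A f : measurable (A : set (plane R)) ->
  mu.-integrable A (EFin \o f) -> (forall x, A x -> 0 <= f x) ->
  \int[mu]_(x in A) f x = 0 -> ae_eq_on A f (fun=> 0).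
Proof.
move=> mA intf f0 If; have mf := measurable_int _ intf.
have /(ae_eq_integral_abs mu mA mf) : (\int[mu]_(x in A) `|(EFin \o f) x| = 0)%E.
  transitivity (\int[mu]_(x in A) (EFin \o f) x)%E.
    by apply: eq_integral => x /set_mem Ax; rewrite gee0_abs//= lee_fin f0.
  rewrite -[LHS]fineK; last exact: integrable_fin_num intf.
  by congr (_%:E).
by apply: filterS => x H Ax; have [] := H Ax.
Qed.

Lemma Rintegral_ge0_ae A f : measurable (A : set (plane R)) ->
  measurable_fun (A : set (plane R)) f -> 
  {ae mu, forall x, A x -> 0 <= f x} -> 0 <= \int[mu]_(x in A) f x.
Proof.
move=> mA mf f0; rewrite (@eq_Rintegral_ae A f (fun x => `|f x|))//.
- exact: Rintegral_ge0.
- exact: measurableT_comp.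
- by apply: filterS f0 => x H Ax; rewrite ger0_norm// H.
Qed.

Lemma negligible_lam_zero (v : 'I_3 -> R * R) m : nondeg v ->
  mu.-negligible [set x | lam v m x = 0].
Proof.
move=> v0; pose d := dlam v m; pose t := (d.2, - d.1).
have t0 : t != 0.
  apply: contra_neq (dlam_neq0 m v0) => t0.
  have d2 : d.2 = 0 := congr1 fst t0.
  have d1 : - d.1 = 0 := congr1 snd t0.
  by rewrite -/d (surjective_pairing d) d2; move/eqP: d1; rewrite oppr_eq0 => /eqP ->.
apply: negligibleS (negligible_line (- (lam v m (0, 0))) t0) => x /= lx.
have := lam_sub v m (0, 0) x; rewrite lx sub0r => ->.
by rewrite /dot /= !subr0; ring.
Qed.

End AlmostEverywhere.

(** * Meshes and piecewise functions *)

Section Mesh.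
Context {R : realType}.
Notation mu := (leb2 R).
Variables (A : set (R * R)) (n : nat) (T : 'I_n -> 'I_3 -> R * R).
Hypothesis A_bounded : bounded_set A.
Hypothesis A_polygonal : polygonal_domain A.
Hypothesis T_conforming : conforming_triangulation A T.
Implicit Types (x y t : R * R) (F G D : 'I_n -> R * R -> R).

Lemma mesh_nondeg k : nondeg (T k).
Proof. by have [] := T_conforming. Qed.

Lemma mesh_open : open A.
Proof. by have [] := A_polygonal. Qed.

Lemma mesh_measurable : measurable (A : set (plane R)).
Proof. exact: (open_measurable2 mesh_open). Qed.

Lemma mesh_cover : closure A = \bigcup_(k in [set: 'I_n]) triangle (T k).
Proof. by have [] := T_conforming. Qed.

Lemma mesh_subset : A `<=` \bigcup_(k in [set: 'I_n]) triangle (T k).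
Proof. by rewrite -mesh_cover; exact: subset_closure. Qed.

Lemma face_missing_vertex (v : 'I_3 -> R * R) (S : {set 'I_3}) : nondeg v ->
  (#|S| <= 2)%N -> exists m, forall x, face v S x -> lam v m x = 0.
Proof.
move=> v0 S2; have [m mS] : exists m, m \notin S.
  apply/existsP; rewrite -negb_forall; apply/negP => /forallP H.
  by move: S2; rewrite (_ : #|S| = 3)// -[RHS](card_ord 3); apply: eq_card => i; rewrite H.
by exists m => x; rewrite faceE// => -[_ /(_ m mS)].
Qed.

Lemma mesh_disj k l : k != l ->
  exists m, forall x, triangle (T k) x -> triangle (T l) x -> lam (T k) m x = 0.
Proof.
move=> kl; have [_ _ /(_ k l kl)[S [S' [S2 _ SE _]]]] := T_conforming.
have [m Hm] := face_missing_vertex (mesh_nondeg k) S2.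
by exists m => x Tkx Tlx; apply: Hm; rewrite -SE.
Qed.

Lemma negligible_overlap k l : k != l ->
  mu.-negligible (triangle (T k) `&` triangle (T l)).
Proof.
move=> kl; have [m Hm] := mesh_disj kl.
by apply: negligibleS (negligible_lam_zero m (mesh_nondeg k)) => x [] /Hm H /H.
Qed.

(** Off its three edges the triangle is open and contained in [closure A], hence in its interior,
    which is [A] since the domain has no slits. *)
Lemma negligible_triangle_diff k : mu.-negligible (triangle (T k) `\` A).
Proof.
suff : {ae mu, forall x, triangle (T k) x -> A x}.
  by apply: negligibleS => x [Tx Ax] /(_ Tx).
have H m : {ae mu, forall x, lam (T k) m x != 0}.
  apply: negligibleS (negligible_lam_zero m (mesh_nondeg k)) => x /= /negP.
  by rewrite negbK => /eqP.
have := @filter_forall _ 'I_3 _ (almost_everywhere mu) plane_ae_filter H.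
apply: filterS => x lx Tx; have [_ _ _ <- _] := A_polygonal.
have : nbhs x (triangle (T k)).
  apply: triangle_interior (mesh_nondeg k) _ => m.
  rewrite lt_neqAle eq_sym lx /=.
  by move: Tx; rewrite triangleE//; exact: mesh_nondeg.
by apply: filterS => y Ty; rewrite mesh_cover; exists k.
Qed.

(* The function equal to [F k] in the interior of the triangle [T k]; the values
   add up on edges. *)
Definition pw F x : R := \sum_k (F k \_ (triangle (T k))) x.

Lemma pwD F G x : pw F x + pw G x = pw (fun k x => F k x + G k x) x.
Proof.
rewrite /pw -big_split /=; apply: eq_bigr => k _; rewrite !patchE.
by case: ifP => // _; rewrite addr0.
Qed.

Lemma pwM F (g : R * R -> R) x : pw F x * g x = pw (fun k x => F k x * g x) x.
Proof.
rewrite /pw mulr_suml; apply: eq_bigr => k _; rewrite !patchE.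
by case: ifP => // _; rewrite mul0r.
Qed.

Lemma measurable_patch k (f : R * R -> R) : continuous f ->
  measurable_fun setT (f \_ (triangle (T k)) : plane R -> R).
Proof.
move=> cf; apply/(measurable_restrictT _ (measurable_triangle (mesh_nondeg k))).
by apply: measurable_funTS; exact: continuous_measurable2.
Qed.

Lemma measurable_pw F : (forall k, continuous (F k)) ->
  measurable_fun setT (pw F : plane R -> R).
Proof.
by move=> cF; apply: measurable_sum => k; exact: measurable_patch.
Qed.

Lemma pw_bounded F : (forall k, continuous (F k)) ->
  exists M, forall x, `|pw F x| <= M.
Proof.
move=> cF.
have H k : exists M, forall x, `|(F k \_ (triangle (T k))) x| <= M.
  have [r r0 Tr] := bounded_set_box (triangle_bounded (mesh_nondeg k)).
  have [M HM] := continuous_bounded_box r (cF k).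
  exists `|M| => x; rewrite patchE; case: ifPn => [/set_mem/Tr/HM|_].
    by move=> /le_trans; apply; exact: ler_norm.
  by rewrite normr0.
have [M HM] := choice H.
exists (\sum_k M k) => x; apply: (le_trans (ler_norm_sum _ _ _)).
by apply: ler_sum => k _; exact: HM.
Qed.

Lemma L2_bounded (f : R * R -> R) M :
  measurable_fun (A : set (plane R)) f -> (forall x, A x -> `|f x| <= M) -> L2 A f.
Proof.
move=> mf fM; split=> //; apply: measurable_bounded_integrable.
- exact: mesh_measurable.
- exact: (mu_bounded_lty mesh_measurable A_bounded).
- exact: measurable_funX.
- exists (M ^+ 2); split; first exact: num_real.
  move=> N MN x Ax /=; rewrite normrX; apply: le_trans (ltW MN).
  by rewrite lerXn2r ?nnegrE// ?(le_trans _ (fM x Ax))// fM.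
Qed.

Lemma L2_pw F : (forall k, continuous (F k)) -> L2 A (pw F).
Proof.
move=> cF; have [M HM] := pw_bounded cF.
by apply: (L2_bounded (M := M)) => // ; apply: measurable_funTS; exact: measurable_pw.
Qed.

Lemma L2_continuous (f : R * R -> R) : continuous f -> L2 A f.
Proof.
move=> cf; have [r r0 Ar] := bounded_set_box A_bounded.
have [M HM] := continuous_bounded_box r cf.
apply: (L2_bounded (M := M)); last by move=> x /Ar /HM.
by apply: measurable_funTS; exact: continuous_measurable2.
Qed.

Lemma pw_ae F k : ae_eq_on (triangle (T k)) (pw F) (F k).
Proof.
have H l : ae_eq_on (triangle (T k))
    (fun x => if l == k then F k x else (F l \_ (triangle (T l))) x)
    (fun x => if l == k then F k x else 0).
  have [_|lk] := eqVneq l k; first exact: aeon_refl.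
  have [B [mB B0 OB]] := negligible_overlap lk.
  exists B; split=> // x /= /not_implyP[Tkx H]; apply: OB; split=> //.
  apply: contrapT => nT; apply: H; rewrite patchE ifF//.
  by apply/negbTE; rewrite notin_setE.
have := @filter_forall _ 'I_n _ (almost_everywhere mu) plane_ae_filter H.
apply: filterS => x Hx Tkx; rewrite /pw.
rewrite (bigD1 k)//= patchE mem_set// big1 ?addr0// => l lk.
by have := Hx l Tkx; rewrite (negbTE lk).
Qed.

Lemma ae_pw (u : R * R -> R) F :
  (forall k, ae_eq_on (triangle (T k)) u (F k)) -> ae_eq_on A u (pw F).
Proof.
move=> uF; apply: (aeon_cover mesh_subset) => k.
by apply: aeon_trans (uF k) _; apply: aeon_sym; exact: pw_ae.
Qed.

Lemma Rintegral_pw F : (forall k, continuous (F k)) ->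
  \int[mu]_(x in A) pw F x = \sum_k \int[mu]_(x in triangle (T k)) F k x.
Proof.
move=> cF; have mA := mesh_measurable.
have mT k := measurable_triangle (mesh_nondeg k).
rewrite Rintegral_sum_fin//; last first.
  move=> k; rewrite -restrict_EFin; apply/integrable_restrict => //.
  apply: integrable_continuous => //; first exact: measurableI.
  by apply: bounded_setS A_bounded; exact: subIsetl.
apply: eq_bigr => k _; rewrite -Rintegral_mkcondr.
have iF : mu.-integrable (triangle (T k)) (EFin \o F k).
  by apply: integrable_continuous => //; exact: triangle_bounded (mesh_nondeg k).
rewrite /Rintegral; congr fine.
have mN : measurable (triangle (T k) `\` A : set (plane R)) by exact: measurableD.
rewrite [RHS](negligible_integral mN (mT k) iF) ?setDD ?(setIC A)//.
by apply/negligibleP => //; exact: negligible_triangle_diff.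
Qed.

(** Near [x] only the triangles containing [x] matter, since triangles are closed. Around a point of
    [A] the mesh covers everything; around another point there may be points in no triangle, where
    [h] is 0, which is why [h x = 0] is asked there. *)
Lemma pw_continuous (h : R * R -> R) F : (forall k, continuous (F k)) ->
  (forall k x, triangle (T k) x -> h x = F k x) ->
  (forall x, (forall k, ~ triangle (T k) x) -> h x = 0) ->
  (forall x, A x \/ h x = 0) -> continuous h.
Proof.
move=> cF hF h0 hA x; apply/cvgrPdist_le => e e0.
have Tnear k : \forall y \near x, triangle (T k) y -> `|h x - F k y| <= e.
  have [Tx|nTx] := pselect (triangle (T k) x).
    rewrite (hF k x Tx); have /cvgrPdist_le /(_ _ e0) := cF k x.
    by apply: filterS => y.
  have : nbhs x (~` triangle (T k)).
    apply: open_nbhs_nbhs; split=> //; apply: closed_openC.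
    exact: triangle_closed (mesh_nondeg k).
  by apply: filterS => y.
have {}Tnear : \forall y \near x, forall k, triangle (T k) y -> `|h x - F k y| <= e.
  exact: (@filter_forall _ 'I_n _ (nbhs x) _ Tnear).
have [Ax|hx0] := hA x.
  have nA : nbhs x A by apply: open_nbhs_nbhs; split=> //; exact: mesh_open.
  near=> y; have [k _ Ty] : (\bigcup_(k in [set: 'I_n]) triangle (T k)) y.
    by apply: mesh_subset; near: y.
  have H : forall k, triangle (T k) y -> `|h x - F k y| <= e by near: y.
  by rewrite (hF k y Ty) H.
near=> y.
have H : forall k, triangle (T k) y -> `|h x - F k y| <= e by near: y.
have [[k Ty]|nT] := pselect (exists k, triangle (T k) y).
  by rewrite (hF k y Ty) H.
rewrite hx0 (h0 y) ?subr0 ?normr0 ?ltW// => k Ty; apply: nT; by exists k.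
Unshelve. all: by end_near. Qed.

Lemma test_function_C1 (f : R * R -> R) : test_function A f ->
  C1 f (partial 0 f) (partial 1 f).
Proof. by move=> [/smooth_C1]. Qed.

Definition pwrow F G x : 'rV[R]_2 := \row_j (if j == 0 then pw F x else pw G x).

Lemma sum2E (V : zmodType) (F : 'I_2 -> V) : \sum_i F i = F 0 + F 1.
Proof.
rewrite !big_ord_recr big_ord0 /= add0r.
by congr (F _ + F _); exact/val_inj.
Qed.

Lemma ip_row (u v : 'rV[R]_2) : ip u v = u 0 0 * v 0 0 + u 0 1 * v 0 1.
Proof. by rewrite /ip big_ord1 sum2E. Qed.

Lemma weak_div_pw F G D : (forall k, continuous (F k)) ->
  (forall k, continuous (G k)) -> (forall k, continuous (D k)) ->
  (forall f, test_function A f -> \sum_k \int[mu]_(x in triangle (T k))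
     (F k x * partial 0 f x + G k x * partial 1 f x + D k x * f x) = 0) ->
  is_weak_div A (pwrow F G) (pw D).
Proof.
move=> cF cG cD H; split; first exact: L2_pw.
move=> f tf; have := H f tf => {}H.
have [cf c1 c2 _] := test_function_C1 tf.
have cFG k : continuous (fun x => F k x * partial 0 f x + G k x * partial 1 f x).
  by apply: continuousD_fun; exact: continuousM_fun.
have cDf k : continuous (fun x => D k x * f x) by exact: continuousM_fun.
under eq_Rintegral => x _.
  rewrite ip_row !mxE /= !pwM pwD; over.
under [in RHS]eq_Rintegral => x _ do rewrite pwM.
rewrite !Rintegral_pw//; apply/eqP; rewrite -subr_eq0 opprK -big_split /=.
apply/eqP; rewrite -[RHS]H; apply: eq_bigr => k _.
have iT (g : R * R -> R) : continuous g ->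
    mu.-integrable (triangle (T k)) (EFin \o g).
  move=> cg; apply: integrable_continuous => //.
    exact: measurable_triangle (mesh_nondeg k).
  exact: triangle_bounded (mesh_nondeg k).
rewrite [RHS]RintegralD//.
- exact: measurable_triangle (mesh_nondeg k).
- exact: iT.
- exact: iT.
Qed.

End Mesh.

(** * Test functions and uniqueness of weak derivatives *)

Section BumpFunctions.
Context {R : realType}.

(* [p(1/x) exp(-1/x)], extended by zero: this class is stable under derivation. *)
Definition flat (p : {poly R}) (x : R) : R :=
  if 0 < x then p.[x^-1] * expR (- x^-1) else 0.

(** With u = 1/h and m one more than the size of [p], e^u is at least (u/m)^m, while |p(u)| is at
    most a constant times u^(m-1); the quotient leaves one factor 1/u = h. *)
Lemma poly_exp_bound (p : {poly R}) :
  exists2 C, 0 <= C & forall h, 0 < h <= 1 -> `|flat p h| <= C * h.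
Proof.
pose N := size p; pose S := \sum_(i < N) `|p`_i|.
pose m := N.+1.
exists (S * m%:R ^+ m) => [|h /andP[h0 h1]].
  by rewrite mulr_ge0 ?exprn_ge0// sumr_ge0.
rewrite /flat h0; pose u := h^-1; rewrite -/u.
have u1 : 1 <= u by rewrite /u invf_ge1.
have u0 : 0 < u by rewrite (lt_le_trans ltr01).
have pu : `|p.[u]| <= S * u ^+ N.
  rewrite horner_coef; apply: (le_trans (ler_norm_sum _ _ _)).
  rewrite mulr_suml; apply: ler_sum => i _; rewrite normrM ler_wpM2l//.
  rewrite (ger0_norm (exprn_ge0 i (ltW u0))); apply: ler_weXn2l => //.
  exact/ltnW.
have m0 : 0 < m%:R :> R by rewrite ltr0n.
have eu : expR (- u) <= m%:R ^+ m / u ^+ m.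
  rewrite expRN -[leRHS]invrK lef_pV2 ?posrE ?expR_gt0 ?invr_gt0 ?divr_gt0 ?exprn_gt0//.
  rewrite -expr_div_n -exprVn invf_div.
  rewrite -[in leRHS](mulfVK (lt0r_neq0 m0) u) expRM_natr.
  rewrite lerXn2r ?nnegrE ?divr_ge0 ?expR_ge0 ?ltW//.
  by apply: lt_le_trans (expR_ge1Dx _); rewrite ltrDr ltr01.
rewrite normrM (ger0_norm (expR_ge0 _)).
apply: (le_trans (ler_pM (normr_ge0 _) (expR_ge0 _) pu eu)).
have E : u ^+ N / u ^+ m = h.
  by rewrite /m exprS invfM mulrCA mulfV ?expf_neq0 ?lt0r_neq0// mulr1 /u invrK.
by rewrite -[in leRHS]E !mulrA (mulrAC S).
Qed.

(** For x > 0 this is the chain rule, (1/x^2) (p - p')(1/x) e^(-1/x). At 0 the difference quotient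
    is [flat (p * 'X)], which the previous bound sends to 0. *)
Lemma is_derive_flat (p : {poly R}) (x : R) :
  is_derive x 1 (flat p) (flat ('X^2 * (p - p^`())) x).
Proof.
have [x0|x0|->] := ltgtP x 0.
- rewrite {2}/flat ifF; last by apply/negbTE; rewrite -leNgt ltW.
  apply: (@near_eq_is_derive _ _ _ (cst 0)) => //.
  near=> y; rewrite /flat ifF//; apply/negbTE; rewrite -leNgt ltW//.
  by near: y; exact: lt_nbhsl.
- rewrite {2}/flat x0.
  have xn0 : x != 0 by rewrite gt_eqF.
  have di : is_derive x 1 (fun y : R => y^-1) (- x ^- 2).
    have := @is_deriveV _ (id : R -> R) x 1 1 xn0 (is_derive_id _ _).
    by move=> D; apply: is_derive_eq D _; rewrite /GRing.scale /= mulr1.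
  have dp : is_derive x 1 (fun y : R => p.[y^-1]) (- x ^- 2 * p^`().[x^-1]).
    have D := is_derive1_comp (is_derive_poly p x^-1) di.
    by apply: is_derive_eq D _; rewrite mulrC.
  have de : is_derive x 1 (fun y : R => expR (- y^-1)) (x ^- 2 * expR (- x^-1)).
    apply: is_derive_eq; rewrite /GRing.scale /=; ring.
  have dpe : is_derive x 1 (fun y : R => p.[y^-1] * expR (- y^-1))
      (('X^2 * (p - p^`())).[x^-1] * expR (- x^-1)).
    apply: is_derive_eq; rewrite /GRing.scale /= !hornerE /= exprVn.
    ring.
  apply: (near_eq_is_derive _ dpe); near=> y; rewrite /flat ifT//.
  by near: y; exact: lt_nbhsr.
rewrite {2}/flat ltxx.
have key : h^-1 * (flat p (h + 0) - flat p 0) @[h --> 0^'] --> 0.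
  have [C C0 HC] := poly_exp_bound (p * 'X).
  apply/cvgrPdist_le => e e0.
  have d0 : 0 < e / (C + 1) by rewrite divr_gt0// ltr_wpDl.
  near=> h.
  have hd : `|h| < e / (C + 1) by near: h; exact: dnbhs0_lt.
  have h1 : `|h| < 1 by near: h; exact: dnbhs0_lt.
  rewrite sub0r normrN addr0 {2}/flat ltxx subr0.
  have [h0|h0] := ltP 0 h; last first.
    by rewrite /flat ifF ?mulr0 ?normr0 ?ltW//; apply/negbTE; rewrite -leNgt.
  have hE : h^-1 * flat p h = flat (p * 'X) h.
    by rewrite /flat h0 hornerM hornerX; ring.
  rewrite hE; apply: le_trans (HC _ _) _; first by rewrite h0 (le_trans (ler_norm h))// ltW.
  have := hd; rewrite (ger0_norm (ltW h0)) => /ltW.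
  rewrite ler_pdivlMr ?ltr_wpDl// => H.
  by apply: le_trans H; rewrite mulrDr mulr1 mulrC lerDl ltW.
apply: DeriveDef; first by apply/cvg_ex; exists 0;
  under eq_fun do rewrite [_%:A]mulr1; exact: key.
apply/cvg_lim => //.
by under eq_fun do rewrite [_%:A]mulr1; exact: key.
Unshelve. all: by end_near. Qed.

Lemma C1_comp (phi phi' : R -> R) (H h1 h2 : R * R -> R) :
  (forall s : R, is_derive s 1 phi (phi' s)) -> continuous phi' -> C1 H h1 h2 ->
  C1 (phi \o H) (fun x => phi' (H x) * h1 x) (fun x => phi' (H x) * h2 x).
Proof.
move=> dphi cphi' [cH c1 c2 dH].
have cphi : continuous phi.
  by move=> s; apply: differentiable_continuous; apply/derivable1_diffP.
have cp : continuous (fun x => phi' (H x)).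
  by move=> x; apply: continuous_comp; [exact: cH|exact: cphi'].
split.
- by move=> x; apply: continuous_comp; [exact: cH|exact: cphi].
- exact: continuousM_fun.
- exact: continuousM_fun.
move=> z t s.
have := is_derive1_comp (dphi ((H \o line z t) s)) (dH z t s).
rewrite -compA => D; apply: is_derive_eq D _.
by rewrite /GRing.scale /=; ring.
Qed.

(** An algebra that contains the bump functions and is closed under both partial derivatives; its
    members are therefore smooth. *)
Inductive flat_alg : (R * R -> R) -> Prop :=
| flat_alg_cst c : flat_alg (fun=> c)
| flat_alg_fst p a b : flat_alg (fun x => flat p (a * x.1 + b))
| flat_alg_snd p a b : flat_alg (fun x => flat p (a * x.2 + b))
| flat_algD f g : flat_alg f -> flat_alg g -> flat_alg (fun x => f x + g x)
| flat_algM f g : flat_alg f -> flat_alg g -> flat_alg (fun x => f x * g x).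

Lemma flat_alg_C1 f : flat_alg f ->
  exists f1 f2, [/\ flat_alg f1, flat_alg f2 & C1 f f1 f2].
Proof.
have cflat p : continuous (flat p).
  move=> s; apply: differentiable_continuous; apply/derivable1_diffP.
  by have := is_derive_flat p s.
have cst0 : flat_alg (fun=> 0) by exact: flat_alg_cst.
elim=> [c|p a b|p a b|g h _ [g1 [g2 [a1 a2 cg]]] _ [h1 [h2 [b1 b2 ch]]]
       |g h ag [g1 [g2 [a1 a2 cg]]] ah [h1 [h2 [b1 b2 ch]]]].
- by exists (fun=> 0), (fun=> 0); split=> //; exact: C1_cst.
- exists (fun x => flat ('X^2 * (p - p^`())) (a * x.1 + b) * a), (fun=> 0); split=> //.
    by apply: flat_algM; [exact: flat_alg_fst|exact: flat_alg_cst].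
  have := C1_comp (is_derive_flat p) (@cflat _) (C1D (C1Z a C1_fst) (C1_cst b)).
  by move=> c; apply: (C1_eq c) => // x; ring.
- exists (fun=> 0), (fun x => flat ('X^2 * (p - p^`())) (a * x.2 + b) * a); split=> //.
    by apply: flat_algM; [exact: flat_alg_snd|exact: flat_alg_cst].
  have := C1_comp (is_derive_flat p) (@cflat _) (C1D (C1Z a C1_snd) (C1_cst b)).
  by move=> c; apply: (C1_eq c) => // x; ring.
- exists (fun x => g1 x + h1 x), (fun x => g2 x + h2 x).
  by split; [exact: flat_algD|exact: flat_algD|exact: C1D].
- exists (fun x => g1 x * h x + g x * h1 x), (fun x => g2 x * h x + g x * h2 x).
  by split; [apply: flat_algD; exact: flat_algM|apply: flat_algD; exact: flat_algM|exact: C1M].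
Qed.

Lemma C1_partial (f f1 f2 : R * R -> R) i : C1 f f1 f2 ->
  (forall x, derivable f x (unitv R i)) /\
  partial i f = if i == 0 then f1 else f2.
Proof.
move=> [_ _ _ df].
have E x : (fun h : R => h^-1 *: (((f \o line x (unitv R i)) \o shift 0) (h *: 1) -
      (f \o line x (unitv R i)) 0)) =
    (fun h : R => h^-1 *: ((f \o shift x) (h *: unitv R i) - f x)).
  apply/funext => h; rewrite /= /shift /line addr0 !mul0r !addr0 -surjective_pairing.
  congr (_ *: (f _ - _)); rewrite [_%:A]mulr1 [RHS]addrC.
  by [].
have D x := df x (unitv R i) 0.
split=> [x|].
  by rewrite /derivable -E; have [] := D x.
apply/funext => x; rewrite /partial /derive -E.
rewrite -[LHS]/('D_1 (f \o line x (unitv R i)) 0).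
have -> : 'D_1 (f \o line x (unitv R i)) 0 = _ := @derive_val _ _ _ _ _ _ _ (D x).
rewrite /line !mul0r !addr0 -surjective_pairing /unitv /=.
by move: i {D E}; case=> [[|[|//]]] ?; rewrite /= ?mul1r ?mul0r ?addr0 ?add0r.
Qed.

Lemma flat_alg_smooth f : flat_alg f -> smooth f.
Proof.
move=> af s; have : flat_alg (foldr (@partial R) f s).
  elim: s => [//|i s /flat_alg_C1[f1 [f2 [a1 a2 /(C1_partial i)[_ E]]]]] /=.
  by rewrite E; case: ifP.
move=> /flat_alg_C1[f1 [f2 [a1 a2 c]]]; split; first by have [] := c.
by move=> x i; have [H _] := C1_partial i c; exact: H.
Qed.

End BumpFunctions.

Section FundamentalLemma.
Context {R : realType}.
Notation mu := (leb2 R).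
Variable A : set (R * R).
Hypothesis A_open : open A.

Let psi (x : R) : R := flat 1 x.

(** One factor per side of the box. The arguments are written as affine functions to match
    [flat_alg]; since e^(-1/(m s)) tends to 1 for s > 0, the bumps converge to the indicator of the
    open box. *)
Definition bump (a b : R * R) (m : nat) (x : R * R) : R :=
  psi (m%:R * x.1 + - (m%:R * a.1)) * psi (- m%:R * x.1 + m%:R * b.1) *
  (psi (m%:R * x.2 + - (m%:R * a.2)) * psi (- m%:R * x.2 + m%:R * b.2)).

Lemma psi_bounds x : 0 <= psi x <= 1.
Proof.
rewrite /psi /flat; case: ifPn => x0; last by rewrite lexx ler01.
by rewrite hornerC mul1r expR_ge0 -expR0 ler_expR oppr_le0 invr_ge0 ltW.
Qed.

Lemma psi_le0 x : x <= 0 -> psi x = 0.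
Proof. by move=> x0; rewrite /psi /flat ltNge x0. Qed.

Lemma psi_cvg (y : R) : psi (m%:R * y) @[m --> \oo] --> ((0 < y)%R%:R : R).
Proof.
have [y0|y0] := ltP 0 y; last first.
  apply: cvg_near_cst; apply: nearW => m; rewrite psi_le0//.
  by rewrite mulr_ge0_le0.
rewrite /= -(cvg_shiftS _).
have -> : (fun m => psi (m.+1%:R * y)) = (fun m => expR (- (harmonic m * y^-1))).
  apply/funext => m; rewrite /psi /flat ifT; last by rewrite mulr_gt0.
  by rewrite hornerC mul1r invfM.
have L : - (harmonic m * y^-1) @[m --> \oo] --> - (0 * y^-1).
  by apply: cvgN; apply: cvgM; [exact: cvg_harmonic|exact: cvg_cst].
have {}L := continuous_cvg _ (@continuous_expR R _) L.
by rewrite mul0r oppr0 expR0 in L; exact: L.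
Qed.

Lemma bump_bounds a b m x : 0 <= bump a b m x <= 1.
Proof.
have H (s t : R) : 0 <= s <= 1 -> 0 <= t <= 1 -> 0 <= s * t <= 1.
  move=> /andP[s0 s1] /andP[t0 t1]; rewrite mulr_ge0//=.
  by rewrite -[leRHS]mulr1 ler_pM.
by apply: (H); apply: (H); exact: psi_bounds.
Qed.

Lemma bump_support a b m x : ~ open_box a b x -> bump a b m x = 0.
Proof.
move=> Hx; rewrite /bump.
have E1 (c d : R) : m%:R * c + - (m%:R * d) = m%:R * (c - d) by ring.
have E2 (c d : R) : - m%:R * c + m%:R * d = m%:R * (d - c) by ring.
have P0 (c d : R) : d <= c -> psi (m%:R * (d - c)) = 0.
  by move=> dc; rewrite psi_le0// mulr_ge0_le0// subr_le0.
rewrite !E1 !E2.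
have [a1|a1] := leP x.1 a.1; first by rewrite (P0 _ _ a1) !mul0r.
have [b1|b1] := leP b.1 x.1; first by rewrite (P0 _ _ b1) mulr0 !mul0r.
have [a2|a2] := leP x.2 a.2; first by rewrite (P0 _ _ a2) mul0r !mulr0.
have [b2|b2] := leP b.2 x.2; first by rewrite (P0 _ _ b2) !mulr0.
by exfalso; apply: Hx; rewrite /open_box /= a1 b1 a2 b2.
Qed.

Lemma bump_cvg a b x :
  bump a b m x @[m --> \oo] --> ((\1_(open_box a b) x) : R).
Proof.
have E1 m (c d : R) : m%:R * c + - (m%:R * d) = m%:R * (c - d) by ring.
have E2 m (c d : R) : - m%:R * c + m%:R * d = m%:R * (d - c) by ring.
rewrite (_ : \1_(open_box a b) x = (0 < x.1 - a.1)%R%:R * (0 < b.1 - x.1)%R%:R *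
   ((0 < x.2 - a.2)%R%:R * (0 < b.2 - x.2)%R%:R)); last first.
  rewrite indicE !subr_gt0 -!natrM !mulnb; congr ((_ : bool)%:R).
  by apply/idP/idP; rewrite inE.
rewrite /bump; under eq_fun do rewrite !E1 !E2.
by apply: cvgM; apply: cvgM; exact: psi_cvg.
Qed.

Lemma closed_box_compact (a b : R * R) : compact (closed_box a b).
Proof.
rewrite (_ : closed_box a b = `[a.1, b.1]%classic `*` `[a.2, b.2]%classic).
  by apply: compact_setX; exact: segment_compact.
by apply/seteqP; split=> -[x y] /=; rewrite !in_itv /= /closed_box /=;
  [move/andP|case=> -> ->].
Qed.

Lemma bump_test a b m : closed_box a b `<=` A -> test_function A (bump a b m).
Proof.
move=> abA; split.
  apply: flat_alg_smooth; apply: flat_algM; apply: flat_algM;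
    (exact: flat_alg_fst) || exact: flat_alg_snd.
exists (closed_box a b); split=> //; first exact: closed_box_compact.
by move=> x Hx; apply: bump_support => /open_box_closed.
Qed.

(** Dominated convergence, with dominating function |d|, along the bumps of the box. *)
Lemma integral_open_box0 (d : R * R -> R) a b : mu.-integrable A (EFin \o d) ->
  (forall f, test_function A f -> \int[mu]_(x in A) (d x * f x) = 0) ->
  closed_box a b `<=` A -> (\int[mu]_(x in open_box a b) (d x)%:E = 0)%E.
Proof.
move=> intd H abA; have mA := open_measurable2 A_open.
have md : measurable_fun (A : set (plane R)) d.
  by apply/measurable_EFinP; exact: measurable_int intd.
have mb m : measurable_fun setT (bump a b m : plane R -> R).
  apply: continuous_measurable2; have [/(_ [::])[]] := bump_test m abA.
  by [].
have [|||||_ _ L] := @dominated_convergence _ _ _ mu A mA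
  (fun m x => (d x * bump a b m x)%:E) (fun x => (d x * \1_(open_box a b) x)%:E)
  (fun x => `|(d x)%:E|)%E.
- by move=> m; apply/measurable_EFinP/measurable_funM => //; exact: measurable_funTS.
- apply/measurable_EFinP/measurable_funM => //.
  by apply: measurable_indic; exact: measurable_open_box.
- apply: filterE => x Ax; apply/fine_cvgP; split; first by apply: nearW.
  by apply: cvgM; [exact: cvg_cst|exact: bump_cvg].
- exact: integrable_abse.
- apply: filterE => x m Ax; rewrite /= lee_fin normrM ler_piMr//.
  by have /andP[b0 b1] := bump_bounds a b m x; rewrite ger0_norm.
have Z : [sequence (\int[mu]_(x in A) (d x * bump a b n x)%:E)%E]_n = cst 0%E.
  apply/funext => m /=; have := H _ (bump_test m abA); rewrite /Rintegral => E.
  rewrite -[LHS]fineK ?E//.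
  apply: integrable_fin_num => //; apply: (le_integrable mA _ _ (integrable_abse intd)).
    by apply/measurable_EFinP/measurable_funM => //; exact: measurable_funTS.
  move=> x Ax /=; rewrite lee_fin normr_id normrM ler_piMr//.
  by have /andP[b0 b1] := bump_bounds a b m x; rewrite ger0_norm.
rewrite Z in L.
have E0 : (\int[mu]_(x in A) (d x * \1_(open_box a b) x)%:E)%E = 0%E.
  by apply/esym/(cvg_unique _ _ L) => //; exact: cvg_cst.
rewrite -[RHS]E0 -[in LHS](_ : A `&` open_box a b = open_box a b); last first.
  by apply/setIidPr => x /open_box_closed /abA.
rewrite integral_mkcondr; apply: eq_integral => x _; rewrite patchE indicE.
by case: ifP => _; rewrite ?mulr1 ?mulr0.
Qed.

(** Dynkin's lemma: the sets whose preimages have integral 0 form a lambda-system containing the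
    pi-system [G]. *)
Lemma integral_setI_generated (d : measure_display) (T : measurableType d)
    (phi : plane R -> T) (D : set (plane R)) (f : R * R -> R) (G : set (set T)) :
  measurable_fun setT phi -> measurable D -> mu.-integrable D (EFin \o f) ->
  @measurable _ T = <<s G >> -> setI_closed G ->
  (\int[mu]_(x in D) (f x)%:E = 0)%E ->
  (forall E, G E -> (\int[mu]_(x in D `&` phi @^-1` E) (f x)%:E = 0)%E) ->
  forall E, measurable E -> (\int[mu]_(x in D `&` phi @^-1` E) (f x)%:E = 0)%E.
Proof.
move=> mphi mD intf GE GI D0 G0 E mE.
have mphiE S : measurable S -> measurable (D `&` phi @^-1` S).
  by move=> mS; apply: measurableI => //; rewrite -[X in measurable X]setTI; exact: mphi.
apply: (@dynkin_induction _ T G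
    (fun E => (\int[mu]_(x in D `&` phi @^-1` E) (f x)%:E = 0)%E)) => //.
- by rewrite preimage_setT setIT.
- move=> S mS S0; have DE : D = (D `&` phi @^-1` S) `|` (D `&` phi @^-1` (~` S)).
    apply/seteqP; split=> [x Dx|x [[]|[]]//].
    by have [?|?] := pselect (S (phi x)); [left|right].
  move: D0; rewrite [in X in X -> _]DE integral_setU ?S0 ?add0e//.
  + exact: mphiE.
  + by apply: mphiE; exact: measurableC.
  + by rewrite -DE; exact: measurable_int intf.
  + apply/disj_setPS => x /= [[_ ?] [_ ?]]; contradiction.
- move=> F mF tF F0.
  rewrite preimage_bigcup setI_bigcupr integral_bigcup//.
  + by rewrite eseries0// => i _ _; exact: F0.
  + move=> i j _ _ [x [[_ Fi] [_ Fj]]]; apply: tF => //.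
    by exists (phi x).
  + by move=> k; exact: mphiE.
  + rewrite -setI_bigcupr -preimage_bigcup; apply: integrableS intf => //.
    by apply: mphiE; exact: bigcupT_measurable.
- by rewrite -GE.
Qed.

(** Starting from boxes, one use of Dynkin's lemma per coordinate reaches all measurable rectangles,
    and a third one all measurable sets. *)
Lemma ae_eq0_open_box (d : R * R -> R) a b : mu.-integrable A (EFin \o d) ->
  (forall f, test_function A f -> \int[mu]_(x in A) (d x * f x) = 0) ->
  closed_box a b `<=` A -> ae_eq_on (open_box a b) d (fun=> 0).
Proof.
move=> intd H abA.
have ray_closed : setI_closed (@RGenOInfty.G R).
  move=> _ _ [x ->] [y ->]; exists (Num.max x y).
  by apply/seteqP; split=> z /=; rewrite !in_itv /= !andbT gt_max;
    [case=> -> ->|move/andP].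
(* Intersecting with open rays unbounded above only raises the lower left corner, which keeps the
   closed box in [A]. *)
have shrink c : a.1 <= c.1 -> a.2 <= c.2 -> closed_box c b `<=` A.
  move=> c1 c2 x /andP[/andP[x1 x2] /andP[x3 x4]]; apply: abA.
  by rewrite /closed_box /= x2 x4 (le_trans c1)// (le_trans c2).
have mbox c : measurable (open_box c b : set (plane R)) := measurable_open_box c b.
have ibox c : a.1 <= c.1 -> a.2 <= c.2 -> mu.-integrable (open_box c b) (EFin \o d).
  move=> c1 c2; apply: integrableS intd => //; first exact: open_measurable2.
  exact: subset_trans (@open_box_closed _ _ _) (shrink c c1 c2).
have step1 c : a.1 <= c.1 -> a.2 <= c.2 -> forall E : set (measurableTypeR R), measurable E ->
    (\int[mu]_(x in open_box c b `&` fst @^-1` E) (d x)%:E = 0)%E.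
  move=> c1 c2; apply: (integral_setI_generated (@measurable_fst _ _ _ _)
    (mbox c) (ibox c c1 c2) (RGenOInfty.measurableE R) ray_closed).
    exact: (integral_open_box0 intd H (shrink c c1 c2)).
  move=> _ [s ->].
  rewrite (_ : _ `&` _ = open_box (Num.max c.1 s, c.2) b).
    apply: (integral_open_box0 intd H); apply: shrink => //=.
    by rewrite le_max c1.
  apply/seteqP; split=> x; rewrite /open_box /= in_itv /= andbT gt_max.
    by case=> /andP[/andP[-> ->] ->] ->.
  by move=> /andP[/andP[/andP[-> ->] ->] ->].
have step2 (E : set (measurableTypeR R)) : measurable E ->
    forall E' : set (measurableTypeR R), measurable E' ->
    (\int[mu]_(x in (open_box a b `&` fst @^-1` E) `&` snd @^-1` E') (d x)%:E = 0)%E.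
  move=> mE; have mQE : measurable (open_box a b `&` fst @^-1` E : set (plane R)).
    apply: measurableI => //; rewrite -[X in measurable X]setTI.
    exact: measurable_fst.
  apply: (integral_setI_generated (@measurable_snd _ _ _ _) mQE _
    (RGenOInfty.measurableE R) ray_closed).
  - by apply: integrableS (ibox a _ _) => //; exact: subIsetl.
  - exact: step1.
  - move=> _ [s ->].
    rewrite (_ : (_ `&` _) `&` _ = open_box (a.1, Num.max a.2 s) b `&` fst @^-1` E).
      by apply: step1 => //=; rewrite le_max lexx.
    apply/seteqP; split=> x; rewrite /open_box /= in_itv /= andbT gt_max.
      by move=> [[/andP[/andP[-> ->] /andP[-> ->]]] ?] ->.
    by move=> [/andP[/andP[-> ->] /andP[/andP[-> ->] ->]]].
have step3 (E : set (plane R)) : measurable E ->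
    (\int[mu]_(x in open_box a b `&` id @^-1` E) (d x)%:E = 0)%E.
  apply: (integral_setI_generated (@measurable_id _ _ _) (mbox a) (ibox a _ _)
    (measurable_prod_measurableType _ _)) => //.
  - move=> _ _ [B1 mB1 [B2 mB2 <-]] [C1 mC1 [C2 mC2 <-]].
    exists (B1 `&` C1); first exact: measurableI.
    by exists (B2 `&` C2); [exact: measurableI|rewrite setXI].
  - by rewrite -(setIT (open_box a b)) -(preimage_setT fst); exact: step1.
  - move=> _ [B1 mB1 [B2 mB2 <-]].
    rewrite (_ : _ `&` _ = (open_box a b `&` fst @^-1` B1) `&` snd @^-1` B2).
      exact: step2.
    by apply/seteqP; split=> x /=; [move=> [? []]|move=> [[]]].
have := @integral_ae_eq _ _ _ mu _ (mbox a) (cst 0%E) (EFin \o d) (ibox a (lexx _) (lexx _)).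
move=> /(_ (measurable_cst _)) W; have {}W := W _.
have : ae_eq mu (open_box a b) (EFin \o d) (cst 0%E).
  apply: W => E EQ mE; rewrite integral0 -[RHS](step3 E mE).
  by rewrite preimage_id setIidr.
by apply: filterS => x + Qx => /(_ Qx) [].
Qed.

Theorem fundamental_lemma (d : R * R -> R) : mu.-integrable A (EFin \o d) ->
  (forall f, test_function A f -> \int[mu]_(x in A) (d x * f x) = 0) ->
  ae_eq_on A d (fun=> 0).
Proof.
move=> intd H.
pose B (q : (rat * rat) * (rat * rat)) : set (R * R) :=
  if `[< closed_box (ratr q.1.1, ratr q.1.2) (ratr q.2.1, ratr q.2.2) `<=` A >]
  then open_box (ratr q.1.1, ratr q.1.2) (ratr q.2.1, ratr q.2.2) else set0.
have aeB q : ae_eq_on (B q) d (fun=> 0).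
  rewrite /B; case: asboolP => [qA|_]; first exact: ae_eq0_open_box.
  by apply: aeonW.
(* The exceptional sets of the boxes are indexed by the codes of the boxes, to form a countable
   union of null sets. *)
pose N (m : nat) : set (plane R) := if unpickle m is Some q
  then ~` [set x | B q x -> d x = 0] else set0.
have nN : mu.-negligible (\bigcup_m N m).
  apply: negligible_bigcup => m; rewrite /N; case: unpickle => [q|].
    exact: aeB.
  exact: negligible_set0.
apply: negligibleS nN => x /= /not_implyP[Ax dx].
move: Ax; rewrite [in X in X -> _](open_rat_box A_open) => -[q _ Bqx].
have NE : N (pickle q) = ~` [set x | B q x -> d x = 0] by rewrite /N pickleK.
by exists (pickle q); [exact: I|rewrite NE => /(_ Bqx)].
Qed.

End FundamentalLemma.

(** * L^2 products and uniqueness of weak derivatives *)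

Section SquareIntegrable.
Context {R : realType}.
Notation mu := (leb2 R).
Variable A : set (R * R).
Hypothesis A_open : open A.
Hypothesis A_bounded : bounded_set A.
Implicit Types f g h : R * R -> R.

Let mA : measurable (A : set (plane R)) := open_measurable2 A_open.

Definition dotL f g : R := \int[mu]_(x in A) (f x * g x).

Lemma L2_measurable f : L2 A f -> measurable_fun (A : set (plane R)) f.
Proof. by case. Qed.

Lemma L2_integrableM f g : L2 A f -> L2 A g ->
  mu.-integrable A (fun x => (f x * g x)%:E).
Proof.
move=> [mf if_] [mg ig].
apply: (le_integrable mA _ _ (integrableD mA if_ ig)).
  by apply/measurable_EFinP; exact: measurable_funM.
move=> x Ax /=; rewrite lee_fin (ger0_norm (addr_ge0 (sqr_ge0 _) (sqr_ge0 _))) normrM.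
rewrite -(real_normK (num_real (f x))) -(real_normK (num_real (g x))).
have := sqr_ge0 (`|f x| - `|g x|); rewrite sqrrB.
have := sqr_ge0 (`|f x| + `|g x|); rewrite sqrrD.
by have := mulr_ge0 (normr_ge0 (f x)) (normr_ge0 (g x)); lra.
Qed.

Lemma L2_cst (c : R) : L2 A (fun=> c).
Proof.
split=> //; apply: integrable_continuous => //; exact: cst_continuous.
Qed.

Lemma L2_integrable f : L2 A f -> mu.-integrable A (EFin \o f).
Proof.
move=> Lf; have := L2_integrableM Lf (L2_cst 1).
by under eq_fun do rewrite mulr1.
Qed.

Lemma L2D f g : L2 A f -> L2 A g -> L2 A (fun x => f x + g x).
Proof.
move=> Lf Lg; have [mf if_] := Lf; have [mg ig] := Lg.
have ifg := L2_integrableM Lf Lg.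
split; first exact: measurable_funD.
have -> : (fun x => ((f x + g x) ^+ 2)%:E) =
    (fun x => ((f x ^+ 2)%:E + (f x * g x)%:E + ((f x * g x)%:E + (g x ^+ 2)%:E))%E).
  by apply/funext => x; rewrite -!EFinD; congr (_%:E); ring.
by apply: (integrableD mA); apply: (integrableD mA).
Qed.

Lemma L2Z (a : R) f : L2 A f -> L2 A (fun x => a * f x).
Proof.
move=> [mf if_]; split; first exact: measurable_funM.
have -> : (fun x => ((a * f x) ^+ 2)%:E) = (fun x => ((a ^+ 2)%:E * (f x ^+ 2)%:E)%E).
  by apply/funext => x; rewrite -EFinM exprMn.
exact: integrableZl.
Qed.

Lemma L2_eq f g : (forall x, A x -> f x = g x) -> L2 A f -> L2 A g.
Proof.
move=> fg [mf if_]; split.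
  by apply: eq_measurable_fun mf => x /set_mem; exact: fg.
by apply: eq_integrable if_ => // x /set_mem Ax; rewrite fg.
Qed.

Lemma L2_lin (a : R) f g : L2 A f -> L2 A g -> L2 A (fun x => a * f x + g x).
Proof. by move=> Lf Lg; apply: L2D Lg; exact: L2Z. Qed.

Lemma L2_sum (I : Type) (r : seq I) (P : pred I) (F : I -> R * R -> R) :
  (forall i, L2 A (F i)) -> L2 A (fun x => \sum_(i <- r | P i) F i x).
Proof.
move=> LF; elim: r => [|i r IH].
  by apply: L2_eq (L2_cst 0) => x _; rewrite big_nil.
case: (boolP (P i)) => Pi.
  by apply: L2_eq (L2D (LF i) IH) => x _; rewrite big_cons Pi.
by apply: L2_eq IH => x _; rewrite big_cons (negbTE Pi).
Qed.

Lemma dotLC f g : dotL f g = dotL g f.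
Proof. by apply: eq_Rintegral => x _; rewrite mulrC. Qed.

Lemma eq_dotL f f' g g' : L2 A f -> L2 A f' -> L2 A g -> L2 A g' ->
  ae_eq_on A f f' -> ae_eq_on A g g' -> dotL f g = dotL f' g'.
Proof.
move=> [mf _] [mf' _] [mg _] [mg' _] ff gg.
apply: eq_Rintegral_ae => //; [exact: measurable_funM|exact: measurable_funM|].
by apply: filterS2 ff gg => x H1 H2 Ax; rewrite H1// H2.
Qed.

Lemma dotLl (a : R) f f' g : L2 A f -> L2 A f' -> L2 A g ->
  dotL (fun x => a * f x + f' x) g = a * dotL f g + dotL f' g.
Proof.
move=> Lf Lf' Lg; have i1 := L2_integrableM Lf Lg; have i2 := L2_integrableM Lf' Lg.
rewrite /dotL -RintegralZl// -RintegralD//.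
  by apply: eq_Rintegral => x _; ring.
by rewrite (_ : _ \o _ = fun x => (a%:E * (f x * g x)%:E)%E)//; exact: integrableZl.
Qed.

Lemma dotL0 g : dotL (fun=> 0) g = 0.
Proof.
rewrite /dotL (@eq_Rintegral _ _ _ _ _ (fun=> 0)); last by move=> x _; rewrite mul0r.
by rewrite /Rintegral integral0.
Qed.

Lemma dotL_ge0 f : 0 <= dotL f f.
Proof. by apply: Rintegral_ge0 => x _; rewrite -expr2 sqr_ge0. Qed.

Lemma L2norm_sqr f : L2norm A f ^+ 2 = dotL f f.
Proof.
rewrite /L2norm sqr_sqrtr; last by apply: Rintegral_ge0 => x _; rewrite sqr_ge0.
by apply: eq_Rintegral => x _; rewrite expr2.
Qed.

Lemma L2norm_ge0 f : 0 <= L2norm A f.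
Proof. exact: sqrtr_ge0. Qed.

Lemma dotL_eq0 f : L2 A f -> dotL f f = 0 -> ae_eq_on A f (fun=> 0).
Proof.
move=> Lf f0; have sq x : A x -> 0 <= f x * f x by move=> _; rewrite -expr2 sqr_ge0.
have := Rintegral_eq0_ae mA (L2_integrableM Lf Lf) sq f0.
by apply: filterS => x + Ax => /(_ Ax) /eqP; rewrite mulf_eq0 orbb => /eqP.
Qed.

Lemma cauchy_schwarz f g : L2 A f -> L2 A g ->
  `|dotL f g| <= L2norm A f * L2norm A g.
Proof.
move=> Lf Lg.
rewrite -ler_sqr ?nnegrE ?mulr_ge0 ?L2norm_ge0// exprMn !L2norm_sqr.
rewrite real_normK ?num_real//.
have Q s : 0 <= s * s * dotL f f + 2 * s * dotL f g + dotL g g.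
  have Lsg : L2 A (fun x => s * f x + g x) by exact: L2_lin.
  have := dotL_ge0 (fun x => s * f x + g x).
  rewrite dotLl// (dotLC f) (dotLC g) !dotLl// (dotLC g f); lra.
have f0 := dotL_ge0 f; have g0 := dotL_ge0 g.
have [E|nE] := eqVneq (dotL f f) 0.
  rewrite E mul0r; rewrite E in Q.
  suff -> : dotL f g = 0 by rewrite expr0n.
  apply/eqP; apply: contraT => fg0.
  (* If [f] has norm 0 the quadratic in [s] is affine; this [s] would give it the value -1. *)
  have := Q (- (dotL g g + 1) / (2 * dotL f g)).
  rewrite mulr0 add0r (_ : 2 * _ * _ = - (dotL g g + 1)); first lra.
  by field.
have fp : 0 < dotL f f by rewrite lt_neqAle eq_sym nE.
have := Q (- dotL f g / dotL f f).
rewrite (_ : _ + _ + _ = dotL g g - dotL f g ^+ 2 / dotL f f); last by field.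
by rewrite subr_ge0 ler_pdivrMr// mulrC.
Qed.

(** The parallelogram identity, with the square of [g - a f] dropped. *)
Lemma dotL_lin_le (a : R) f g : L2 A f -> L2 A g ->
  dotL (fun x => a * f x + g x) (fun x => a * f x + g x) <=
  2 * (a ^+ 2 * dotL f f) + 2 * dotL g g.
Proof.
move=> Lf Lg; have := dotL_ge0 (fun x => - a * f x + g x).
have L1 : L2 A (fun x => a * f x + g x) by exact: L2_lin.
have L2' : L2 A (fun x => - a * f x + g x) by exact: L2_lin.
rewrite !dotLl// !(dotLC _ (fun x => _ + _)) !dotLl//; rewrite (dotLC g f).
lra.
Qed.

Section Matrices.
Variables m n : nat.
Implicit Types M N : R * R -> 'M[R]_(m, n).

Lemma L2mx_lin (a : R) M N : L2mx A M -> L2mx A N ->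
  L2mx A (fun x => a *: M x + N x).
Proof.
move=> LM LN i j; apply: L2_eq (L2_lin a (LM i j) (LN i j)) => x _.
by rewrite !mxE.
Qed.

Lemma integrable_ip M N : L2mx A M -> L2mx A N ->
  mu.-integrable A (fun x => (ip (M x) (N x))%:E).
Proof.
move=> LM LN; rewrite /ip.
by apply: integrable_sum_fin => // i; apply: integrable_sum_fin => // j;
  exact: L2_integrableM.
Qed.

Lemma Rintegral_ip M N : L2mx A M -> L2mx A N ->
  \int[mu]_(x in A) ip (M x) (N x) =
  \sum_i \sum_j dotL (fun x => M x i j) (fun x => N x i j).
Proof.
move=> LM LN; rewrite /ip Rintegral_sum_fin//.
  apply: eq_bigr => i _; rewrite Rintegral_sum_fin// => j.
  exact: L2_integrableM.
by move=> i; apply: integrable_sum_fin => // j; exact: L2_integrableM.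
Qed.

Lemma L2mxnorm_sqr M : L2mx A M ->
  L2mxnorm A M ^+ 2 = \sum_i \sum_j dotL (fun x => M x i j) (fun x => M x i j).
Proof.
move=> LM; rewrite /L2mxnorm sqr_sqrtr ?Rintegral_ip//.
rewrite sumr_ge0// => i _; apply: sumr_ge0 => j _; exact: dotL_ge0.
Qed.

End Matrices.

Lemma ord2P (P : 'I_2 -> Prop) : P 0 -> P 1 -> forall i, P i.
Proof.
move=> P0 P1 [[|[|//]] i2].
- by rewrite (_ : Ordinal _ = 0)//; exact/val_inj.
- by rewrite (_ : Ordinal _ = 1)//; exact/val_inj.
Qed.

Lemma test_function_L2 f : test_function A f ->
  L2 A f /\ forall i, L2 A (partial i f).
Proof.
move=> [/smooth_C1[cf c1 c2 _] _].
have H h : continuous h -> L2 A h.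
  move=> ch; split; first by apply: measurable_funTS; exact: continuous_measurable2.
  apply: integrable_continuous => // x; exact: (@continuousM_fun _ _ h h).
by split; [exact: H|apply: ord2P; exact: H].
Qed.

Implicit Types (u v : R * R -> 'rV[R]_2) (d e : R * R -> R).

Lemma Rintegral_ip_grad v f : L2mx A v -> test_function A f ->
  \int[mu]_(x in A) ip (v x) (classical_grad f x) =
  dotL (fun x => v x 0 0) (partial 0 f) + dotL (fun x => v x 0 1) (partial 1 f).
Proof.
move=> Lv /test_function_L2[Lf Lp].
have E (i : 'I_1) j : (fun x => classical_grad f x i j) = partial j f.
  by apply/funext => x; rewrite mxE.
rewrite Rintegral_ip//; last by move=> i j; rewrite E.
by rewrite big_ord1 sum2E !E.
Qed.

Lemma weak_div_lin (a : R) u v d e : L2mx A u -> L2mx A v ->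
  is_weak_div A u d -> is_weak_div A v e ->
  is_weak_div A (fun x => a *: u x + v x) (fun x => a * d x + e x).
Proof.
move=> Lu Lv [Ld Hd] [Le He]; split; first exact: L2_lin.
move=> f tf; have [Lf Lp] := test_function_L2 tf.
rewrite Rintegral_ip_grad//; last exact: L2mx_lin.
have E i g : L2 A g -> dotL (fun x => (a *: u x + v x) 0 i) g =
    a * dotL (fun x => u x 0 i) g + dotL (fun x => v x 0 i) g.
  move=> Lg; rewrite -(dotLl a (Lu 0 i) (Lv 0 i) Lg).
  by apply: eq_Rintegral => x _; rewrite !mxE.
have := Hd f tf; rewrite Rintegral_ip_grad// => Eu.
have := He f tf; rewrite Rintegral_ip_grad// => Ev.
rewrite -[X in _ = - X]/(dotL _ _) (dotLl a Ld Le Lf) (E _ _ (Lp 0)) (E _ _ (Lp 1)).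
by rewrite addrACA -mulrDr Eu Ev mulrN -opprD.
Qed.

(** By the fundamental lemma, the difference of the divergences being orthogonal to all test
    functions. It makes the arbitrary representative [wdiv] computable: it is almost everywhere any
    known weak divergence. *)
Lemma weak_div_unique_ae u v d e : L2mx A u -> L2mx A v -> ae_eq_on A u v ->
  is_weak_div A u d -> is_weak_div A v e -> ae_eq_on A d e.
Proof.
move=> Lu Lv uv [Ld Hd] [Le He].
have Lde : L2 A (fun x => -1 * e x + d x) by exact: L2_lin.
have : ae_eq_on A (fun x => -1 * e x + d x) (fun=> 0).
  apply: (fundamental_lemma A_open (L2_integrable Lde)) => f tf.
  have [Lf Lp] := test_function_L2 tf.
  rewrite -[LHS]/(dotL _ _) (dotLl _ Le Ld Lf) mulN1r.
  have := Hd f tf; rewrite Rintegral_ip_grad// => Eu.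
  have := He f tf; rewrite Rintegral_ip_grad// => Ev.
  have uvi i : dotL (fun x => u x 0 i) (partial i f) = dotL (fun x => v x 0 i) (partial i f).
    apply: (eq_dotL (Lu 0 i) (Lv 0 i) (Lp i) (Lp i)); last exact: aeon_refl.
    by apply: filterS uv => x H Ax; rewrite H.
  rewrite -[RHS](subrr (dotL d f)) addrC; congr (_ - _); apply: oppr_inj.
  by rewrite -[LHS]Ev -[RHS]Eu !uvi.
by apply: filterS => x H Ax; have := H Ax; lra.
Qed.

Lemma wdivP v : (exists d, is_weak_div A v d) -> is_weak_div A v (wdiv A v).
Proof. by move=> H; rewrite /wdiv; case: xgetP => [d _ //|]; case: H => d Hd /(_ d). Qed.

Lemma wdiv_ae v d : L2mx A v -> is_weak_div A v d -> ae_eq_on A (wdiv A v) d.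
Proof.
move=> Lv Hd; have H := wdivP (ex_intro _ d Hd).
exact: (weak_div_unique_ae Lv Lv (aeon_refl _ _) H Hd).
Qed.

Lemma wgradP f : (exists d' : R * R -> 'rV[R]_2, is_weak_grad A f d') ->
  is_weak_grad A f (wgrad A f).
Proof. by move=> H; rewrite /wgrad; case: xgetP => [d _ //|]; case: H => d Hd /(_ d). Qed.

(** Reduces the uniqueness of weak gradients to that of weak divergences. *)
Lemma weak_grad_div f (d : R * R -> 'rV[R]_2) : L2 A f -> is_weak_grad A f d ->
  forall i, is_weak_div A (fun x => f x *: delta_mx 0 i) (fun x => d x 0 i).
Proof.
move=> Lf [Ld Hd] i; split=> // h th; rewrite -Hd//.
apply: eq_Rintegral => x _; rewrite /ip big_ord1 (bigD1 i)//= !mxE !eqxx mulr1.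
by rewrite big1 ?addr0// => j ji; rewrite !mxE (negbTE ji) andbF mulr0 mul0r.
Qed.

Lemma L2mx_delta f i : L2 A f -> L2mx A (fun x => f x *: delta_mx 0 i : 'rV[R]_2).
Proof.
by move=> Lf k j; apply: L2_eq (L2Z ((k == 0) && (j == i))%:R Lf) => x _; rewrite !mxE mulrC.
Qed.

Lemma wgrad_ae f (d : R * R -> 'rV[R]_2) : L2 A f -> is_weak_grad A f d ->
  forall i, ae_eq_on A (fun x => wgrad A f x 0 i) (fun x => d x 0 i).
Proof.
move=> Lf Hd i; have H := wgradP (ex_intro _ d Hd).
exact: (weak_div_unique_ae (L2mx_delta i Lf) (L2mx_delta i Lf)
  (aeon_refl _ _) (weak_grad_div Lf H i) (weak_grad_div Lf Hd i)).
Qed.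

Lemma wgrad_lin_ae (a : R) f g : L2 A f -> L2 A g ->
  (exists d' : R * R -> 'rV[R]_2, is_weak_grad A f d') ->
  (exists d' : R * R -> 'rV[R]_2, is_weak_grad A g d') ->
  forall i, ae_eq_on A (fun x => wgrad A (fun y => a * f y + g y) x 0 i)
    (fun x => a * wgrad A f x 0 i + wgrad A g x 0 i).
Proof.
move=> Lf Lg /wgradP[Lf' Hf] /wgradP[Lg' Hg].
have H : is_weak_grad A (fun y => a * f y + g y) (fun x => a *: wgrad A f x + wgrad A g x).
  split; first exact: L2mx_lin.
  move=> h th i; have [Lh Lp] := test_function_L2 th.
  rewrite -[LHS]/(dotL _ _) (dotLl a Lf Lg (Lp i)).
  transitivity (- dotL (fun x => a * wgrad A f x 0 i + wgrad A g x 0 i) h).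
    rewrite (dotLl a (Lf' 0 i) (Lg' 0 i) Lh) [X in a * X](Hf h th i : dotL _ _ = _).
    by rewrite [X in _ + X](Hg h th i : dotL _ _ = _) mulrN -opprD.
  by congr (- _); apply: eq_Rintegral => x _; rewrite !mxE.
move=> i; apply: aeon_trans (wgrad_ae (L2_lin a Lf Lg) H i) _.
by apply: aeonW => x _; rewrite !mxE.
Qed.

Lemma wdiv_lin_ae (a : R) u v : L2mx A u -> L2mx A v ->
  (exists d, is_weak_div A u d) -> (exists d, is_weak_div A v d) ->
  ae_eq_on A (wdiv A (fun x => a *: u x + v x)) (fun x => a * wdiv A u x + wdiv A v x).
Proof.
move=> Lu Lv /wdivP Hu /wdivP Hv; apply: wdiv_ae; first exact: L2mx_lin.
exact: weak_div_lin.
Qed.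

End SquareIntegrable.

(** * Symmetric problems on finite-dimensional spaces *)

Section RowSpace.
Context {F : fieldType} (N : nat).

(** Rows of [C] are adjoined as long as the rank grows, which happens at most [N] times. *)
Lemma subspace_row_basis (C : 'rV[F]_N -> Prop) :
  (forall (a : F) c c', C c -> C c' -> C (a *: c + c')) ->
  exists (m : nat) (M : 'M[F]_(m, N)),
    (forall i, C (row i M)) /\ forall c, C c -> (c <= M)%MS.
Proof.
move=> Clin.
suff H k m (M : 'M[F]_(m, N)) : (N - \rank M <= k)%N -> (forall i, C (row i M)) ->
    exists m' (M' : 'M[F]_(m', N)),
    (forall i, C (row i M')) /\ forall c, C c -> (c <= M')%MS.
  apply: (H N 0%N (0 : 'M[F]_(0, N))) => [|[]//]; exact: leq_subr.
elim: k m M => [|k IH] m M rk CM;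
  (have [full|] := pselect (forall c, C c -> (c <= M)%MS); first by exists m, M);
  move=> /existsNP[c /not_implyP[Cc /negP cM]].
all: have /andP[_ MM'] : (c <= col_mx c M)%MS && (M <= col_mx c M)%MS
  by rewrite -col_mx_sub submx_refl.
all: have lt : (\rank M < \rank (col_mx c M))%N
  by rewrite (ltn_leqif (mxrank_leqif_sup MM')) col_mx_sub negb_and cM.
all: have leN := rank_leq_col (col_mx c M).
  by move: rk; rewrite leqn0 subn_eq0 => Nr; move: (leq_trans lt leN); rewrite ltnNge Nr.
apply: (IH _ (col_mx c M)).
  by rewrite -ltnS; apply: leq_trans rk; exact: ltn_sub2l (leq_trans lt leN) lt.
move=> i; case: (fintype.split_ordP i) => j ->.
  by rewrite rowKu (ord1 j) row_id.
by rewrite rowKd.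
Qed.

End RowSpace.

Section AbstractProblem.
Context {R : realType}.
Notation mu := (leb2 R).
Variable A : set (R * R).
Hypothesis A_open : open A.
Hypothesis A_bounded : bounded_set A.
(** [V] is a space of genuine functions and [S] the discrete space in it. [Phi s] lists scalar
    functions attached to [s] (components and weak derivatives), linear only almost everywhere.
    [K s c] says that [c] is a vector of coefficients of [s]; as a relation it involves no choice,
    and it bounds the dimension of [S] modulo [null]. *)
Variables (V : zmodType) (sc : R -> V -> V) (S : V -> Prop).
Variables (F : Type) (Phi : V -> F -> R * R -> R).
Variables (I : finType) (K : V -> (I -> R) -> Prop).
Variables (B : seq (R * (F * F))) (k0 : F).

Definition null (s : V) := forall k, ae_eq_on A (Phi s k) (fun=> 0).

(* Symmetric by construction; a diagonal coefficient counts twice. *)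
Definition form (s d : V) := \sum_(z <- B) z.1 *
  (dotL A (Phi s z.2.1) (Phi d z.2.2) + dotL A (Phi s z.2.2) (Phi d z.2.1)).

Hypothesis S0 : S 0.
Hypothesis S_lin : forall a s s', S s -> S s' -> S (sc a s + s').
Hypothesis Phi_L2 : forall s k, S s -> L2 A (Phi s k).
Hypothesis Phi_lin : forall a s s' k, S s -> S s' ->
  ae_eq_on A (Phi (sc a s + s') k) (fun x => a * Phi s k x + Phi s' k x).
Hypothesis K0 : K 0 (fun=> 0).
Hypothesis K_lin : forall a s s' c c', K s c -> K s' c' ->
  K (sc a s + s') (fun i => a * c i + c' i).
Hypothesis K_ex : forall s, S s -> exists c, K s c.
Hypothesis K_null : forall s, S s -> K s (fun=> 0) -> null s.
Hypothesis form_nondeg : forall s, S s -> (forall d, S d -> form s d = 0) -> null s.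

Lemma dotL_Phi_lin a s s' k f : S s -> S s' -> L2 A f ->
  dotL A (Phi (sc a s + s') k) f = a * dotL A (Phi s k) f + dotL A (Phi s' k) f.
Proof.
move=> Ss Ss' Lf; rewrite -dotLl//; [|exact: Phi_L2|exact: Phi_L2].
apply: (eq_dotL A_open) => //.
- exact/Phi_L2/S_lin.
- by apply: L2_lin => //; exact: Phi_L2.
- exact: Phi_lin.
- exact: aeon_refl.
Qed.

Lemma form_lin a s s' d : S s -> S s' -> S d ->
  form (sc a s + s') d = a * form s d + form s' d.
Proof.
move=> Ss Ss' Sd; rewrite /form mulr_sumr -big_split; apply: eq_bigr => z _ /=.
by rewrite !dotL_Phi_lin//; [ring|exact: Phi_L2|exact: Phi_L2].
Qed.

Lemma form_sym s d : form s d = form d s.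
Proof.
rewrite /form; apply: eq_bigr => z _; rewrite addrC.
by congr (_ * (_ + _)); rewrite dotLC.
Qed.

Lemma dotL_null s k f : S s -> null s -> L2 A f -> dotL A (Phi s k) f = 0.
Proof.
move=> Ss ns Lf; rewrite -(dotL0 A f).
apply: (eq_dotL A_open) => //; [exact: Phi_L2|exact: L2_cst|exact: aeon_refl].
Qed.

Lemma form_null s d : S s -> S d -> null s -> form s d = 0.
Proof.
move=> Ss Sd ns; rewrite /form big1// => z _.
by rewrite !dotL_null ?addr0 ?mulr0//; exact: Phi_L2.
Qed.

Lemma null_dot0 s k : S s -> null s -> dotL A (Phi s k) (Phi s k) = 0.
Proof. by move=> Ss ns; rewrite dotL_null//; exact: Phi_L2. Qed.

Section Combinations.
Variables (m : nat) (e : 'I_m -> V).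
Hypothesis Se : forall i, S (e i).

Definition comb (r : seq 'I_m) (x : 'I_m -> R) : V := \sum_(i <- r) sc (x i) (e i).

Lemma S_comb r x : S (comb r x).
Proof.
rewrite /comb; elim: r => [|i r IH]; first by rewrite big_nil.
by rewrite big_cons; exact: S_lin.
Qed.

Lemma dotL_comb r x k f : L2 A f ->
  dotL A (Phi (comb r x) k) f = \sum_(i <- r) x i * dotL A (Phi (e i) k) f.
Proof.
move=> Lf; elim: r => [|i r IH].
  rewrite /comb !big_nil.
  have z : null 0 by exact: K_null.
  exact: dotL_null.
rewrite /comb !big_cons -/(comb r x) dotL_Phi_lin//; last exact: S_comb.
by rewrite IH.
Qed.

Lemma form_comb r x d : S d -> form (comb r x) d = \sum_(i <- r) x i * form (e i) d.
Proof.
move=> Sd; elim: r => [|i r IH].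
  rewrite /comb !big_nil.
  have z : null 0 by exact: K_null.
  exact: form_null.
rewrite /comb !big_cons -/(comb r x) form_lin//; last exact: S_comb.
by rewrite IH.
Qed.

Lemma K_comb r x (c : 'I_m -> I -> R) : (forall i, K (e i) (c i)) ->
  K (comb r x) (fun j => \sum_(i <- r) x i * c i j).
Proof.
move=> Kc; elim: r => [|i r IH].
  by rewrite /comb big_nil; under eq_fun do rewrite big_nil.
rewrite /comb big_cons -/(comb r x); under eq_fun do rewrite big_cons.
exact: K_lin.
Qed.

(** Each added term costs a factor 2, by the parallelogram bound; only the independence of the
    constant from [x] matters. *)
Lemma dot_comb_le r x k :
  dotL A (Phi (comb r x) k) (Phi (comb r x) k) <=
  2 ^+ (size r) * \sum_(i <- r) x i ^+ 2 * dotL A (Phi (e i) k) (Phi (e i) k).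
Proof.
elim: r => [|i r IH].
  rewrite /comb !big_nil mulr0 null_dot0//; exact: K_null.
rewrite /comb !big_cons -/(comb r x).
rewrite (@eq_dotL _ A A_open _ (fun y => x i * Phi (e i) k y + Phi (comb r x) k y)
  _ (fun y => x i * Phi (e i) k y + Phi (comb r x) k y)); first last.
- exact/Phi_lin/S_comb.
- exact/Phi_lin/S_comb.
- by apply: L2_lin => //; apply: Phi_L2 => //; exact: S_comb.
- by apply/Phi_L2/S_lin => //; exact: S_comb.
- by apply: L2_lin => //; apply: Phi_L2 => //; exact: S_comb.
- by apply/Phi_L2/S_lin => //; exact: S_comb.
apply: le_trans (dotL_lin_le A_open (x i) (Phi_L2 k (Se i)) (Phi_L2 k (S_comb r x))) _.
rewrite (exprS 2 (size r) : 2 ^+ size (i :: r) = _) mulrDr.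
apply: lerD; rewrite -[leRHS]mulrA ler_wpM2l//.
rewrite ler_peMl ?exprn_ege1 ?ler1n// mulr_ge0 ?sqr_ge0//.
exact: dotL_ge0.
Qed.

End Combinations.

(** The coefficient vectors of elements of [S] form a subspace of a finite-dimensional space;
    elements of [S] above a generating family of it span modulo [null], since zero coefficients
    force nullity. *)
Lemma spanning_family : exists (m : nat) (e : 'I_m -> V),
  (forall i, S (e i)) /\
  forall s, S s -> exists x, null (sc (-1) (comb e (index_enum _) x) + s).
Proof.
pose row_coord (r : 'rV[R]_#|I|) (i : I) : R := r 0 (enum_rank i).
pose C (r : 'rV[R]_#|I|) := exists2 s, S s & K s (row_coord r).
have [|m [M [CM spanM]]] := @subspace_row_basis R #|I| C.
  move=> a c c' [s Ss Ks] [s' Ss' Ks']; exists (sc a s + s'); first exact: S_lin.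
  rewrite (_ : row_coord _ = fun i => a * row_coord c i + row_coord c' i).
    exact: K_lin.
  by apply/funext => i; rewrite /row_coord !mxE.
have {}CM i : {s | S s /\ K s (row_coord (row i M))}.
  by apply: cid; have [s Ss Ks] := CM i; exists s.
pose e i := sval (CM i); have He i : S (e i) /\ K (e i) (row_coord (row i M)).
  exact: svalP (CM i).
exists m, e; split=> [i|s Ss]; first by have [] := He i.
have Se i : S (e i) by have [] := He i.
have [c Kc] := K_ex Ss.
pose r : 'rV[R]_#|I| := \row_j c (enum_val j).
have rE : row_coord r = c by apply/funext => i; rewrite /row_coord mxE enum_rankK.
have /submxP[x xE] : (r <= M)%MS by apply: spanM; exists s => //; rewrite rE.
exists (fun i => x 0 i); apply: K_null; first by apply: S_lin => //; exact: S_comb.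
have := K_lin (-1) (K_comb (index_enum _) (fun i => x 0 i) (fun i => (He i).2)) Kc.
have -> // : (fun j => -1 * \sum_i x 0 i * row_coord (row i M) j + c j) = fun=> 0.
apply/funext => j; rewrite -rE xE /row_coord mxE mulN1r.
by under eq_bigr do rewrite mxE; rewrite addNr.
Qed.

(** A vector in the kernel of the Gram matrix gives an element of [S] orthogonal to [S] for the
    form, hence null, hence orthogonal to every load. So the load lies in the row space of the
    matrix, even if the latter is singular. *)
Lemma form_solvable :
  (forall g, L2 A g -> exists2 s, S s &
     forall d, S d -> form s d = - dotL A (Phi d k0) g) /\
  forall k, exists2 C : R, 0 <= C & forall g s, L2 A g -> S s ->
    (forall d, S d -> form s d = - dotL A (Phi d k0) g) ->
    dotL A (Phi s k) (Phi s k) <= C * L2norm A g ^+ 2.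
Proof.
have [m [e [Se span]]] := spanning_family.
pose G : 'M[R]_m := \matrix_(i, j) form (e i) (e j).
pose l (g : R * R -> R) : 'rV[R]_m := \row_j (- dotL A (Phi (e j) k0) g).
(* A fixed pseudo-inverse makes the coefficients linear in the load, with bounds that depend on the
   family only. *)
pose x g : 'rV[R]_m := l g *m pinvmx G.
pose s0 g := comb e (index_enum _) (fun i => x g 0 i).
have Ss0 g : S (s0 g) by exact: S_comb.
have form_span s d : S s -> S d -> (forall j, form s (e j) = 0) -> form s d = 0.
  move=> Ss Sd H; have [y ny] := span d Sd.
  have := form_null (S_lin (-1) (S_comb Se _ y) Sd) Ss ny.
  rewrite form_lin//; last exact: S_comb.
  rewrite form_comb// big1 ?mulr0 ?add0r => [|i _]; first by rewrite form_sym.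
  by rewrite form_sym H mulr0.
have sub_lG g : L2 A g -> (l g <= G)%MS.
  move=> Lg; rewrite submxE; apply/eqP/rowP => j; rewrite [RHS]mxE.
  (* The columns of the cokernel matrix span the kernel of [G]; each is tested separately. *)
  pose y i := cokermx G i j.
  pose s := comb e (index_enum _) y.
  have Ss : S s by exact: S_comb.
  have ns : null s.
    apply: form_nondeg => // d Sd; apply: form_span => // i.
    have := congr1 (fun M : 'M[R]_m => M i j) (mulmx_coker G).
    rewrite !mxE => GE; rewrite form_comb// -[RHS]GE.
    by apply: eq_bigr => i' _; rewrite [G _ _]mxE form_sym mulrC.
  have := dotL_null k0 Ss ns Lg; rewrite dotL_comb// => E.
  rewrite mxE -[RHS]oppr0 -[X in _ = - X]E -sumrN; apply: eq_bigr => i _.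
  by rewrite mxE mulNr mulrC.
have sol g : L2 A g -> forall d, S d -> form (s0 g) d = - dotL A (Phi d k0) g.
  move=> Lg; have xG : x g *m G = l g by rewrite /x mulmxKpV// sub_lG.
  have Hj j : form (s0 g) (e j) = - dotL A (Phi (e j) k0) g.
    rewrite form_comb//.
    have := congr1 (fun M : 'rV[R]_m => M 0 j) xG; rewrite !mxE => <-.
    by apply: eq_bigr => i _; rewrite !mxE.
  move=> d Sd; have [y ny] := span d Sd.
  have Sc : S (comb e (index_enum _) y) by exact: S_comb.
  have E1 : form (comb e (index_enum _) y) (s0 g) = form d (s0 g).
    have := form_null (S_lin (-1) Sc Sd) (Ss0 g) ny; rewrite form_lin// mulN1r.
    by move/eqP; rewrite addrC subr_eq0 => /eqP ->.
  have E2 : dotL A (Phi (comb e (index_enum _) y) k0) g = dotL A (Phi d k0) g.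
    have := dotL_null k0 (S_lin (-1) Sc Sd) ny Lg; rewrite dotL_Phi_lin// mulN1r.
    by move/eqP; rewrite addrC subr_eq0 => /eqP ->.
  rewrite form_sym -E1 -E2 form_comb// dotL_comb// -sumrN.
  by apply: eq_bigr => i _; rewrite form_sym Hj mulrN.
split=> [g Lg|]; first by exists (s0 g) => //; exact: sol.
(* By Cauchy-Schwarz, the coefficient [x g 0 i] is at most [al i] times the norm of [g]. *)
pose al i := \sum_j L2norm A (Phi (e j) k0) * `|pinvmx G j i|.
have al0 i : 0 <= al i by apply: sumr_ge0 => j _; rewrite mulr_ge0// L2norm_ge0.
move=> k; pose C := 2 ^+ (size (index_enum 'I_m)) *
  \sum_(i <- index_enum 'I_m) al i ^+ 2 * dotL A (Phi (e i) k) (Phi (e i) k).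
have C0 : 0 <= C.
  rewrite mulr_ge0 ?exprn_ge0// sumr_ge0// => i _.
  by rewrite mulr_ge0 ?sqr_ge0// dotL_ge0.
exists C => // g s Lg Ss Hs.
(* Any solution agrees with [s0 g] modulo [null], so the estimate passes from [s0 g] to it. *)
have ns : null (sc (-1) (s0 g) + s).
  apply: form_nondeg; first exact: S_lin.
  by move=> d Sd; rewrite form_lin// sol// Hs// mulN1r opprK subrr.
have Ek f : L2 A f -> dotL A (Phi (s0 g) k) f = dotL A (Phi s k) f.
  move=> Lf; have := dotL_null k (S_lin (-1) (Ss0 g) Ss) ns Lf.
  rewrite dotL_Phi_lin// mulN1r.
  by move/eqP; rewrite addrC subr_eq0 => /eqP ->.
rewrite -Ek; last exact: Phi_L2.
rewrite dotLC -Ek; last exact: Phi_L2.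
apply: le_trans (dot_comb_le Se _ _ k) _.
rewrite /C -mulrA ler_wpM2l ?exprn_ge0// mulr_suml; apply: ler_sum => i _.
rewrite [leRHS]mulrAC ler_wpM2r ?dotL_ge0// -exprMn.
rewrite -(real_normK (num_real (x g 0 i))) lerXn2r ?nnegrE ?mulr_ge0 ?L2norm_ge0//.
rewrite /x mxE; apply: (le_trans (ler_norm_sum _ _ _)).
rewrite /al mulr_suml; apply: ler_sum => j _.
rewrite mxE normrM normrN mulrAC ler_wpM2r//.
by apply: cauchy_schwarz => //; exact: Phi_L2.
Qed.

Variables (same : V -> V -> Prop) (nrm : V -> R) (r : seq F).
Variable solution : (R * R -> R) -> V -> Prop.
Hypothesis sc_opp : forall s, sc (-1) s = - s.
Hypothesis solutionE : forall g s, L2 A g -> solution g s <->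
  S s /\ forall d, S d -> form s d = - dotL A (Phi d k0) g.
Hypothesis null_same : forall s s', S s -> S s' -> null (s - s') -> same s s'.
Hypothesis nrm_le : forall s, S s -> nrm s <= \sum_(k <- r) L2norm A (Phi s k).

(** The difference of two solutions solves the problem for the difference of the loads; uniqueness
    and the Lipschitz bound are both read off it. *)
Theorem abstract_well_posed : well_posed A same nrm solution.
Proof.
have [sol est] := form_solvable.
have S_sub s s' : S s -> S s' -> S (s - s').
  by move=> Ss Ss'; rewrite addrC -sc_opp; exact: S_lin.
have diff g g' s s' : L2 A g -> L2 A g' -> solution g s -> solution g' s' ->
    S (s - s') /\ forall d, S d -> form (s - s') d = - dotL A (Phi d k0) (g - g').
  move=> Lg Lg' /(solutionE _ Lg)[Ss Hs] /(solutionE _ Lg')[Ss' Hs'].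
  split=> [|d Sd]; first exact: S_sub.
  rewrite addrC -sc_opp form_lin// Hs// Hs'// (dotLC _ _ g) (dotLC _ _ g') (dotLC _ _ (g - g')).
  rewrite (_ : g - g' = fun x => -1 * g' x + g x); last first.
    by apply/funext => x; rewrite mulN1r addrC.
  by rewrite dotLl//; [rewrite mulrN opprD|exact: Phi_L2].
split.
- by move=> g Lg; have [s Ss Hs] := sol g Lg; exists s; apply/(solutionE _ Lg).
- move=> g s s' Lg Hs Hs'; have [Sd Hd] := diff _ _ _ _ Lg Lg Hs Hs'.
  have [Ss _] := (solutionE _ Lg).1 Hs; have [Ss' _] := (solutionE _ Lg).1 Hs'.
  apply: null_same => //; apply: form_nondeg => // d Sd'.
  by rewrite Hd// subrr dotLC dotL0 oppr0.
pose c k := sval (cid2 (est k)).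
have cP k : 0 <= c k /\ forall g s, L2 A g -> S s ->
    (forall d, S d -> form s d = - dotL A (Phi d k0) g) ->
    dotL A (Phi s k) (Phi s k) <= c k * L2norm A g ^+ 2.
  by rewrite /c; case: cid2.
exists (\sum_(k <- r) Num.sqrt (c k)) => [|g g' s s' Lg Lg' Hs Hs'].
  by apply: sumr_ge0 => k _; exact: sqrtr_ge0.
have [Sd Hd] := diff _ _ _ _ Lg Lg' Hs Hs'.
apply: (le_trans (nrm_le Sd)); rewrite mulr_suml; apply: ler_sum => k _.
have [ck0 ck] := cP k.
have Ld : L2 A (g - g').
  rewrite (_ : g - g' = fun x => -1 * g' x + g x); first exact: L2_lin.
  by apply/funext => x; rewrite mulN1r addrC.
rewrite -(@ler_pXn2r _ 2)// ?nnegrE ?mulr_ge0 ?L2norm_ge0 ?sqrtr_ge0//.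
by rewrite L2norm_sqr exprMn sqr_sqrtr//; exact: ck.
Qed.

End AbstractProblem.

(** * Integration by parts over the mesh *)

Section MeshFields.
Context {R : realType}.
Notation mu := (leb2 R).
Variables (A : set (R * R)) (n : nat) (T : 'I_n -> 'I_3 -> R * R).
Hypothesis A_bounded : bounded_set A.
Hypothesis A_polygonal : polygonal_domain A.
Hypothesis T_conforming : conforming_triangulation A T.
Implicit Types (H : 'I_n -> R * R -> R) (t : R * R).

Let T_nondeg k : nondeg (T k).
Proof. exact: (mesh_nondeg T_conforming). Qed.
Let A_open : open A.
Proof. exact: (mesh_open A_polygonal). Qed.

Lemma integrable_triangle k (f : R * R -> R) : continuous f ->
  mu.-integrable (triangle (T k)) (EFin \o f).
Proof.
move=> cf; apply: integrable_continuous => //.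
  exact: measurable_triangle (T_nondeg k).
exact: triangle_bounded (T_nondeg k).
Qed.

Lemma RintegralD_triangle k (f g : R * R -> R) : continuous f -> continuous g ->
  \int[mu]_(x in triangle (T k)) (f x + g x) =
  \int[mu]_(x in triangle (T k)) f x + \int[mu]_(x in triangle (T k)) g x.
Proof.
move=> cf cg; rewrite RintegralD//; try exact: integrable_triangle.
exact: measurable_triangle (T_nondeg k).
Qed.

Lemma RintegralZ_triangle k (a : R) (f : R * R -> R) : continuous f ->
  \int[mu]_(x in triangle (T k)) (a * f x) =
  a * \int[mu]_(x in triangle (T k)) f x.
Proof.
move=> cf; rewrite RintegralZl//; last exact: integrable_triangle.
exact: measurable_triangle (T_nondeg k).
Qed.

Lemma eq_Rintegral_triangle k (f g : R * R -> R) :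
  (forall x, triangle (T k) x -> f x = g x) ->
  \int[mu]_(x in triangle (T k)) f x = \int[mu]_(x in triangle (T k)) g x.
Proof. by move=> fg; apply: eq_Rintegral => x; rewrite inE => /fg. Qed.

Lemma Rintegral_triangle0 k (f : R * R -> R) :
  (forall x, triangle (T k) x -> f x = 0) -> \int[mu]_(x in triangle (T k)) f x = 0.
Proof.
by move=> /eq_Rintegral_triangle ->; rewrite Rintegral_cst ?mul0r//;
  exact: measurable_triangle (T_nondeg k).
Qed.

Lemma triangle_integral_eq0 k (f : R * R -> R) : continuous f ->
  (forall x, triangle (T k) x -> 0 <= f x) ->
  \int[mu]_(x in triangle (T k)) f x = 0 ->
  forall x, triangle (T k) x -> f x = 0.
Proof.
move=> cf f0 If x Tx; apply: (@continuous_ae0_triangle _ (T k) f x) => //.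
apply: Rintegral_eq0_ae => //; first exact: measurable_triangle (T_nondeg k).
exact: integrable_triangle.
Qed.

Definition vec t : 'rV[R]_2 := \row_j (if j == 0 then t.1 else t.2).

Definition along t (h1 h2 : R * R -> R) x : R := t.1 * h1 x + t.2 * h2 x.

Lemma continuous_along t (h1 h2 : R * R -> R) : continuous h1 -> continuous h2 ->
  continuous (along t h1 h2).
Proof. by move=> c1 c2; apply: continuousD_fun; exact: continuousZ_fun. Qed.

(** For a field of constant direction [t], div(H t) f + H t . grad f is the derivative of H f along
    [t], so the weak formulation becomes a statement about derivatives along lines. *)
Lemma weak_div_dir t H h1 h2 : (forall k, C1 (H k) (h1 k) (h2 k)) ->
  (forall f, test_function A f -> \sum_k \int[mu]_(x in triangle (T k))
    along t (fun x => h1 k x * f x + H k x * partial 0 f x)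
            (fun x => h2 k x * f x + H k x * partial 1 f x) x = 0) ->
  is_weak_div A (fun x => pw T H x *: vec t)
    (pw T (fun k => along t (h1 k) (h2 k))).
Proof.
move=> HC flux.
rewrite (_ : (fun x => _) =
    pwrow T (fun k x => H k x * t.1) (fun k x => H k x * t.2)); last first.
  apply/funext => x; apply/rowP => j; rewrite !mxE.
  by rewrite -(pwM T H (fun=> t.1)) -(pwM T H (fun=> t.2)); case: ifP.
have cH k : continuous (H k) by have [] := HC k.
have c1 k : continuous (h1 k) by have [] := HC k.
have c2 k : continuous (h2 k) by have [] := HC k.
apply: weak_div_pw => //.
- by move=> k; apply: continuousM_fun => //; exact: cst_continuous.
- by move=> k; apply: continuousM_fun => //; exact: cst_continuous.
- by move=> k; exact: continuous_along.
move=> f tf; rewrite -[RHS](flux f tf); apply: eq_bigr => k _.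
by apply: eq_Rintegral => x _; rewrite /along; ring.
Qed.

(** The pieces glue to a continuous function, and the test function vanishes outside a compact
    subset of [A]; their product, extended by 0, is continuous in the whole plane and so on every
    line. *)
Lemma weak_div_continuous t H h1 h2 : (forall k, C1 (H k) (h1 k) (h2 k)) ->
  (forall k l x, triangle (T k) x -> triangle (T l) x -> H k x = H l x) ->
  is_weak_div A (fun x => pw T H x *: vec t)
    (pw T (fun k => along t (h1 k) (h2 k))).
Proof.
move=> HC HT; apply: weak_div_dir => // f tf.
have fC := test_function_C1 tf; have [_ [K [_ KA f0]]] := tf.
have [t0|t0] := eqVneq t 0.
  by rewrite big1// => k _; apply: Rintegral_triangle0 => x _; rewrite /along t0 !mul0r addr0.
(* Any triangle containing [x] may be chosen, since the pieces agree on intersections. *)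
pose h x := if pselect (exists k, triangle (T k) x) is left e
  then H (sval (cid e)) x * f x else 0.
have hE k x : triangle (T k) x -> h x = H k x * f x.
  move=> Tx; rewrite /h; case: pselect => [e|[]]; last by exists k.
  by rewrite (HT _ k)//; exact: svalP (cid e).
have h0 x : (forall k, ~ triangle (T k) x) -> h x = 0.
  by move=> nT; rewrite /h; case: pselect => // e; have [k /nT] := e.
have HfC k := C1M (HC k) fC.
apply: (sum_triangles_lines T_nondeg (mesh_disj T_conforming) HfC hE h0 t0).
move=> z _ s; apply: continuous_comp; first exact: continuous_line2.
apply: (pw_continuous A_polygonal T_conforming _ hE h0) => [k|x].
  by have [] := HfC k.
have [Ax|nAx] := pselect (A x); first by left.
right; rewrite /h; case: pselect => // e; rewrite f0 ?mulr0// => Kx.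
exact/nAx/KA.
Qed.

Definition only (k : 'I_n) (f : R * R -> R) (l : 'I_n) : R * R -> R :=
  if l == k then f else fun=> 0.

Lemma only_C1 k (f f1 f2 : R * R -> R) l : C1 f f1 f2 ->
  C1 (only k f l) (only k f1 l) (only k f2 l).
Proof. by move=> fC; rewrite /only; case: ifP => // _; exact: C1_cst. Qed.

(** A bubble times a test function is again a bubble, and its derivative along the edge integrates
    to 0 on this triangle alone. The jump across the edge is tangential and produces no
    divergence. *)
Lemma weak_div_bubble k i j (q H h1 h2 : R * R -> R) : i != j -> continuous q ->
  C1 H h1 h2 -> (forall x, H x = lam (T k) i x * lam (T k) j x * q x) ->
  is_weak_div A (fun x => pw T (only k H) x *: vec (edge (T k) i j))
    (pw T (only k (along (edge (T k) i j) h1 h2))).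
Proof.
move=> ij cq HC HE; have := @weak_div_dir (edge (T k) i j) (only k H)
  (only k h1) (only k h2) (fun l => only_C1 k l HC).
rewrite (_ : (fun l => along _ (only k h1 l) (only k h2 l)) =
    only k (along (edge (T k) i j) h1 h2)); last first.
  apply/funext => l; rewrite /only; case: ifP => // _.
  by apply/funext => x; rewrite /along !mulr0 addr0.
apply=> f tf; have fC := test_function_C1 tf.
rewrite (bigD1 k)//= big1 => [|l /negbTE lk]; last first.
  by apply: Rintegral_triangle0 => x _; rewrite /along /only lk; ring.
rewrite addr0 /only eqxx.
apply: (@edge_bubble_integral0 _ (T k) i j (fun x => q x * f x)
  (fun x => H x * f x)) => //; last by move=> x; rewrite HE mulrA.
- by apply: continuousM_fun => //; have [] := fC.
- exact: C1M.
Qed.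

Lemma bubble_parts k i j (q H h1 h2 u u1 u2 : R * R -> R) : i != j ->
  continuous q -> C1 H h1 h2 ->
  (forall x, H x = lam (T k) i x * lam (T k) j x * q x) -> C1 u u1 u2 ->
  \int[mu]_(x in triangle (T k)) (along (edge (T k) i j) h1 h2 x * u x) =
  - \int[mu]_(x in triangle (T k)) (H x * along (edge (T k) i j) u1 u2 x).
Proof.
move=> ij cq HC HE uC; apply/eqP; rewrite -subr_eq0 opprK.
have [cH ch1 ch2 _] := HC; have [cu cu1 cu2 _] := uC.
rewrite -RintegralD_triangle; last 2 first.
- by apply: continuousM_fun => //; exact: continuous_along.
- by apply: continuousM_fun => //; exact: continuous_along.
apply/eqP; rewrite -[RHS](@edge_bubble_integral0 _ (T k) i j
  (fun x => q x * u x) (fun x => H x * u x) (fun x => h1 x * u x + H x * u1 x)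
  (fun x => h2 x * u x + H x * u2 x))//.
- by apply: eq_Rintegral => x _; rewrite /along; ring.
- exact: continuousM_fun.
- exact: C1M.
- by move=> x; rewrite HE mulrA.
Qed.

Lemma dotL_pw D (u : R * R -> R) P : (forall k, continuous (D k)) ->
  (forall k, continuous (P k)) -> L2 A u ->
  (forall k, ae_eq_on (triangle (T k)) u (P k)) ->
  dotL A (pw T D) u = \sum_k \int[mu]_(x in triangle (T k)) (D k x * P k x).
Proof.
move=> cD cP Lu uP; rewrite (@eq_dotL _ A A_open _ (pw T D) _ (pw T P))//.
- rewrite /dotL -(Rintegral_pw A_bounded A_polygonal T_conforming); last first.
    by move=> k; exact: continuousM_fun.
  apply: eq_Rintegral_ae; first exact: mesh_measurable A_polygonal.
  - by apply: measurable_funM; apply: L2_measurable; exact: L2_pw.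
  - by apply: L2_measurable; apply: L2_pw => // k; exact: continuousM_fun.
  apply: (aeon_cover (mesh_subset T_conforming)) => k.
  have := pw_ae T_conforming (fun k x => D k x * P k x) k.
  have := pw_ae T_conforming D k; have := pw_ae T_conforming P k.
  by apply: filterS3 => x HP HD HDP Tx; rewrite HP// HD// HDP.
- exact: L2_pw.
- exact: L2_pw.
- exact: L2_pw.
- exact: aeon_refl.
- exact: ae_pw.
Qed.

End MeshFields.

(** * Edges of a mesh *)

Section ExposedEdge.
Context {R : realType}.
Implicit Types (v : 'I_3 -> R * R) (t y z : R * R).

Lemma sum_third (F : 'I_3 -> R) i j m : i != j -> m != i -> m != j ->
  \sum_k F k = F i + F j + F m.
Proof.
move: i j m; apply: ord3P; apply: ord3P; apply: ord3P => //= _ _ _;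
  rewrite sum3E; ring.
Qed.

Lemma ord3_other (m : 'I_3) : exists i j, [/\ i != j, m != i & m != j].
Proof.
move: m; apply: ord3P; [by exists 1, 2%:R|by exists 0, 2%:R|by exists 0, 1].
Qed.

Lemma vertex_inj v i j : nondeg v -> v i = v j -> i = j.
Proof.
move=> v0 ij; apply/eqP; have := lam_vertex i j v0.
by rewrite -ij lam_vertex// eqxx; case: eqP => // _ /eqP; rewrite oner_eq0.
Qed.

Lemma lam_two_zeros v i m y : nondeg v -> i != m -> lam v i y = 0 ->
  lam v m y = 0 -> exists j, y = v j.
Proof.
move=> v0 im yi ym; have [j /andP[ji jm] third] := ord3_third im.
exists j; apply: (lam_inj v0) => k; rewrite lam_vertex//.
have yj : lam v j y = 1.
  by rewrite -(lam_sum y v0) (sum_third _ im ji jm) yi ym !add0r.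
case/or3P: (third k) => /eqP ->; rewrite ?yi ?ym ?yj ?eqxx//.
  by rewrite eq_sym (negbTE ji).
by rewrite eq_sym (negbTE jm).
Qed.

(** Coordinates that vanish at [y] do not decrease along [t], and the positive ones survive a short
    step. *)
Lemma enter_triangle v y t : nondeg v ->
  (forall i, 0 < lam v i y \/ lam v i y = 0 /\ 0 <= dot (dlam v i) t) ->
  exists2 e, 0 < e & triangle v (line y t e).
Proof.
move=> v0 H.
(* Where the coordinate vanishes no limit on the step arises, and 1 is a dummy. *)
pose x i := if 0 < lam v i y then lam v i y else 1.
have x0 i : 0 < x i by rewrite /x; case: ifP.
pose f i := x i / (`|dot (dlam v i) t| + 1).
have f0 i : 0 < f i by rewrite divr_gt0// ltr_pwDr.
exists (Num.min (f 0) (Num.min (f 1) (f 2%:R))); first by rewrite !lt_min !f0.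
set e := Num.min _ _.
have e0 : 0 <= e by rewrite !le_min !ltW.
have ef i : e <= f i.
  by move: i; apply: ord3P; rewrite /e !ge_min lexx ?orbT.
rewrite triangleE// => i; rewrite /= lam_line.
have [yi|[-> di]] := H i; last by rewrite add0r mulr_ge0.
have : e * (`|dot (dlam v i) t| + 1) <= lam v i y.
  by have := ef i; rewrite /f /x yi ler_pdivlMr// ltr_pwDr.
have : - (e * dot (dlam v i) t) <= e * `|dot (dlam v i) t|.
  by rewrite -mulrN ler_wpM2l// -normrN ler_norm.
lra.
Qed.

Variables (n : nat) (T : 'I_n -> 'I_3 -> R * R).
Hypothesis T_nondeg : forall k, nondeg (T k).
Hypothesis T_disj : forall k l, k != l ->
  exists m, forall x, triangle (T k) x -> triangle (T l) x -> lam (T k) m x = 0.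

(* Among the bad triangles crossed by a generic horizontal line, [k] is the one
   that the line leaves last, through the edge opposite to [m]. *)
Lemma exposed_edge (bad : 'I_n -> Prop) k0 : bad k0 ->
  exists k m, bad k /\ forall l, l != k ->
    (forall i, i != m -> exists j, T l j = T k i) -> ~ bad l.
Proof.
move=> bad0; pose t : R * R := (1, 0).
have crossE y : cross t y = y.2 by rewrite /cross /= mul1r mul0r subr0.
(* The centre is moved up a little, to a height that is not the height of any vertex. *)
have [z zT gz] : exists2 z, (forall i, 0 < lam (T k0) i z) & generic T t z.
  have c0 i : 0 < lam (T k0) i (center (T k0)) by rewrite lam_center// invr_gt0.
  have [e e0] := enter_triangle (t := (0, 1)) (T_nondeg k0) (fun i => or_introl (c0 i)).
  rewrite triangleE// => eT.
  pose Z := range (fun ki : 'I_n * 'I_3 => (T ki.1 ki.2).2 - (center (T k0)).2).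
  have [|s /andP[s0 se] sZ] := @exists_notin_finite _ Z _ _ e0.
    exact/finite_image/finite_finset.
  exists (line (center (T k0)) (0, 1) s).
    move=> i; have := eT i; have := c0 i; rewrite /= /line !lam_line.
    have [d0|d0] := leP 0 (dot (dlam (T k0) i) (0, 1)).
      by move=> l0 _; rewrite ltr_wpDr// mulr_ge0// ltW.
    move=> _ /le_lt_trans; apply; rewrite ltrD2l.
    by rewrite ltr_nM2r.
  move=> k i; rewrite !crossE; apply/eqP => E; apply: sZ; exists (k, i) => //=.
  by rewrite E /line /= mulr1 addrC addKr.
have [|ab abP] := @choice _ _ (fun k (ab : R * R) => forall s,
    triangle (T k) (line z t s) <-> ab.1 <= s <= ab.2).
  move=> k; have [a [b H]] := triangle_section z (T_nondeg k) (or_introl (erefl : t.1 = 1)).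
  by exists (a, b).
have line_line s s' : line (line z t s) t s' = line z t (s + s').
  by rewrite /line /= !mulrDl !addrA.
have line_opp s s' : line (line z t s) (- t.1, - t.2) s' = line z t (s - s').
  by rewrite /line /=; congr (_, _); ring.
have z0 : line z t 0 = z by rewrite /line !mul0r !addr0; case: (z).
(* The strict inequality excludes triangles missed by the line, whose bounds are arbitrary. *)
pose P k := `[< bad k /\ (ab k).1 < (ab k).2 >].
have Pk0 : P k0.
  apply/asboolP; split=> //.
  have [e e0 Te] := enter_triangle (t := t) (T_nondeg k0) (fun i => or_introl (zT i)).
  have /abP /andP[a0 _] : triangle (T k0) (line z t 0).
    by rewrite z0 triangleE// => i; exact: ltW.
  have /abP /andP[_ be] : triangle (T k0) (line z t e) by [].
  exact: le_lt_trans a0 (lt_le_trans e0 be).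
have [k /asboolP[badk abk] kmax] := @Order.TotalTheory.arg_maxP _ _ _ k0 P (fun k => (ab k).2) Pk0.
pose y := line z t (ab k).2.
have yT : triangle (T k) y by apply/abP; rewrite lexx ltW.
have y0 i : 0 <= lam (T k) i y by move: yT; rewrite triangleE.
(* Otherwise the line could be followed a little further inside the triangle. *)
have [m ym] : exists m, lam (T k) m y = 0.
  apply: contrapT => /forallNP ny.
  have [|e e0 Te] := @enter_triangle (T k) y t (T_nondeg k).
    by move=> i; left; rewrite lt_neqAle y0 andbT eq_sym; apply/eqP/ny.
  have /abP /andP[_] : triangle (T k) (line z t ((ab k).2 + e)) by rewrite -line_line.
  by rewrite leNgt ltrDl e0.
have y_vertex l j : y <> T l j.
  by move=> E; have := gz l j; rewrite -E !crossE /y /line /= mulr0 addr0 eqxx.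
have ypos i : i != m -> 0 < lam (T k) i y.
  move=> im; rewrite lt_neqAle y0 andbT eq_sym; apply/eqP => yi.
  by have [j /y_vertex] := lam_two_zeros (T_nondeg k) im yi ym.
exists k, m; split=> // l lk share badl.
have [i1 [i2 [i12 mi1 mi2]]] := ord3_other m.
have im1 : i1 != m by rewrite eq_sym.
have im2 : i2 != m by rewrite eq_sym.
have [j1 E1] := share i1 im1.
have [j2 E2] := share i2 im2.
have j12 : j1 != j2.
  apply: contra_neq i12 => j12; apply: vertex_inj (T_nondeg k) _.
  by rewrite -E1 -E2 j12.
(* The exit point is a combination of the two shared vertices, with positive weights because it is
   not a vertex; this gives its coordinates in the neighbour. *)
have lamE j : lam (T l) j y = lam (T k) i1 y * (j == j1)%:R + lam (T k) i2 y * (j == j2)%:R.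
  rewrite {1}(lam_combination y (T_nondeg k)) lam_affine; last exact: lam_sum.
  by rewrite (sum_third _ i12 mi1 mi2) ym mul0r addr0 -E1 -E2 !lam_vertex.
have [m' /andP[mj1 mj2] third] := ord3_third j12.
have lm' : lam (T l) m' y = 0 by rewrite lamE (negbTE mj1) (negbTE mj2) !mulr0 addr0.
have lpos j : j != m' -> 0 < lam (T l) j y.
  move=> jm; rewrite lamE; case/or3P: (third j) jm => /eqP ->; rewrite ?eqxx//.
    by rewrite (negbTE j12) mulr1 mulr0 addr0 ypos// eq_sym.
  by rewrite (eq_sym j2 j1) (negbTE j12) mulr1 mulr0 add0r ypos// eq_sym.
have yTl : triangle (T l) y.
  rewrite triangleE// => j; have [->|/lpos/ltW//] := eqVneq j m'.
  by rewrite lm'.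
have /andP[al bl] := (abP l _).1 yTl.
have d0 : dot (dlam (T l) m') t != 0.
  apply/eqP => d0; have := lam_sub (T l) m' y (T l j1).
  rewrite lm' lam_vertex// (negbTE mj1) subrr => /esym.
  move=> /(cross_dot0 (dlam_neq0 m' (T_nondeg l)) d0); rewrite crossE /= => /eqP.
  rewrite subr_eq0 => /eqP E; have := gz l j1.
  by rewrite !crossE E /y /line /= mulr0 addr0 eqxx.
(* The line is not parallel to the shared edge, so from [y] it enters the neighbour either forwards
   or backwards. *)
have abl : (ab l).1 < (ab l).2.
  have [dp|dn] := ltP 0 (dot (dlam (T l) m') t).
    have [|e e0] := @enter_triangle (T l) y t (T_nondeg l).
      move=> j; have [->|/lpos] := eqVneq j m'; last by left.
      by right; rewrite lm' ltW.
    rewrite line_line => /abP /andP[_ be].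
    by apply: le_lt_trans al (lt_le_trans _ be); rewrite ltrDl.
  have [|e e0] := @enter_triangle (T l) y (- t.1, - t.2) (T_nondeg l).
    move=> j; have [->|/lpos] := eqVneq j m'; last by left.
    right; rewrite lm'; split=> //; move: dn.
    by rewrite /dot /= !mulrN -opprD oppr_ge0.
  rewrite line_opp => /abP /andP[ae _].
  by apply: le_lt_trans ae (lt_le_trans _ bl); rewrite gtrBl.
have Pl : P l by apply/asboolP.
have blk : (ab l).2 <= (ab k).2 by exact: kmax.
have {bl blk} bE : (ab l).2 = (ab k).2 by apply/eqP; rewrite eq_le blk.
(* By maximality both triangles are left at the same point; then both contain the line from the
   later entry on, which makes two common points. *)
pose s := Num.max (ab k).1 (ab l).1.
have sb : s < (ab k).2 by rewrite gt_max abk -bE.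
have kl : k != l by rewrite eq_sym.
have sT : triangle (T k) (line z t s).
  by apply/abP; rewrite /s le_max lexx /= ltW.
have sTl : triangle (T l) (line z t s).
  by apply/abP; rewrite /s le_max lexx orbT /= bE ltW.
have := generic_sections T_nondeg T_disj kl gz sT sTl yT yTl.
by move/eqP; rewrite lt_eqF.
Qed.

End ExposedEdge.

(** * Hat functions of a conforming mesh *)

Section Hats.
Context {R : realType}.
Variables (A : set (R * R)) (n : nat) (T : 'I_n -> 'I_3 -> R * R).
Hypothesis T_conforming : conforming_triangulation A T.

Let T_nondeg k : nondeg (T k).
Proof. exact: (mesh_nondeg T_conforming). Qed.

(* 0 when [a] is not a vertex of [T k], so that the products of hat functions
   below are supported on the triangles sharing an edge. *)
Definition hat k (a : R * R) (x : R * R) : R :=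
  \sum_i (T k i == a)%:R * lam (T k) i x.

Definition dhat k (a : R * R) : R * R :=
  (\sum_i (T k i == a)%:R * (dlam (T k) i).1,
   \sum_i (T k i == a)%:R * (dlam (T k) i).2).

Lemma hat_C1 k a : C1 (hat k a) (fun=> (dhat k a).1) (fun=> (dhat k a).2).
Proof. by apply: C1_sum => i; apply: C1Z; exact: C1_lam. Qed.

Lemma hat_poly k a : poly2 1 (hat k a).
Proof.
by apply: poly2_sum => i; apply: poly2Z; exact: poly2_lam.
Qed.

Lemma hat_eq0 k a : (forall i, T k i <> a) ->
  (forall x, hat k a x = 0) /\ dhat k a = (0, 0).
Proof.
move=> H; have F (G : 'I_3 -> R) : \sum_i (T k i == a)%:R * G i = 0.
  by rewrite big1// => i _; case: eqP => [/H//|_]; rewrite mul0r.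
by split=> [x|]; rewrite /hat /dhat ?F.
Qed.

Lemma hat_vertex k i : (forall x, hat k (T k i) x = lam (T k) i x) /\
  dhat k (T k i) = dlam (T k) i.
Proof.
have F (G : 'I_3 -> R) : \sum_j (T k j == T k i)%:R * G j = G i.
  rewrite (bigD1 i)//= eqxx mul1r big1 ?addr0// => j /eqP ji.
  by case: eqP => [/(vertex_inj (T_nondeg k))//|_]; rewrite mul0r.
by split=> [x|]; rewrite /hat /dhat ?F//; case: dlam.
Qed.

Lemma hat_at_vertex k j a : hat k a (T k j) = (T k j == a)%:R.
Proof.
rewrite /hat (bigD1 j)//= lam_vertex// eqxx mulr1 big1 ?addr0// => i ij.
by rewrite lam_vertex// (negbTE ij) mulr0.
Qed.

Lemma hat_affine k a (l : 'I_3 -> R) (q : 'I_3 -> R * R) : \sum_j l j = 1 ->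
  hat k a (\sum_j l j * (q j).1, \sum_j l j * (q j).2) = \sum_j l j * hat k a (q j).
Proof.
move=> l1; rewrite /hat; under eq_bigr do rewrite lam_affine// mulr_sumr.
rewrite exchange_big; apply: eq_bigr => j _ /=; rewrite mulr_sumr.
by apply: eq_bigr => i _; ring.
Qed.

(** By conformity the point lies in a face of [T l] that is contained in [T k]. It is an extreme
    point of [T k], so a vertex of that face with nonzero weight coincides with it. *)
Lemma vertex_of_neighbour k l i : triangle (T l) (T k i) -> exists j, T k i = T l j.
Proof.
move=> Tl; have [->|kl] := eqVneq k l; first by exists i.
have [_ _ /(_ k l kl)[S [S' [_ _ _ IE]]]] := T_conforming.
have : face (T l) S' (T k i) by rewrite -IE; split=> //; exact: vertex_triangle.
move=> [w [w0 wS w1 wE]].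
have [j [jS wj]] : exists j, j \in S' /\ w j != 0.
  apply: contrapT => /forallNP H; move: w1; rewrite big1; first by move/eqP; rewrite eq_sym oner_eq0.
  move=> j _; apply/eqP; apply: contrapT => /negP wj; apply: (H j); split=> //.
  by apply: contrapT => /negP /wS w0'; rewrite w0' eqxx in wj.
exists j; apply: lam_inj (T_nondeg k) _ => m.
have le1 j' : j' \in S' -> forall m, 0 <= lam (T k) m (T l j').
  move=> j'S; have : triangle (T k) (T l j').
    suff : face (T l) S' (T l j') by rewrite -IE => -[].
    rewrite faceE//; split=> i'; rewrite lam_vertex ?ler0n// => i'S.
    by case: eqP i'S => // ->; rewrite j'S.
  by rewrite triangleE.
(* The coordinate [i] is at most 1 on these vertices and its weighted mean is 1, so it equals 1
   wherever the weight is nonzero. *)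
have li : lam (T k) i (T l j) = 1.
  have ge0 j' : 0 <= w j' * (1 - lam (T k) i (T l j')).
    have [/le1 jS'|/wS ->] := boolP (j' \in S'); last by rewrite mul0r.
    rewrite mulr_ge0// subr_ge0 -(lam_sum (T l j') (T_nondeg k)) (bigD1 i)//=.
    by rewrite lerDl sumr_ge0.
  have : \sum_j' w j' * (1 - lam (T k) i (T l j')) = 0.
    under eq_bigr do rewrite mulrBr mulr1; rewrite sumrB w1.
    by rewrite -lam_affine// -wE lam_vertex// eqxx subrr.
  move=> /eqP; rewrite psumr_eq0// => /allP /(_ j).
  rewrite mem_index_enum mulf_eq0 (negbTE wj) subr_eq0 /= => /(_ isT) /eqP <-//.
have [->|mi] := eqVneq m i; first by rewrite lam_vertex// eqxx li.
rewrite lam_vertex// (negbTE mi).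
have : \sum_(i' | i' != i) lam (T k) i' (T l j) = 0.
  have := lam_sum (T l j) (T_nondeg k); rewrite (bigD1 i)//= li => /eqP.
  by rewrite -subr_eq0 addrAC subrr add0r => /eqP.
move=> /eqP; rewrite psumr_eq0; last by move=> i' _; exact: le1.
by move=> /allP /(_ m (mem_index_enum _)) /implyP /(_ mi) /eqP ->.
Qed.

(** A common point is a combination of common vertices, where the value of the hat does not depend
    on the triangle. *)
Lemma hat_agree k l a x : triangle (T k) x -> triangle (T l) x ->
  hat k a x = hat l a x.
Proof.
have [->//|kl] := eqVneq k l; move=> Tk Tl.
have [_ _ /(_ k l kl)[S [S' [_ _ IE _]]]] := T_conforming.
have : face (T k) S x by rewrite -IE.
rewrite faceE// => -[x0 xS].
rewrite (lam_combination x (T_nondeg k)) !hat_affine; [|exact: lam_sum..].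
apply: eq_bigr => i _; have [iS|/xS ->] := boolP (i \in S); last by rewrite !mul0r.
have /vertex_of_neighbour[j E] : triangle (T l) (T k i).
  suff : face (T k) S (T k i) by rewrite -IE => -[].
  rewrite faceE//; split=> j; rewrite lam_vertex ?ler0n// => jS.
  by case: eqP jS => // ->; rewrite iS.
by rewrite hat_at_vertex E hat_at_vertex.
Qed.

(** In the first two cases one of the hats of the ends of the edge vanishes on [T l]; so a product
    of both lives on the triangles sharing the edge. *)
Lemma edge_neighbour k l i j m : i != j -> m != i -> m != j ->
  [\/ forall h, T l h <> T k i, forall h, T l h <> T k j |
      forall h, h != m -> exists h', T l h' = T k h].
Proof.
move=> ij mi mj.
have [[hi Ti]|/forallNP ni] := pselect (exists h, T l h = T k i); last exact: Or31.
have [[hj Tj]|/forallNP nj] := pselect (exists h, T l h = T k j); last exact: Or32.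
apply: Or33 => h hm; have [g /andP[gi gj] third] := ord3_third ij.
have /eqP mg : m == g by have := third m; rewrite (negbTE mi) (negbTE mj).
by case/or3P: (third h) hm => /eqP ->; [exists hi|exists hj|rewrite mg eqxx].
Qed.

End Hats.

(** * Strains and rigid motions on a triangle *)

Section TriangleCalculus.
Context {R : realType}.
Implicit Types (v : 'I_3 -> R * R) (a b c t w x y : R * R).

Lemma C1_unique (H G h1 h2 g1 g2 : R * R -> R) : H =1 G -> C1 H h1 h2 ->
  C1 G g1 g2 -> h1 = g1 /\ h2 = g2.
Proof.
move=> /funext <- [_ _ _ dH] [_ _ _ dG].
have E x t : t.1 * h1 x + t.2 * h2 x = t.1 * g1 x + t.2 * g2 x.
  have x0 : line x t 0 = x by rewrite /line !mul0r !addr0; case: (x).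
  have := @derive_val _ _ _ _ _ _ _ (dH x t 0).
  by rewrite (@derive_val _ _ _ _ _ _ _ (dG x t 0)) x0 => ->.
split; apply/funext => x.
  by have := E x (1, 0); rewrite /= !mul1r !mul0r !addr0.
by have := E x (0, 1); rewrite /= !mul1r !mul0r !add0r.
Qed.

Lemma segment_constant v (u u1 u2 : R * R -> R) x y : nondeg v -> C1 u u1 u2 ->
  triangle v x -> triangle v y ->
  (forall z, triangle v z -> along (y.1 - x.1, y.2 - x.2) u1 u2 z = 0) -> u x = u y.
Proof.
move=> v0 [cu cu1 cu2 du] Tx Ty H; pose t : R * R := (y.1 - x.1, y.2 - x.2).
have cD : continuous (along t u1 u2 \o line x t).
  move=> s; apply: continuous_comp; first exact: continuous_line2.
  exact: continuous_along.
have := FTC_segment ler01 (du x t) cD.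
rewrite integral0_eq => [|s]; last first.
  rewrite /= in_itv /= => s01.
  by congr (_%:E); apply: H; exact: triangle_convex.
move=> /esym/eqP; rewrite eqe subr_eq0 => /eqP /=.
rewrite /line /= !mul1r !mul0r !addr0 !(addrC _ (_ - _)) !subrK.
by case: (x); case: (y) => /= ? ? ? ? ->.
Qed.

Definition wedge a b : R := a.1 * b.2 - b.1 * a.2.

Lemma wedge_edges v i j m : nondeg v -> i != j -> m != i -> m != j ->
  wedge (edge v i j) (edge v i m) != 0.
Proof.
rewrite nondegP /tdet => v0.
move: i j m; apply: ord3P; apply: ord3P; apply: ord3P => //= _ _ _;
  apply: contra_neq v0 => E; move: E; rewrite /wedge /edge /= => E; lra.
Qed.

Lemma dot_basis0 a b w : wedge a b != 0 -> dot a w = 0 -> dot b w = 0 -> w = (0, 0).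
Proof.
move=> d0 ha hb.
have E1 : wedge a b * w.1 = 0.
  rewrite (_ : wedge a b * w.1 = b.2 * dot a w - a.2 * dot b w); first by rewrite ha hb !mulr0 subrr.
  by rewrite /wedge /dot; ring.
have E2 : wedge a b * w.2 = 0.
  rewrite (_ : wedge a b * w.2 = a.1 * dot b w - b.1 * dot a w); first by rewrite ha hb !mulr0 subrr.
  by rewrite /wedge /dot; ring.
move/eqP: E1; move/eqP: E2; rewrite !mulf_eq0 (negbTE d0) /= => /eqP E2 /eqP E1.
by case: w E1 E2 {ha hb} => w1 w2 /= -> ->.
Qed.

Lemma dot_self0 w : dot w w = 0 -> w = (0, 0).
Proof.
move/eqP; rewrite /dot -!expr2 paddr_eq0 ?sqr_ge0// !sqrf_eq0.
by case: w => w1 w2 /= /andP[/eqP -> /eqP ->].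
Qed.

Lemma dot_self_ge0 w : 0 <= dot w w.
Proof. by rewrite /dot addr_ge0// -expr2 sqr_ge0. Qed.

(* The quadratic form [t . (D u) t] of the gradients [a], [b] of the two
   components of a vector field [u]. *)
Definition strain (a b : R * R) t : R := t.1 * dot t a + t.2 * dot t b.

Lemma strain0 (a b e f : R * R) : wedge e f != 0 -> strain a b e = 0 ->
  strain a b f = 0 -> strain a b (f.1 - e.1, f.2 - e.2) = 0 ->
  [/\ a.1 = 0, b.2 = 0 & a.2 + b.1 = 0].
Proof.
move=> d0 he hf hef.
(* The polar form at [e] and [f]. In the basis [e], [f] it completes the data of the symmetric part
   of the gradient, which the identities below express in the standard basis. *)
pose B := (strain a b e + strain a b f - strain a b (f.1 - e.1, f.2 - e.2)).
have B0 : B = 0 by rewrite /B he hf hef subr0 addr0.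
have E1 : wedge e f ^+ 2 * a.1 = f.2 ^+ 2 * strain a b e - f.2 * e.2 * B
    + e.2 ^+ 2 * strain a b f.
  by rewrite /B /wedge /strain /dot /=; ring.
have E2 : wedge e f ^+ 2 * b.2 = f.1 ^+ 2 * strain a b e - f.1 * e.1 * B
    + e.1 ^+ 2 * strain a b f.
  by rewrite /B /wedge /strain /dot /=; ring.
have E3 : wedge e f ^+ 2 * (a.2 + b.1) = - 2 * f.1 * f.2 * strain a b e
    + (f.1 * e.2 + e.1 * f.2) * B - 2 * e.1 * e.2 * strain a b f.
  by rewrite /B /wedge /strain /dot /=; ring.
have Z z : wedge e f ^+ 2 * z = 0 -> z = 0.
  by move=> /eqP; rewrite mulf_eq0 expf_eq0 /= (negbTE d0) => /eqP.
by split; apply: Z; rewrite ?E1 ?E2 ?E3 he hf B0 !mulr0 ?subrr ?addr0 ?subr0.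
Qed.

(** The barycentric coordinates of the vertex [v i] translated by [c]. *)
Lemma edge_decomposition v i j m c : nondeg v -> i != j -> m != i -> m != j ->
  c = (dot (dlam v j) c * (edge v i j).1 + dot (dlam v m) c * (edge v i m).1,
       dot (dlam v j) c * (edge v i j).2 + dot (dlam v m) c * (edge v i m).2).
Proof.
move=> v0 ij mi mj; have := lam_combination ((v i).1 + c.1, (v i).2 + c.2) v0.
have L k : lam v k ((v i).1 + c.1, (v i).2 + c.2) = (k == i)%:R + dot (dlam v k) c.
  by rewrite -(lam_vertex k i v0) /lam /dot /=; ring.
have S : dot (dlam v i) c + dot (dlam v j) c + dot (dlam v m) c = 0.
  have [s1 s2] := dlam_sum v0; move: s1 s2.
  rewrite !(sum_third _ ij mi mj) /dot => s1 s2.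
  transitivity (((dlam v i).1 + (dlam v j).1 + (dlam v m).1) * c.1 +
    ((dlam v i).2 + (dlam v j).2 + (dlam v m).2) * c.2); first by ring.
  by rewrite s1 s2 !mul0r addr0.
rewrite !(sum_third _ ij mi mj) !L eqxx (eq_sym j) (negbTE ij) (negbTE mi).
have {S}-> : dot (dlam v i) c = - dot (dlam v j) c - dot (dlam v m) c by lra.
move=> [E1 E2]; rewrite {1}(surjective_pairing c) /edge /=; congr (_, _).
  by rewrite -[LHS](addrK (v i).1) (addrC c.1) E1; ring.
by rewrite -[LHS](addrK (v i).2) (addrC c.2) E2; ring.
Qed.

(* The hypothesis says that [u] is an infinitesimal rigid motion. *)
Lemma rigid_affine v (u : R * R -> R * R) : nondeg v ->
  (forall x y, triangle v x -> triangle v y ->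
    dot (y.1 - x.1, y.2 - x.2) ((u y).1 - (u x).1, (u y).2 - (u x).2) = 0) ->
  forall x, triangle v x ->
    (u x).1 = \sum_i lam v i x * (u (v i)).1 /\
    (u x).2 = \sum_i lam v i x * (u (v i)).2.
Proof.
move=> v0 H x Tx.
have Tv i := vertex_triangle i v0.
have H01 := H _ _ (Tv 0) (Tv 1); have H02 := H _ _ (Tv 0) (Tv 2%:R).
have H12 := H _ _ (Tv 1) (Tv 2%:R).
have X0 := H _ _ (Tv 0) Tx; have X1 := H _ _ (Tv 1) Tx.
have X2 := H _ _ (Tv 2%:R) Tx.
have := lam_combination x v0; have := lam_sum x v0; rewrite !sum3E.
set l0 := lam v 0 x; set l1 := lam v 1 x; set l2 := lam v 2%:R x => l1E xE.
have [x1E x2E] : x.1 = l0 * (v 0).1 + l1 * (v 1).1 + l2 * (v 2%:R).1 /\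
    x.2 = l0 * (v 0).2 + l1 * (v 1).2 + l2 * (v 2%:R).2 by split; rewrite {1}xE.
have l0E : l0 = 1 - l1 - l2 by lra.
move: l0 l1 l2 l1E x1E x2E l0E {xE} => l0 l1 l2 l1E x1E x2E l0E.
pose al := edge v 0 1; pose be := edge v 0 2%:R.
have d0 : wedge al be != 0 by exact: wedge_edges.
pose g i : R * R := ((u (v i)).1 - (u (v 0)).1, (u (v i)).2 - (u (v 0)).2).
(* The deviation of [u x] from affine interpolation; rigidity against the three vertices makes it
   orthogonal to two independent edges. *)
pose W : R * R := ((u x).1 - (u (v 0)).1 - l1 * (g 1).1 - l2 * (g 2%:R).1,
                   (u x).2 - (u (v 0)).2 - l1 * (g 1).2 - l2 * (g 2%:R).2).
pose V : R * R := ((u x).1 - (u (v 0)).1, (u x).2 - (u (v 0)).2).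
have gba : dot al (g 2%:R) = - dot be (g 1).
  suff : dot al (g 2%:R) + dot be (g 1) = dot al (g 1) + dot be (g 2%:R) -
    dot ((v 2%:R).1 - (v 1).1, (v 2%:R).2 - (v 1).2)
      ((u (v 2%:R)).1 - (u (v 1)).1, (u (v 2%:R)).2 - (u (v 1)).2).
    rewrite H12 subr0; rewrite /dot /al /be /edge /g /= in H01 H02 *; lra.
  by rewrite /dot /al /be /edge /g /=; ring.
have E0 : l1 * dot al V + l2 * dot be V = 0.
  rewrite -[RHS]X0 x1E x2E l0E /dot /V /al /be /edge /=; ring.
have E1 : dot al V - dot al (g 1) - (l1 * dot al V + l2 * dot be V)
    + l1 * dot al (g 1) + l2 * dot be (g 1) = 0.
  rewrite -[RHS]oppr0 -[X in _ = - X]X1 x1E x2E l0E /dot /V /al /be /g /edge /=; ring.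
have E2 : dot be V - dot be (g 2%:R) - (l1 * dot al V + l2 * dot be V)
    + l1 * dot al (g 2%:R) + l2 * dot be (g 2%:R) = 0.
  rewrite -[RHS]oppr0 -[X in _ = - X]X2 x1E x2E l0E /dot /V /al /be /g /edge /=; ring.
have W0 : W = (0, 0).
  apply: (dot_basis0 d0).
    rewrite (_ : dot al W = dot al V - l1 * dot al (g 1) - l2 * dot al (g 2%:R)); last first.
      by rewrite /dot /W /V /=; ring.
    rewrite E0 in E1; rewrite gba; have : dot al (g 1) = 0 by exact: H01.
    by move=> z; rewrite z in E1 *; lra.
  rewrite (_ : dot be W = dot be V - l1 * dot be (g 1) - l2 * dot be (g 2%:R)); last first.
    by rewrite /dot /W /V /=; ring.
  rewrite E0 gba in E2; have : dot be (g 2%:R) = 0 by exact: H02.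
  by move=> z; rewrite z in E2 *; lra.
move: W0; rewrite /W /g /= l0E => -[W1 W2]; split; lra.
Qed.

End TriangleCalculus.

(** * Flux of cubic fields through an edge *)

Section Flux.
Context {R : realType}.
Notation mu := (leb2 R).
Variables (A : set (R * R)) (n : nat) (T : 'I_n -> 'I_3 -> R * R).
Hypothesis T_conforming : conforming_triangulation A T.

Let T_nondeg k : nondeg (T k).
Proof. exact: (mesh_nondeg T_conforming). Qed.

Variables (k : 'I_n) (i j m : 'I_3).
Hypothesis ij : i != j.
Hypothesis mi : m != i.
Hypothesis mj : m != j.
Notation l_ := (lam (T k)).
Notation I f := (\int[mu]_(x in triangle (T k)) f x).

(* [c] is a combination of the edges [i j] and [i m], and the derivative along
   [i j] integrates to 0 because [G] vanishes on the two other edges. *)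
Lemma flux_edge (c : R * R) (g G g1 g2 : R * R -> R) : continuous g -> C1 G g1 g2 ->
  (forall x, G x = l_ i x * l_ j x * g x) ->
  I (along c g1 g2) = dot (dlam (T k) m) c * I (along (edge (T k) i m) g1 g2).
Proof.
move=> cg GC GE; have [cG c1 c2 _] := GC.
have z := edge_bubble_integral0 (T_nondeg k) ij cg GC GE.
rewrite -(RintegralZ_triangle T_conforming); last exact: continuous_along.
rewrite -[RHS]add0r -[X in X + _](mulr0 (dot (dlam (T k) j) c)).
rewrite -{1}z -(RintegralZ_triangle T_conforming); last exact: continuous_along.
rewrite -(RintegralD_triangle T_conforming); last 2 first.
- by apply: continuousZ_fun; exact: continuous_along.
- by apply: continuousZ_fun; exact: continuous_along.
apply: eq_Rintegral => x _.
by rewrite {1}(edge_decomposition c (T_nondeg k) ij mi mj) /along /=; ring.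
Qed.

Let cl h : continuous (l_ h). Proof. exact: continuous_lam. Qed.

(** The derivative of (lam_i lam_j)^2 along the edge is 2 (lam_i^2 lam_j - lam_i lam_j^2), and it
    integrates to 0. *)
Lemma integral_lam2_lam : I (fun x => l_ i x * l_ j x ^+ 2) =
  I (fun x => l_ i x ^+ 2 * l_ j x).
Proof.
have GC := C1M (C1M (C1_lam (T k) i) (C1_lam (T k) j))
               (C1M (C1_lam (T k) i) (C1_lam (T k) j)).
have cll : continuous (fun x => l_ i x * l_ j x) by exact: continuousM_fun.
have := edge_bubble_integral0 (T_nondeg k) ij cll GC (fun=> erefl).
have dE h := dlam_edge h i j (T_nondeg k).
have di : dot (dlam (T k) i) (edge (T k) i j) = -1 by rewrite dE (negbTE ij) eqxx sub0r.
have dj : dot (dlam (T k) j) (edge (T k) i j) = 1 by rewrite dE eq_sym (negbTE ij) eqxx subr0.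
rewrite (@eq_Rintegral_triangle _ _ T k _ (fun x => 2 * (l_ i x ^+ 2 * l_ j x) +
   (-2) * (l_ i x * l_ j x ^+ 2))); last first.
  move=> x _; transitivity (2 * (dot (dlam (T k) i) (edge (T k) i j) * l_ j x
    + dot (dlam (T k) j) (edge (T k) i j) * l_ i x) * (l_ i x * l_ j x)).
    by rewrite /dot; ring.
  by rewrite di dj; ring.
have c1 : continuous (fun x => l_ i x ^+ 2 * l_ j x).
  by apply: continuousM_fun => //; apply: continuousM_fun.
have c2 : continuous (fun x => l_ i x * l_ j x ^+ 2).
  by apply: continuousM_fun => //; apply: continuousM_fun.
rewrite (RintegralD_triangle T_conforming); last 2 first.
- exact: continuousZ_fun.
- exact: continuousZ_fun.
by rewrite !(RintegralZ_triangle T_conforming)//; lra.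
Qed.

Lemma integral_lam_gt0 (f : R * R -> R) : continuous f ->
  (forall x, (forall h, 0 <= l_ h x) -> 0 <= f x) -> 0 < f (center (T k)) -> 0 < I f.
Proof.
move=> cf f0 fc; have fT x : triangle (T k) x -> 0 <= f x.
  by rewrite triangleE// => /f0.
rewrite lt_neqAle Rintegral_ge0 ?andbT; last by move=> x /fT.
apply/eqP => /esym If.
have := triangle_integral_eq0 T_conforming cf fT If (x := center (T k)).
rewrite triangleE// => /(_ _)/eqP; rewrite gt_eqF// => H; apply: notF; apply: H.
by move=> h; rewrite lam_center// invr_ge0.
Qed.

(** Up to a factor this is the integral over the edge i j of lam_i^2 lam_j L, which only sees the
    values of [L] at its ends. *)
Lemma flux_moment (f : 'I_3 -> R) (L G g1 g2 : R * R -> R) :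
  (forall x, L x = \sum_h l_ h x * f h) ->
  (forall x, G x = l_ i x ^+ 2 * l_ j x * L x) -> C1 G g1 g2 ->
  I (along (edge (T k) i m) g1 g2) =
  - I (fun x => l_ i x ^+ 2 * l_ j x) * (3 * f i + 2 * f j).
Proof.
move=> LE GE GC.
have dE h := dlam_edge h i m (T_nondeg k).
pose e := edge (T k) i m.
have im : i != m by rewrite eq_sym.
have di : dot (dlam (T k) i) e = -1 by rewrite dE (negbTE im) eqxx sub0r.
have dj : dot (dlam (T k) j) e = 0.
  by rewrite dE !(eq_sym j) (negbTE mj) (negbTE ij) subrr.
have dm : dot (dlam (T k) m) e = 1 by rewrite dE (negbTE mi) eqxx subr0.
have lC := C1_lam (T k).
have GC' := C1M (C1M (C1M (lC i) (lC i)) (lC j))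
  (C1D (C1D (C1Z (f i) (lC i)) (C1Z (f j) (lC j))) (C1Z (f m) (lC m))).
have [|-> ->] := C1_unique _ GC GC'.
  by move=> x; rewrite GE LE (sum_third _ ij mi mj); ring.
have BC := C1M (C1M (lC i) (lC m)) (C1M (lC i) (lC j)).
have cll : continuous (fun x => l_ i x * l_ j x) by exact: continuousM_fun.
have := edge_bubble_integral0 (T_nondeg k) im cll BC (fun=> erefl).
rewrite -/e; set b := (fun x => _) => zb.
have cb : continuous b by have [_ c1 c2 _] := BC; exact: continuous_along.
have bE x : b x = l_ i x ^+ 2 * l_ j x - 2 * (l_ i x * l_ j x * l_ m x).
  transitivity ((dot (dlam (T k) i) e * l_ m x + dot (dlam (T k) m) e * l_ i x) *
    (l_ i x * l_ j x) + l_ i x * l_ m x * (dot (dlam (T k) i) e * l_ j x +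
    dot (dlam (T k) j) e * l_ i x)); first by rewrite /b /dot; ring.
  by rewrite di dj dm; ring.
have c1 : continuous (fun x => l_ i x ^+ 2 * l_ j x).
  by apply: continuousM_fun => //; apply: continuousM_fun.
have c2 : continuous (fun x => l_ i x * l_ j x ^+ 2).
  by apply: continuousM_fun => //; apply: continuousM_fun.
(* Along i m the coordinates i, j, m have slopes -1, 0, 1: lam_i^3 lam_j yields the 3, lam_i^2
   lam_j^2 the 2, and the part with [f m] is the derivative [b] of a bubble of the edge i m. *)
rewrite (@eq_Rintegral_triangle _ _ T k _ (fun x => (- 3 * f i) * (l_ i x ^+ 2 * l_ j x)
  + ((- 2 * f j) * (l_ i x * l_ j x ^+ 2) + f m * b x))); last first.
  move=> x _; rewrite bE.
  transitivity ((2 * dot (dlam (T k) i) e * l_ i x * l_ j x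
      + l_ i x ^+ 2 * dot (dlam (T k) j) e) *
      (f i * l_ i x + f j * l_ j x + f m * l_ m x) + l_ i x ^+ 2 * l_ j x *
      (f i * dot (dlam (T k) i) e + f j * dot (dlam (T k) j) e
       + f m * dot (dlam (T k) m) e)).
    by rewrite /along /dot; ring.
  by rewrite di dj dm; ring.
rewrite (RintegralD_triangle T_conforming); last 2 first.
- exact: continuousZ_fun.
- by apply: continuousD_fun; exact: continuousZ_fun.
rewrite (RintegralD_triangle T_conforming); last 2 first.
- exact: continuousZ_fun.
- exact: continuousZ_fun.
rewrite !(RintegralZ_triangle T_conforming)// zb mulr0 addr0 integral_lam2_lam.
ring.
Qed.

End Flux.

(** * Fields orthogonal to all discrete divergences *)

Section Kernels.
Context {R : realType}.
Notation mu := (leb2 R).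
Variables (A : set (R * R)) (n : nat) (T : 'I_n -> 'I_3 -> R * R) (p : nat).
Hypothesis A_bounded : bounded_set A.
Hypothesis A_polygonal : polygonal_domain A.
Hypothesis T_conforming : conforming_triangulation A T.
Hypothesis p_ge3 : (3 <= p)%N.

Let T_nondeg k : nondeg (T k).
Proof. exact: (mesh_nondeg T_conforming). Qed.
Let A_open : open A.
Proof. exact: (mesh_open A_polygonal). Qed.

Lemma row_vec (S : 'M[R]_2) r : row r S = vec (S r 0, S r 1).
Proof.
by apply/rowP; apply: ord2P; rewrite !mxE.
Qed.

Lemma L2mx_pw (a b : nat) H (S : 'M[R]_(a, b)) : (forall k, continuous (H k)) ->
  L2mx A (fun x => pw T H x *: S).
Proof.
move=> cH i j; rewrite (_ : (fun x => _) = fun x => S i j * pw T H x).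
  by apply: L2Z => //; exact: L2_pw.
by apply/funext => x; rewrite mxE mulrC.
Qed.

Lemma HZh_pw H S : S^T = S -> (forall k, poly2 p (H k)) ->
  (forall k l a b, T k a = T l b -> H k (T k a) = H l (T l b)) ->
  (forall r, exists d, is_weak_div A (fun x => pw T H x *: row r S) d) ->
  HZh A T p (fun x => pw T H x *: S).
Proof.
move=> sS pH vH dH; have cH k : continuous (H k) by exact: poly2_continuous (pH k).
split; first split.
- exact: L2mx_pw.
- by apply: aeonW => x _; rewrite linearZ /= sS.
- move=> r; have [d Hd] := dH r; exists d.
  by rewrite (_ : (fun x => _) = fun x => pw T H x *: row r S)//; apply/funext => x; rewrite linearZ.
exists (fun k x => H k x *: S); split.
- move=> k i j; apply: (poly2_eq (poly2Z (S i j) (pH k))) => x.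
  by rewrite mxE mulrC.
- by move=> k x; rewrite linearZ /= sS.
- by move=> k; apply: (aeon_comp (op := fun a => a *: S) (pw_ae T_conforming H k)).
- by move=> k l a b ab; rewrite (vH _ _ _ _ ab).
Qed.

(** Edge bubbles vanish at all vertices, so they satisfy the vertex continuity of the Hu-Zhang
    space. *)
Lemma only_vertex k i j (q : R * R -> R) l h : i != j ->
  only k (fun x => lam (T k) i x * lam (T k) j x * q x) l (T l h) = 0.
Proof.
move=> ij; rewrite /only; case: (eqVneq l k) => [->|//]; rewrite !lam_vertex//.
by case: (eqVneq i h) => [<-|_]; rewrite ?(eq_sym j) ?(negbTE ij) ?mulr0 !mul0r.
Qed.

Lemma only_poly (k : 'I_n) d (f : R * R -> R) l : poly2 d f -> poly2 d (only k f l).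
Proof. by rewrite /only; case: ifP => // _ _; exact: poly2_0. Qed.

Lemma pw_onlyZ k c (f : R * R -> R) x :
  pw T (only k (fun y => c * f y)) x = c * pw T (only k f) x.
Proof.
rewrite mulrC (pwM T (only k f) (fun=> c)).
apply: eq_bigr => l _; rewrite !patchE; case: ifP => // _.
by rewrite /only; case: ifP => _; rewrite ?mul0r 1?mulrC.
Qed.

(** The product lam_i lam_j vanishes only on two lines, a null set, and [q] is continuous. *)
Lemma bubble_zero k i j (q : R * R -> R) : continuous q ->
  (forall x, triangle (T k) x -> lam (T k) i x * lam (T k) j x * q x = 0) ->
  forall x, triangle (T k) x -> q x = 0.
Proof.
move=> cq H x Tx; apply: (@continuous_ae0_triangle _ (T k) q) => //.
have ni := negligible_lam_zero i (T_nondeg k).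
have nj := negligible_lam_zero j (T_nondeg k).
move/negligibleP: (negligibleU ni nj) => N.
have : mu.-negligible ([set y | lam (T k) i y = 0] `|` [set y | lam (T k) j y = 0]).
  exact: negligibleU.
rewrite /ae_eq_on; apply: negligibleS => y /= /not_implyP[Ty qy].
have := H y Ty; move=> /eqP; rewrite !mulf_eq0 -orbA => /or3P[/eqP|/eqP|/eqP//].
- by left.
- by right.
Qed.

Lemma HZ_wDiv_L2 M r : HZh A T p M -> L2 A (fun x => wDiv A M x 0 r).
Proof.
move=> [[_ _ /(_ r)/wdivP[L _]] _].
by rewrite (_ : (fun x => _) = wdiv A (fun y => row r (M y)))//; apply/funext => x; rewrite mxE.
Qed.

Lemma HZ_wDiv_ae M r d : HZh A T p M -> is_weak_div A (fun x => row r (M x)) d ->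
  ae_eq_on A (fun x => wDiv A M x 0 r) d.
Proof.
move=> [[LM _ _] _] Hd.
rewrite (_ : (fun x => _) = wdiv A (fun y => row r (M y))); last by apply/funext => x; rewrite mxE.
apply: (wdiv_ae A_open A_bounded) Hd => i j.
by rewrite (_ : (fun x => _) = fun x => M x r j)//; apply/funext => x; rewrite mxE.
Qed.

Section Moments.
Variables (phi : R * R -> 'rV[R]_2) (P : 'I_n -> 'I_2 -> R * R -> R).
Hypothesis phi_L2 : L2mx A phi.
Hypothesis P_poly : forall k r, poly2 p.-1 (P k r).
Hypothesis phiP : forall k r, ae_eq_on (triangle (T k)) (fun x => phi x 0 r) (P k r).
Hypothesis phi_ker : forall M, HZh A T p M ->
  \sum_r dotL A (fun x => wDiv A M x 0 r) (fun x => phi x 0 r) = 0.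

Lemma HZ_test H S D : HZh A T p (fun x => pw T H x *: S) ->
  (forall k, continuous (H k)) -> (forall r k, continuous (D r k)) ->
  (forall r, is_weak_div A (fun x => pw T H x *: row r S) (pw T (D r))) ->
  \sum_k \int[mu]_(x in triangle (T k)) (\sum_r D r k x * P k r x) = 0.
Proof.
move=> HM cH cD dD; rewrite -[RHS](phi_ker HM).
have cP k r : continuous (P k r) by exact: poly2_continuous (P_poly k r).
have rowE r : (fun x => row r (pw T H x *: S)) = fun x => pw T H x *: row r S.
  by apply/funext => x; rewrite linearZ.
under eq_bigr => k _.
  rewrite (@eq_Rintegral_triangle _ _ T k _ (fun x => D 0 k x * P k 0 x + D 1 k x * P k 1 x)).
    rewrite (RintegralD_triangle T_conforming); last 2 first.
    - exact: continuousM_fun.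
    - exact: continuousM_fun.
    over.
  by move=> x _; rewrite sum2E.
rewrite big_split sum2E /=; congr (_ + _).
  rewrite -(dotL_pw A_bounded A_polygonal T_conforming (cD 0) (fun k => cP k 0)
    (phi_L2 0 0) (fun k => phiP k 0)).
  apply: (eq_dotL A_open); try exact: phi_L2; last exact: aeon_refl.
  - by apply: L2_pw.
  - exact: (HZ_wDiv_L2 _ HM).
  - by apply/aeon_sym/(HZ_wDiv_ae HM); rewrite rowE.
rewrite -(dotL_pw A_bounded A_polygonal T_conforming (cD 1) (fun k => cP k 1)
  (phi_L2 0 1) (fun k => phiP k 1)).
apply: (eq_dotL A_open); try exact: phi_L2; last exact: aeon_refl.
- by apply: L2_pw.
- exact: (HZ_wDiv_L2 _ HM).
- by apply/aeon_sym/(HZ_wDiv_ae HM); rewrite rowE.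
Qed.

Variable k : 'I_n.

Lemma phi_derivatives : exists a b : 'I_2 -> R * R -> R,
  [/\ forall r, poly2 p.-2 (a r), forall r, poly2 p.-2 (b r) &
      forall r, C1 (P k r) (a r) (b r)].
Proof.
have [|f Hf] := @choice _ _ (fun r (f : (R * R -> R) * (R * R -> R)) =>
  [/\ poly2 p.-2 f.1, poly2 p.-2 f.2 & C1 (P k r) f.1 f.2]).
  by move=> r; have [f1 [f2 H]] := poly2_C1 (P_poly k r); exists (f1, f2).
by exists (fun r => (f r).1), (fun r => (f r).2); split=> r; have [] := Hf r.
Qed.

(** Testing with lam_i lam_j q t t^T and integrating by parts leaves minus the integral of lam_i
    lam_j q times the strain along [t]; choosing that strain for [q] gives a square. *)
Lemma edge_strain0 a b i j x : (forall r, poly2 p.-2 (a r)) ->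
  (forall r, poly2 p.-2 (b r)) -> (forall r, C1 (P k r) (a r) (b r)) ->
  i != j -> triangle (T k) x ->
  strain (a 0 x, b 0 x) (a 1 x, b 1 x) (edge (T k) i j) = 0.
Proof.
move=> pa pb PC ij; set t := edge (T k) i j; move: x.
(* Pieces of degree p - 1 have strains of degree p - 2, so that the bubble has exactly the
   admissible degree p. *)
pose q x := t.1 * (t.1 * a 0 x + t.2 * b 0 x) + t.2 * (t.1 * a 1 x + t.2 * b 1 x).
have pq : poly2 p.-2 q.
  by apply: poly2D; apply: poly2Z; apply: poly2D; exact: poly2Z.
have cq := poly2_continuous pq.
pose H x := lam (T k) i x * lam (T k) j x * q x.
have pH : poly2 p H.
  apply: poly2_le (poly2M (poly2M (poly2_lam (T k) i) (poly2_lam (T k) j)) pq).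
  by case: p p_ge3 => [|[]].
have [h1 [h2 [p1 p2 HC]]] := poly2_C1 pH.
have [cH c1 c2 _] := HC.
pose c r := if r == 0 :> 'I_2 then t.1 else t.2.
pose S := \matrix_(r, s) (c r * c s).
have rowS r : row r S = c r *: vec t.
  by apply/rowP => s; rewrite !mxE.
pose D r := only k (along t (fun x => c r * h1 x) (fun x => c r * h2 x)).
have cal : continuous (along t h1 h2) by exact: continuous_along.
have dH r : is_weak_div A (fun x => pw T (only k H) x *: row r S) (pw T (D r)).
  rewrite (_ : (fun x => _) = fun x => pw T (only k (fun y => c r * H y)) x *: vec t); last first.
    by apply/funext => x; rewrite rowS scalerA pw_onlyZ mulrC.
  have cq' : continuous (fun x => c r * q x) by exact: continuousZ_fun.
  apply: (@weak_div_bubble _ A n T A_bounded A_polygonal T_conforming k i j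
    (fun x => c r * q x) (fun x => c r * H x) (fun x => c r * h1 x)
    (fun x => c r * h2 x) ij cq' (C1Z (c r) HC)).
  by move=> x; rewrite /H; ring.
have HM : HZh A T p (fun x => pw T (only k H) x *: S).
  apply: HZh_pw => [|l|l l' e f _|r].
  - by apply/matrixP => r s; rewrite !mxE mulrC.
  - exact: only_poly.
  - by rewrite !only_vertex.
  - by exists (pw T (D r)).
have cO l : continuous (only k H l) by rewrite /only; case: ifP => // _; exact: cst_continuous.
have cD r l : continuous (D r l).
  rewrite /D /only; case: ifP => // _; last exact: cst_continuous.
  by apply: continuous_along; exact: continuousZ_fun.
have := HZ_test HM cO cD dH.
rewrite (bigD1 k)//= big1 ?addr0; last first.
  move=> l lk; apply: (Rintegral_triangle0 T_conforming) => x _.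
  by rewrite big1// => r _; rewrite /D /only (negbTE lk) mul0r.
have uC := C1D (C1Z t.1 (PC 0)) (C1Z t.2 (PC 1)).
have cu : continuous (fun x => t.1 * P k 0 x + t.2 * P k 1 x) by have [] := uC.
rewrite (@eq_Rintegral_triangle _ _ T k _ (fun x => along t h1 h2 x *
    (t.1 * P k 0 x + t.2 * P k 1 x))); last first.
  by move=> x _; rewrite sum2E /D /only eqxx /along /c /=; ring.
rewrite (bubble_parts T_conforming ij cq HC (fun=> erefl) uC).
move/eqP; rewrite oppr_eq0 => /eqP Iq x Tx; rewrite -[LHS]/(t.1 * _ + t.2 * _).
have qE y : along (edge (T k) i j) (fun x => t.1 * a 0 x + t.2 * a 1 x)
    (fun x => t.1 * b 0 x + t.2 * b 1 x) y = q y.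
  by rewrite /along /q -/t; ring.
have cHq : continuous (fun x => H x * q x) by exact: continuousM_fun.
have Hq0 : forall y, triangle (T k) y -> H y * q y = 0.
  apply: (triangle_integral_eq0 T_conforming cHq).
    move=> y; rewrite triangleE// => y0; rewrite /H -mulrA.
    by apply: mulr_ge0; [exact: mulr_ge0|rewrite -expr2 sqr_ge0].
  by rewrite -[RHS]Iq; apply: eq_Rintegral => y _; rewrite qE.
have cqq : continuous (fun y => q y * q y) by exact: continuousM_fun.
have := @bubble_zero k i j (fun y => q y * q y) cqq.
move=> /(_ _ x Tx)/eqP; rewrite mulf_eq0 orbb => H0.
apply/eqP; rewrite -[X in X == _]/(q x); apply: H0 => y Ty.
by rewrite mulrA; exact: Hq0.
Qed.

(** Strains along three edges determine the symmetric part of the gradient, which is therefore 0;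
    the component of the field along y - x is then constant on the segment. *)
Lemma phi_rigid x y : triangle (T k) x -> triangle (T k) y ->
  dot (y.1 - x.1, y.2 - x.2) (P k 0 y - P k 0 x, P k 1 y - P k 1 x) = 0.
Proof.
move=> Tx Ty; have [a [b [pa pb PC]]] := phi_derivatives.
set t := (y.1 - x.1, y.2 - x.2).
have uC := C1D (C1Z t.1 (PC 0)) (C1Z t.2 (PC 1)).
suff E : t.1 * P k 0 x + t.2 * P k 1 x = t.1 * P k 0 y + t.2 * P k 1 y.
  by rewrite /dot /= !mulrBr addrACA -opprD E subrr.
apply: (segment_constant (T_nondeg k) uC Tx Ty) => z Tz; have s i j ij := @edge_strain0 a b i j z pa pb PC ij Tz.
have [||||/= e1 e2 e3] := @strain0 _ (a 0 z, b 0 z) (a 1 z, b 1 z) (edge (T k) 0 1) (edge (T k) 0 2%:R).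
- exact: wedge_edges.
- exact: s.
- exact: s.
- have <- : edge (T k) 1 2%:R = ((edge (T k) 0 2%:R).1 - (edge (T k) 0 1).1,
      (edge (T k) 0 2%:R).2 - (edge (T k) 0 1).2); last exact: s.
  by rewrite /edge /=; congr (_, _); ring.
rewrite /along e1 e2; transitivity (t.1 * t.2 * (b 0 z + a 1 z)); first by rewrite /t /=; ring.
by rewrite e3 mulr0.
Qed.

Lemma phi_affine x : triangle (T k) x ->
  forall r, P k r x = \sum_i lam (T k) i x * P k r (T k i).
Proof.
move=> Tx; have [||E0 E1] := @rigid_affine _ (T k) (fun x => (P k 0 x, P k 1 x)) _ _ x Tx => //.
  by move=> y z; exact: phi_rigid.
exact: ord2P.
Qed.

Lemma phi_edge_rigid i j :
  dot (edge (T k) i j) (P k 0 (T k j) - P k 0 (T k i), P k 1 (T k j) - P k 1 (T k i)) = 0.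
Proof. by apply: phi_rigid; exact: vertex_triangle. Qed.

Lemma affine_gradient (f : 'I_3 -> R) i j :
  dot (edge (T k) i j) (\sum_h f h * (dlam (T k) h).1, \sum_h f h * (dlam (T k) h).2)
  = f j - f i.
Proof.
rewrite /dot /= !mulr_sumr -big_split /=.
transitivity (\sum_h (f h * (h == j)%:R - f h * (h == i)%:R)).
  apply: eq_bigr => h _; rewrite -mulrBr -(dlam_edge h i j (T_nondeg k)) /dot /edge /=; ring.
rewrite sumrB; congr (_ - _).
  by rewrite (bigD1 j)//= eqxx mulr1 big1 ?addr0// => h /negbTE ->; rewrite mulr0.
by rewrite (bigD1 i)//= eqxx mulr1 big1 ?addr0// => h /negbTE ->; rewrite mulr0.
Qed.

(** With neighbours across the edge known to vanish, testing with lam_i^2 lam_j S isolates the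
    weighted edge moment [v] of this triangle, paired with the normal through [S]. *)
Lemma phi_edge_moment i j m : i != j -> m != i -> m != j ->
  (forall l, l != k -> (forall h, h != m -> exists h', T l h' = T k h) ->
     forall x r, triangle (T l) x -> P l r x = 0) ->
  forall r, 3 * P k r (T k i) + 2 * P k r (T k j) = 0.
Proof.
move=> ij mi mj good; pose a := T k i; pose b := T k j; pose f r h := P k r (T k h).
pose v : R * R := (3 * f 0 i + 2 * f 0 j, 3 * f 1 i + 2 * f 1 j).
pose nn := dlam (T k) m.
pose c (w : R * R) r := if r == 0 :> 'I_2 then w.1 else w.2.
(* A symmetrised product of the normal with the moment itself, because test tensors have to be
   symmetric. *)
pose S : 'M[R]_2 := \matrix_(r, s) (c nn r * c v s + c v r * c nn s).
pose H l x := hat T l a x * hat T l a x * hat T l b x.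
have HC l := C1M (C1M (hat_C1 T l a) (hat_C1 T l a)) (hat_C1 T l b).
pose h1 l x := ((dhat T l a).1 * hat T l a x + hat T l a x * (dhat T l a).1) * hat T l b x
  + hat T l a x * hat T l a x * (dhat T l b).1.
pose h2 l x := ((dhat T l a).2 * hat T l a x + hat T l a x * (dhat T l a).2) * hat T l b x
  + hat T l a x * hat T l a x * (dhat T l b).2.
have {}HC l : C1 (H l) (h1 l) (h2 l) by exact: HC.
have agree l l' x : triangle (T l) x -> triangle (T l') x -> H l x = H l' x.
  by move=> Tx Tx'; rewrite /H !(hat_agree T_conforming _ Tx Tx').
have cH l : continuous (H l) by have [] := HC l.
pose D r l := along (S r 0, S r 1) (h1 l) (h2 l).
have cD r l : continuous (D r l) by have [_ ? ? _] := HC l; exact: continuous_along.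
have dH r : is_weak_div A (fun x => pw T H x *: row r S) (pw T (D r)).
  by rewrite row_vec; exact: (weak_div_continuous A_bounded A_polygonal T_conforming _ HC agree).
have HM : HZh A T p (fun x => pw T H x *: S).
  apply: HZh_pw => [|l|l l' e e' E|r]; last by exists (pw T (D r)).
  - by apply/matrixP => r s; rewrite !mxE addrC !(mulrC (c v _)) !(mulrC (c nn _)).
  - apply: (@poly2_le _ (1 + 1 + 1)); first exact: p_ge3.
    by apply: poly2M; [apply: poly2M|]; exact: hat_poly.
  - rewrite -E; apply: agree; first exact: vertex_triangle.
    by rewrite E; exact: vertex_triangle.
have := HZ_test HM cH cD dH.
rewrite (bigD1 k)//= big1 ?addr0; last first.
  move=> l lk; apply: (Rintegral_triangle0 T_conforming) => x Tx.
  rewrite big1// => r _.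
  have D0 : (forall h, T l h <> a) \/ (forall h, T l h <> b) -> D r l x = 0.
    rewrite /D /along /h1 /h2 => -[] /hat_eq0 [-> ->] /=; ring.
  have [na|nb|sh] := edge_neighbour T k l ij mi mj.
  - by rewrite D0 ?mul0r//; left.
  - by rewrite D0 ?mul0r//; right.
  - by rewrite (good l lk) ?mulr0.
have [haE dhaE] := hat_vertex T_conforming k i.
have [hbE dhbE] := hat_vertex T_conforming k j.
pose L r x := \sum_h f r h * lam (T k) h x.
pose L1 r := \sum_h f r h * (dlam (T k) h).1.
pose L2 r := \sum_h f r h * (dlam (T k) h).2.
have LC r : C1 (L r) (fun=> L1 r) (fun=> L2 r).
  by apply: C1_sum => h; apply: C1Z; exact: C1_lam.
have GC r := C1M (HC k) (LC r).
have GE r x : H k x * L r x = lam (T k) i x ^+ 2 * lam (T k) j x * L r x.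
  by rewrite /H haE hbE expr2.
pose G1 r x := h1 k x * L r x + H k x * L1 r.
pose G2 r x := h2 k x * L r x + H k x * L2 r.
have {}GC r : C1 (fun x => H k x * L r x) (G1 r) (G2 r) by exact: GC.
(* The affine rotation has no strain, so its gradient is orthogonal to [S], and the integrand below
   is the full divergence of H S L. *)
have strainL : [/\ L1 0 = 0, L2 1 = 0 & L2 0 + L1 1 = 0].
  have s i' j' : strain (L1 0, L2 0) (L1 1, L2 1) (edge (T k) i' j') = 0.
    by rewrite /strain !affine_gradient; have := phi_edge_rigid i' j'; rewrite /dot.
  apply: (@strain0 _ (L1 0, L2 0) (L1 1, L2 1) (edge (T k) 0 1) (edge (T k) 0 2%:R)) => //.
    exact: wedge_edges.
  have <- : edge (T k) 1 2%:R = ((edge (T k) 0 2%:R).1 - (edge (T k) 0 1).1,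
    (edge (T k) 0 2%:R).2 - (edge (T k) 0 1).2); last exact: s.
  by rewrite /edge /=; congr (_, _); ring.
have S01 : S 0 1 = S 1 0 by rewrite !mxE /c /=; ring.
rewrite (@eq_Rintegral_triangle _ _ T k _ (fun x =>
   along (S 0 0, S 0 1) (G1 0) (G2 0) x + along (S 1 0, S 1 1) (G1 1) (G2 1) x)); last first.
  move=> x Tx; have [e1 e2 e3] := strainL.
  have PL r : P k r x = L r x.
    by rewrite phi_affine//; apply: eq_bigr => h _; rewrite mulrC.
  rewrite sum2E /D !PL /along /G1 /G2 /= e1 e2 S01.
  transitivity ((S 0 0 * h1 k x + S 1 0 * h2 k x) * L 0 x +
    (S 1 0 * h1 k x + S 1 1 * h2 k x) * L 1 x + H k x * S 1 0 * (L2 0 + L1 1)).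
    by rewrite e3 mulr0 addr0.
  by ring.
have cG1 r : continuous (G1 r) by have [] := GC r.
have cG2 r : continuous (G2 r) by have [] := GC r.
rewrite (RintegralD_triangle T_conforming); last 2 first.
- exact: continuous_along.
- exact: continuous_along.
have cg r : continuous (fun x => lam (T k) i x * L r x).
  by apply: continuousM_fun; [exact: continuous_lam|have [] := LC r].
have GE' r x : H k x * L r x = lam (T k) i x * lam (T k) j x * (lam (T k) i x * L r x).
  by rewrite GE; ring.
have LE r x : L r x = \sum_h lam (T k) h x * f r h by apply: eq_bigr => h _; rewrite mulrC.
pose M := \int[mu]_(x in triangle (T k)) (lam (T k) i x ^+ 2 * lam (T k) j x).
have FE r e : \int[mu]_(x in triangle (T k)) along e (G1 r) (G2 r) x =
    dot nn e * (- M * (3 * f r i + 2 * f r j)).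
  rewrite (flux_edge T_conforming ij mi mj e (cg r) (GC r) (GE' r)).
  by congr (_ * _); exact: (flux_moment T_conforming ij mi mj (LE r) (GE r) (GC r)).
rewrite !FE => E.
have M0 : 0 < M.
  apply: (integral_lam_gt0 T_conforming).
  - apply: continuousM_fun; last exact: continuous_lam.
    by apply: continuousM_fun; exact: continuous_lam.
  - by move=> x x0; rewrite mulr_ge0 ?sqr_ge0.
  - by rewrite !lam_center// mulr_gt0 ?exprn_gt0 ?invr_gt0.
(* Both terms are nonnegative and the normal is nonzero, so [v] vanishes. *)
have {E} : - M * ((dot nn v) ^+ 2 + dot nn nn * dot v v) = 0.
  by rewrite -[RHS]E /S !mxE /c /dot /v /=; ring.
move/eqP; rewrite mulf_eq0 oppr_eq0 gt_eqF//= => /eqP E.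
have n0 : 0 < dot nn nn.
  rewrite lt_neqAle dot_self_ge0 andbT eq_sym.
  by apply: contra_neq (dlam_neq0 m (T_nondeg k)) => /dot_self0.
have /eqP : dot nn nn * dot v v = 0.
  have := mulr_ge0 (ltW n0) (dot_self_ge0 v); have := sqr_ge0 (dot nn v); lra.
rewrite mulf_eq0 gt_eqF//= => /eqP/dot_self0[v1 v2].
exact: ord2P.
Qed.

(** The moments for both orders of the ends make the field vanish at these; rigidity then makes its
    value at the third vertex orthogonal to the two remaining edges. *)
Lemma phi_exposed m :
  (forall l, l != k -> (forall h, h != m -> exists h', T l h' = T k h) ->
     forall x r, triangle (T l) x -> P l r x = 0) ->
  forall x r, triangle (T k) x -> P k r x = 0.
Proof.
move=> good; have [i [j [ij mi mj]]] := ord3_other m.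
have ji : j != i by rewrite eq_sym.
have Eij := phi_edge_moment ij mi mj good.
have Eji := phi_edge_moment ji mj mi good.
have fi r : P k r (T k i) = 0 by have := Eij r; have := Eji r; lra.
have fj r : P k r (T k j) = 0 by have := Eij r; have := Eji r; lra.
have fm : (P k 0 (T k m), P k 1 (T k m)) = (0, 0).
  have im : i != m by rewrite eq_sym.
  have jm : j != m by rewrite eq_sym.
  apply: (dot_basis0 (wedge_edges (T_nondeg k) mi jm ji)).
    have := phi_edge_rigid m i; rewrite !fi /dot /= => E; lra.
  have := phi_edge_rigid m j; rewrite !fj /dot /= => E; lra.
move=> x r Tx; rewrite phi_affine// (sum_third _ ij mi mj) fi fj !mulr0 !add0r.
by case: fm => E0 E1; move: r; apply: ord2P; rewrite ?E0 ?E1 mulr0.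
Qed.

End Moments.

Lemma HZ_kernel phi : Dh2 A T p.-1 phi ->
  (forall M, HZh A T p M ->
     \sum_r dotL A (fun x => wDiv A M x 0 r) (fun x => phi x 0 r) = 0) ->
  forall r, ae_eq_on A (fun x => phi x 0 r) (fun=> 0).
Proof.
move=> Dphi ker.
have [|P HP] := @choice _ _ (fun (kr : 'I_n * 'I_2) Q => poly2 p.-1 Q /\
  ae_eq_on (triangle (T kr.1)) (fun x => phi x 0 kr.2) Q).
  by move=> [k r]; have [_ /(_ k)[Q pQ E]] := Dphi r; exists Q.
have Lphi : L2mx A phi.
  by move=> i r; rewrite ord1; have [] := Dphi r.
pose P' k r := P (k, r).
have pP k r : poly2 p.-1 (P' k r) by have [] := HP (k, r).
have phiP k r : ae_eq_on (triangle (T k)) (fun x => phi x 0 r) (P' k r) by have [] := HP (k, r).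
suff Z k x r : triangle (T k) x -> P' k r x = 0.
  move=> r; apply: (aeon_cover (mesh_subset T_conforming)) => k.
  by apply: aeon_trans (phiP k r) _; apply: aeonW => x; exact: Z.
pose bad k := exists x r, triangle (T k) x /\ P' k r x <> 0.
apply: contrapT => nz.
have [|k0 [m [badk share]]] := exposed_edge T_nondeg (mesh_disj T_conforming) (bad := bad) (k0 := k).
  by exists x, r; split; [apply: contrapT => nT; apply: nz|move=> z; apply: nz].
have [y [s [Ty]]] := badk; apply.
apply: (phi_exposed Lphi pP phiP ker (m := m)) Ty => l lk sh z s' Tz.
apply: contrapT => nz'; apply: (share l lk sh); by exists z, s'.
Qed.

End Kernels.

(** * Deflections orthogonal to all Raviart-Thomas divergences *)

Section RaviartThomasKernel.
Context {R : realType}.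
Notation mu := (leb2 R).
Variables (A : set (R * R)) (n : nat) (T : 'I_n -> 'I_3 -> R * R) (p : nat).
Hypothesis A_bounded : bounded_set A.
Hypothesis A_polygonal : polygonal_domain A.
Hypothesis T_conforming : conforming_triangulation A T.
Hypothesis p_ge3 : (3 <= p)%N.

Let T_nondeg k : nondeg (T k).
Proof. exact: (mesh_nondeg T_conforming). Qed.
Let A_open : open A.
Proof. exact: (mesh_open A_polygonal). Qed.

Variables (w : R * R -> R) (P : 'I_n -> R * R -> R).
Hypothesis w_L2 : L2 A w.
Hypothesis P_poly : forall k, poly2 p.-1 (P k).
Hypothesis wP : forall k, ae_eq_on (triangle (T k)) w (P k).
Hypothesis w_ker : forall q, RTh A T p.-1 q -> dotL A (wdiv A q) w = 0.

Lemma w_test q d : RTh A T p.-1 q -> is_weak_div A q d -> dotL A d w = 0.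
Proof.
move=> Rq dq; rewrite -(w_ker Rq); have [[Lq eq] _] := Rq.
apply: (eq_dotL A_open) => //.
- exact: dq.1.
- exact: (wdivP eq).1.
- exact/aeon_sym/(wdiv_ae A_open A_bounded Lq dq).
- exact: aeon_refl.
Qed.

Variable k : 'I_n.

Section Bubbles.
Variables (d1 d2 : R * R -> R).
Hypothesis pd1 : poly2 p.-2 d1.
Hypothesis pd2 : poly2 p.-2 d2.
Hypothesis PC : C1 (P k) d1 d2.

Let slope i j := along (edge (T k) i j) d1 d2.
(** The sign cancels the one of the integration by parts, so that testing yields integrals of
    squares. *)
Let bubble i j x := lam (T k) i x * lam (T k) j x * - slope i j x.
Let field i j x := pw T (only k (bubble i j)) x *: vec (edge (T k) i j).

Let slope_poly i j : poly2 p.-2 (slope i j).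
Proof. by apply: poly2D; exact: poly2Z. Qed.

Let nslope_poly i j : poly2 p.-2 (fun x => - slope i j x).
Proof. by apply: (poly2_eq (poly2Z (-1) (slope_poly i j))) => x; rewrite mulN1r. Qed.

Let bubble_continuous i j : continuous (bubble i j).
Proof.
apply: continuousM_fun; last exact: poly2_continuous (nslope_poly i j).
by apply: continuousM_fun; exact: continuous_lam.
Qed.

Let field_L2 i j : L2mx A (field i j).
Proof.
apply: L2mx_pw => // l; rewrite /only; case: ifP => // _; exact: cst_continuous.
Qed.

Let field_div i j : i != j -> exists2 d, is_weak_div A (field i j) d &
  dotL A d w = \int[mu]_(x in triangle (T k))
    (lam (T k) i x * lam (T k) j x * slope i j x ^+ 2).
Proof.
move=> ij.
have pb : poly2 (1 + 1 + p.-2) (bubble i j).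
  by apply: poly2M => //; apply: poly2M; exact: poly2_lam.
have [h1 [h2 [p1 p2 HC]]] := poly2_C1 pb.
have cs := poly2_continuous (nslope_poly i j).
have [_ c1 c2 _] := HC.
exists (pw T (only k (along (edge (T k) i j) h1 h2))).
  exact: (weak_div_bubble A_bounded A_polygonal T_conforming ij cs HC (fun=> erefl)).
rewrite (dotL_pw A_bounded A_polygonal T_conforming _ _ w_L2 wP); last 2 first.
- move=> l; rewrite /only; case: ifP => // _; first exact: continuous_along.
  exact: cst_continuous.
- by move=> l; exact: poly2_continuous (P_poly l).
rewrite (bigD1 k)//= big1 ?addr0; last first.
  move=> l lk; apply: (Rintegral_triangle0 T_conforming) => x _.
  by rewrite /only (negbTE lk) mul0r.
rewrite /only eqxx (bubble_parts T_conforming ij cs HC (fun=> erefl) PC).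
rewrite -mulN1r -(RintegralZ_triangle T_conforming); last first.
  by apply: continuousM_fun => //; exact: poly2_continuous (slope_poly i j).
by apply: eq_Rintegral => x _; rewrite /bubble -/(slope i j x); ring.
Qed.

Let test_field x := 1 *: field 0 1 x + (1 *: field 0 2%:R x + field 1 2%:R x).

(** A single edge field has degree p without the required shape. In the sum of the three the excess
    is [x] times a polynomial: with s_i = lam_i times the slope along 0 i, the sum is s_1 (x - v_1)
    + s_2 (x - v_2). *)
Let test_field_RT : RTh A T p.-1 test_field.
Proof.
have [d01 w01 _] := @field_div 0 1 isT.
have [d02 w02 _] := @field_div 0 2%:R isT.
have [d12 w12 _] := @field_div 1 2%:R isT.
split.
  split; first by apply: (L2mx_lin A_open) => //; exact: (L2mx_lin A_open).
  exists (fun x => 1 * d01 x + (1 * d02 x + d12 x)).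
  apply: (weak_div_lin A_open A_bounded) => //.
    exact: (L2mx_lin A_open).
  exact: (weak_div_lin A_open A_bounded).
move=> l.
have H i j : ae_eq_on (triangle (T l)) (field i j)
    (fun x => only k (bubble i j) l x *: vec (edge (T k) i j)).
  exact: (aeon_comp (op := fun c => c *: vec (edge (T k) i j))
    (pw_ae T_conforming (only k (bubble i j)) l)).
have [lk|lk] := eqVneq l k; last first.
  exists (fun=> 0), (fun=> 0); split.
  - by move=> j; apply: (poly2_eq (poly2_0 _)) => x; rewrite mxE.
  - exact: poly2_0.
  - apply: filterS3 (H 0 1) (H 0 2%:R) (H 1 2%:R) => x H1 H2 H3 Tx.
    by rewrite /test_field H1// H2// H3// /only (negbTE lk) !scale0r !scaler0 !addr0.
pose s1 x := lam (T k) 1 x * slope 0 1 x.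
pose s2 x := lam (T k) 2%:R x * slope 0 2%:R x.
have ps i j : poly2 p.-1 (fun x => lam (T k) i x * slope 0 j x).
  by apply: poly2_le (poly2M (poly2_lam (T k) i) (slope_poly 0 j)); case: p p_ge3 => [|[]].
exists (fun x => \row_j - (s1 x * vec (T k 1) 0 j + s2 x * vec (T k 2%:R) 0 j)).
exists (fun x => s1 x + s2 x); split.
- move=> j; apply: (poly2_eq (poly2D (poly2Z (- vec (T k 1) 0 j) (ps 1 1))
    (poly2Z (- vec (T k 2%:R) 0 j) (ps 2%:R 2%:R)))) => x.
  by rewrite [RHS]mxE /s1 /s2; ring.
- by apply: poly2D; exact: ps.
apply: filterS3 (H 0 1) (H 0 2%:R) (H 1 2%:R) => x H1 H2 H3 Tx.
rewrite /test_field H1// H2// H3// /only lk eqxx !scale1r.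
have := lam_combination x (T_nondeg k); have := lam_sum x (T_nondeg k).
rewrite !sum3E => l1 xE.
have x1 : x.1 = lam (T k) 0 x * (T k 0).1 + lam (T k) 1 x * (T k 1).1 +
  lam (T k) 2%:R x * (T k 2%:R).1 by rewrite {1}xE.
have x2 : x.2 = lam (T k) 0 x * (T k 0).2 + lam (T k) 1 x * (T k 1).2 +
  lam (T k) 2%:R x * (T k 2%:R).2 by rewrite {1}xE.
have {l1}l0 : lam (T k) 0 x = 1 - lam (T k) 1 x - lam (T k) 2%:R x by lra.
have s12 : slope 1 2%:R x = slope 0 2%:R x - slope 0 1 x.
  by rewrite /slope /along /edge /=; ring.
apply/rowP => j; rewrite !mxE /bubble s12 /s1 /s2.
by case: ifP => _; rewrite ?x1 ?x2 l0 /edge /=; ring.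
Qed.

Let slope0 i j x : i != j -> triangle (T k) x ->
  \int[mu]_(x in triangle (T k)) (lam (T k) i x * lam (T k) j x * slope i j x ^+ 2) = 0 ->
  slope i j x = 0.
Proof.
move=> ij Tx I0.
have cs := poly2_continuous (slope_poly i j).
have cs2 : continuous (fun x => slope i j x ^+ 2) by exact: continuousM_fun.
have c : continuous (fun x => lam (T k) i x * lam (T k) j x * slope i j x ^+ 2).
  by apply: continuousM_fun => //; apply: continuousM_fun; exact: continuous_lam.
have /eqP : slope i j x ^+ 2 = 0; last by rewrite sqrf_eq0 => /eqP.
apply: (bubble_zero T_conforming cs2 (i := i) (j := j) _ Tx).
apply: (triangle_integral_eq0 T_conforming c) => // y.
by rewrite triangleE// => y0; rewrite mulr_ge0 ?sqr_ge0// mulr_ge0.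
Qed.

(** Testing gives a sum of three nonnegative integrals equal to 0; the slopes along two edges
    already determine the gradient. *)
Lemma w_gradient0 x : triangle (T k) x -> (d1 x, d2 x) = (0, 0).
Proof.
move=> Tx; have [d01 w01 I01] := @field_div 0 1 isT.
have [d02 w02 I02] := @field_div 0 2%:R isT.
have [d12 w12 I12] := @field_div 1 2%:R isT.
have wd : is_weak_div A test_field (fun x => 1 * d01 x + (1 * d02 x + d12 x)).
  apply: (weak_div_lin A_open A_bounded) => //.
    exact: (L2mx_lin A_open).
  exact: (weak_div_lin A_open A_bounded).
have := w_test test_field_RT wd.
have L01 := w01.1; have L02 := w02.1; have L12 := w12.1.
rewrite !(dotLl A_open)//; last exact: L2_lin.
rewrite I01 I02 I12.
have ge0 i j : 0 <= \int[mu]_(x in triangle (T k)) (lam (T k) i x * lam (T k) j x * slope i j x ^+ 2).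
  apply: Rintegral_ge0 => y; rewrite triangleE// => y0.
  by rewrite mulr_ge0 ?sqr_ge0// mulr_ge0.
have g01 := ge0 0 1; have g02 := ge0 0 2%:R; have g12 := ge0 1 2%:R.
rewrite !mul1r addrA => /eqP.
rewrite paddr_eq0 ?addr_ge0// paddr_eq0// => /andP[/andP[/eqP z01 /eqP z02] _].
apply: (dot_basis0 (a := edge (T k) 0 1) (b := edge (T k) 0 2%:R)).
- exact: wedge_edges.
- exact: (@slope0 0 1 x).
- exact: (@slope0 0 2%:R x).
Qed.

End Bubbles.

Lemma w_constant x y : triangle (T k) x -> triangle (T k) y -> P k x = P k y.
Proof.
move=> Tx Ty; have [d1 [d2 [pd1 pd2 PC]]] := poly2_C1 (P_poly k).
apply: (segment_constant (T_nondeg k) PC Tx Ty) => z Tz.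
by have [e1 e2] := w_gradient0 pd1 pd2 PC Tz; rewrite /along e1 e2 !mulr0 addr0.
Qed.

(** On this triangle the deflection is a constant, and the test field lam_i lam_j n, supported on
    the triangles of the edge, multiplies it by a nonzero flux. Its degree 2 is at most p - 1. *)
Lemma w_exposed m :
  (forall l, l != k -> (forall h, h != m -> exists h', T l h' = T k h) ->
     forall x, triangle (T l) x -> P l x = 0) ->
  forall x, triangle (T k) x -> P k x = 0.
Proof.
move=> good; have [i [j [ij mi mj]]] := ord3_other m.
pose a := T k i; pose b := T k j; pose nn := dlam (T k) m.
pose H l x := hat T l a x * hat T l b x.
pose h1 l x := (dhat T l a).1 * hat T l b x + hat T l a x * (dhat T l b).1.
pose h2 l x := (dhat T l a).2 * hat T l b x + hat T l a x * (dhat T l b).2.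
have HC l : C1 (H l) (h1 l) (h2 l) by exact: (C1M (hat_C1 T l a) (hat_C1 T l b)).
have agree l l' x : triangle (T l) x -> triangle (T l') x -> H l x = H l' x.
  by move=> Tx Tx'; rewrite /H !(hat_agree T_conforming _ Tx Tx').
have dH := weak_div_continuous A_bounded A_polygonal T_conforming nn HC agree.
have cH l : continuous (H l) by have [] := HC l.
have RTH : RTh A T p.-1 (fun x => pw T H x *: vec nn).
  split; first by split; [exact: L2mx_pw|eexists; exact: dH].
  move=> l; exists (fun x => H l x *: vec nn), (fun=> 0); split.
  - move=> r; apply: (@poly2_le _ (1 + 1)); first by case: p p_ge3 => [|[|[]]].
    apply: (poly2_eq (poly2Z (vec nn 0 r) (poly2M (hat_poly T l a) (hat_poly T l b)))) => x.
    by rewrite [RHS]mxE mulrC.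
  - exact: poly2_0.
  - apply: (aeon_comp (op := fun c => c *: vec nn) (pw_ae T_conforming H l)) => // x _.
    by rewrite scale0r addr0.
have cD l : continuous (along nn (h1 l) (h2 l)).
  by have [_ ? ? _] := HC l; exact: continuous_along.
have cP l : continuous (P l) by exact: poly2_continuous (P_poly l).
have := w_test RTH dH; rewrite (dotL_pw A_bounded A_polygonal T_conforming cD cP w_L2 wP).
rewrite (bigD1 k)//= big1 ?addr0; last first.
  move=> l lk; apply: (Rintegral_triangle0 T_conforming) => x Tx.
  have D0 : (forall h, T l h <> a) \/ (forall h, T l h <> b) -> along nn (h1 l) (h2 l) x = 0.
    rewrite /along /h1 /h2 => -[] /hat_eq0 [-> ->] /=; ring.
  have [na|nb|sh] := edge_neighbour T k l ij mi mj.
  - by rewrite D0 ?mul0r//; left.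
  - by rewrite D0 ?mul0r//; right.
  - by rewrite (good l lk) ?mulr0.
have [haE dhaE] := hat_vertex T_conforming k i.
have [hbE dhbE] := hat_vertex T_conforming k j.
move=> E x Tx; move: E.
rewrite (@eq_Rintegral_triangle _ _ T k _ (fun y => P k x * along nn (h1 k) (h2 k) y)); last first.
  by move=> y Ty; rewrite (w_constant Ty Tx) mulrC.
rewrite (RintegralZ_triangle T_conforming)//.
have HE y : H k y = lam (T k) i y * lam (T k) j y * (fun=> 1) y by rewrite /H haE hbE mulr1.
have c1 : continuous (fun _ : R * R => 1 : R) by exact: cst_continuous.
rewrite (flux_edge T_conforming ij mi mj nn c1 (HC k) HE).
rewrite (@eq_Rintegral_triangle _ _ T k _ (fun y => -1 * lam (T k) j y)); last first.
  move=> y _.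
  have im : i != m by rewrite eq_sym.
  have di : dot (dlam (T k) i) (edge (T k) i m) = -1.
    by rewrite dlam_edge// (negbTE im) eqxx sub0r.
  have dj : dot (dlam (T k) j) (edge (T k) i m) = 0.
    by rewrite dlam_edge// !(eq_sym j) (negbTE mj) (negbTE ij) subrr.
  transitivity (dot (dlam (T k) i) (edge (T k) i m) * lam (T k) j y
    + lam (T k) i y * dot (dlam (T k) j) (edge (T k) i m)).
    by rewrite /along /h1 /h2 dhaE dhbE haE hbE /dot; ring.
  by rewrite di dj mulr0 addr0.
rewrite (RintegralZ_triangle T_conforming); last exact: continuous_lam.
have M0 : 0 < \int[mu]_(y in triangle (T k)) lam (T k) j y.
  apply: (integral_lam_gt0 T_conforming); first exact: continuous_lam.
  - by move=> y y0.
  - by rewrite lam_center// invr_gt0.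
have n0 : dot nn nn != 0.
  by apply: contra_neq (dlam_neq0 m (T_nondeg k)) => /dot_self0.
by move/eqP; rewrite !mulf_eq0 oppr_eq0 oner_eq0 (negbTE n0) (gt_eqF M0) !orbF => /eqP.
Qed.

End RaviartThomasKernel.

Lemma RT_kernel {R : realType} (A : set (R * R)) (n : nat)
    (T : 'I_n -> 'I_3 -> R * R) (p : nat) w :
  bounded_set A -> polygonal_domain A -> conforming_triangulation A T ->
  (3 <= p)%N -> Dh A T p.-1 w ->
  (forall q, RTh A T p.-1 q -> dotL A (wdiv A q) w = 0) ->
  ae_eq_on A w (fun=> 0).
Proof.
move=> A_bounded A_polygonal T_conforming p_ge3 [Lw Dw] ker.
have [|P HP] := @choice _ _ (fun k Q => poly2 p.-1 Q /\ ae_eq_on (triangle (T k)) w Q).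
  by move=> k; have [Q pQ E] := Dw k; exists Q.
have pP k : poly2 p.-1 (P k) by have [] := HP k.
have wP k : ae_eq_on (triangle (T k)) w (P k) by have [] := HP k.
suff Z k x : triangle (T k) x -> P k x = 0.
  apply: (aeon_cover (mesh_subset T_conforming)) => k.
  by apply: aeon_trans (wP k) _; apply: aeonW => x; exact: Z.
pose bad k := exists x, triangle (T k) x /\ P k x <> 0.
apply: contrapT => nz.
have [|k0 [m [badk share]]] := exposed_edge (mesh_nondeg T_conforming)
    (mesh_disj T_conforming) (bad := bad) (k0 := k).
  by exists x; split; [apply: contrapT => nT; apply: nz|move=> z; apply: nz].
have [y [Ty]] := badk; apply.
apply: (w_exposed A_bounded A_polygonal T_conforming p_ge3 Lw pP wP ker (m := m)) Ty => l lk sh z Tz.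
apply: contrapT => nz'; apply: (share l lk sh); by exists z.
Qed.

(** * Finite element spaces *)

Section FiniteElementSpaces.
Context {R : realType}.
Notation mu := (leb2 R).
Variables (A : set (R * R)) (n : nat) (T : 'I_n -> 'I_3 -> R * R) (p : nat).
Hypothesis A_bounded : bounded_set A.
Hypothesis A_polygonal : polygonal_domain A.
Hypothesis T_conforming : conforming_triangulation A T.

Let A_open : open A.
Proof. exact: (mesh_open A_polygonal). Qed.

Lemma dotLZ (a : R) f g : L2 A f -> L2 A g ->
  dotL A (fun x => a * f x) g = a * dotL A f g.
Proof.
move=> Lf Lg; rewrite -[RHS]addr0 -(dotL0 A g) -(dotLl A_open)//; last exact: L2_cst.
by apply: eq_Rintegral => x _; rewrite addr0.
Qed.

Lemma ae_triangle f g k : ae_eq_on A f g -> ae_eq_on (triangle (T k)) f (g : R * R -> R).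
Proof.
move=> fg; have /negligibleP N := negligible_triangle_diff A_polygonal T_conforming k.
have := negligible_triangle_diff A_polygonal T_conforming k.
move=> /negligibleU /(_ fg); apply: negligibleS => x /= /not_implyP[Tx nfg].
have [Ax|nAx] := pselect (A x); last by left.
by right=> /(_ Ax).
Qed.

Section Displacement.
Variable u : R * R -> R.
Hypothesis Uu : Uh A T p u.

Lemma Uh_pieces : exists P D1 D2 : 'I_n -> R * R -> R,
  [/\ forall k, poly2 p (P k), forall k, C1 (P k) (D1 k) (D2 k) &
      forall k x, triangle (T k) x -> u x = P k x].
Proof.
have [_ Hu _] := Uu.
have [|P HP] := @choice _ _ (fun k (Q : (R * R -> R) * ((R * R -> R) * (R * R -> R))) =>
  [/\ poly2 p Q.1, C1 Q.1 Q.2.1 Q.2.2 & forall x, triangle (T k) x -> u x = Q.1 x]).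
  move=> k; have [Q pQ uQ] := Hu k; have [f1 [f2 [_ _ QC]]] := poly2_C1 pQ.
  by exists (Q, (f1, f2)).
exists (fun k => (P k).1), (fun k => (P k).2.1), (fun k => (P k).2.2).
by split=> k; have [] := HP k.
Qed.

(** Points of the closure outside [A] lie on the boundary, where [u] vanishes, so the extension by 0
    is continuous. *)
Lemma Uh_zero_extension : exists2 h : R * R -> R, continuous h &
  (forall x, closure A x -> h x = u x) /\ (forall x, ~ closure A x -> h x = 0).
Proof.
have [P [D1 [D2 [pP PC uP]]]] := Uh_pieces; have [_ _ u0] := Uu.
pose h x := if pselect (closure A x) is left _ then u x else 0.
have hc x : closure A x -> h x = u x by rewrite /h; case: pselect.
have hn x : ~ closure A x -> h x = 0 by rewrite /h; case: pselect.
exists h => //; apply: (pw_continuous A_polygonal T_conforming (F := P)).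
- by move=> k; have [] := PC k.
- move=> k x Tx; rewrite hc ?(uP k)//.
  by rewrite (mesh_cover T_conforming); exists k.
- move=> x nT; apply: hn; rewrite (mesh_cover T_conforming) => -[k _].
  exact: nT.
move=> x; have [Ax|nAx] := pselect (A x); first by left.
right; have [cx|/hn//] := pselect (closure A x).
rewrite hc//; apply: u0; split=> //.
by move=> /interior_subset.
Qed.

Lemma Uh_L2 : L2 A u.
Proof.
have [h ch [hu _]] := Uh_zero_extension.
apply: (L2_eq A_open _ (L2_continuous A_bounded A_polygonal ch)) => x Ax.
by apply: hu; exact: subset_closure.
Qed.

Lemma Uh_ae P : (forall k x, triangle (T k) x -> u x = P k x) ->
  ae_eq_on A u (pw T P).
Proof. by move=> uP; apply: (ae_pw T_conforming) => k; apply: aeonW => x; exact: uP. Qed.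

(** Component [i] is the weak divergence of [u] times a unit vector, whose pieces agree on
    intersections. *)
Lemma Uh_weak_grad P D1 D2 : (forall k, C1 (P k) (D1 k) (D2 k)) ->
  (forall k x, triangle (T k) x -> u x = P k x) ->
  is_weak_grad A u (pwrow T D1 D2).
Proof.
move=> PC uP; have c1 k : continuous (D1 k) by have [] := PC k.
have c2 k : continuous (D2 k) by have [] := PC k.
have cP k : continuous (P k) by have [] := PC k.
split.
  move=> i; apply: ord2P.
    by rewrite (_ : (fun x => _) = pw T D1); [exact: L2_pw|apply/funext => x; rewrite mxE].
  by rewrite (_ : (fun x => _) = pw T D2); [exact: L2_pw|apply/funext => x; rewrite mxE].
move=> f tf.
have agree k l x : triangle (T k) x -> triangle (T l) x -> P k x = P l x.
  by move=> Tk Tl; rewrite -(uP k)// -(uP l).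
have [Lf Lp] := test_function_L2 A_open A_bounded tf.
have W i : dotL A u (partial i f) = - dotL A
    (pw T (fun k => along (unitv R i) (D1 k) (D2 k))) f.
  have [_ /(_ f tf) <-] := weak_div_continuous A_bounded A_polygonal T_conforming
    (unitv R i) PC agree.
  rewrite (Rintegral_ip_grad A_open A_bounded) => //; last exact: L2mx_pw.
  have E j : dotL A (fun x => (pw T P x *: vec (unitv R i)) 0 j) (partial j f) =
      (i == j)%:R * dotL A (pw T P) (partial j f).
    rewrite -dotLZ//; last exact: L2_pw.
    apply: eq_Rintegral => x _; congr (_ * _); rewrite !mxE mulrC; congr (_ * _).
    by move: i j; apply: ord2P; apply: ord2P.
  rewrite !E.
  have -> : dotL A u (partial i f) = dotL A (pw T P) (partial i f).
    apply: (eq_dotL A_open) => //; [exact: Uh_L2|exact: L2_pw|exact: Uh_ae|exact: aeon_refl].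
  by move: (i); apply: ord2P; rewrite /= ?mul1r ?mul0r ?addr0 ?add0r.
move=> i; have := W i; rewrite /dotL => ->; congr (- _).
apply: eq_Rintegral => x _; congr (_ * _); rewrite mxE.
have E D : (forall k y, along (unitv R i) (D1 k) (D2 k) y = D k y) ->
    pw T (fun k => along (unitv R i) (D1 k) (D2 k)) x = pw T D x.
  by move=> H; apply: eq_bigr => k _; rewrite !patchE; case: ifP => // _; exact: H.
by move: (i) E; apply: ord2P => /= E; apply: E => k y; rewrite /along /= ?mul1r ?mul0r ?addr0 ?add0r.
Qed.

End Displacement.

Lemma Uh_lin a u v : Uh A T p u -> Uh A T p v -> Uh A T p (fun x => a * u x + v x).
Proof.
move=> [cu Pu u0] [cv Pv v0]; split.
- apply: continuousD_fun => //; exact: continuousZ_fun.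
- move=> k; have [P pP uP] := Pu k; have [Q pQ vQ] := Pv k.
  exists (fun x => a * P x + Q x); first by apply: poly2D => //; exact: poly2Z.
  by move=> x Tx; rewrite uP// vQ.
- by move=> x bx; rewrite u0// v0// mulr0 addr0.
Qed.

Lemma Uh0 : Uh A T p (fun=> 0).
Proof.
split=> //; first by move=> x; exact: cst_continuous.
by move=> k; exists (fun=> 0) => //; exact: poly2_0.
Qed.

Lemma Dh_lin d a u v : Dh A T d u -> Dh A T d v -> Dh A T d (fun x => a * u x + v x).
Proof.
move=> [Lu Pu] [Lv Pv]; split; first exact: L2_lin.
move=> k; have [P pP uP] := Pu k; have [Q pQ vQ] := Pv k.
exists (fun x => a * P x + Q x); first by apply: poly2D => //; exact: poly2Z.
by apply: filterS2 uP vQ => x H1 H2 Tx; rewrite H1// H2.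
Qed.

Lemma Dh0 d : Dh A T d (fun=> 0).
Proof.
split; first exact: L2_cst.
by move=> k; exists (fun=> 0); [exact: poly2_0|exact: aeon_refl].
Qed.

Lemma Dh2_lin d a (u v : R * R -> 'rV[R]_2) : Dh2 A T d u -> Dh2 A T d v ->
  Dh2 A T d (fun x => a *: u x + v x).
Proof.
move=> Du Dv j; rewrite (_ : (fun x => _) = fun x => a * u x 0 j + v x 0 j).
  exact: Dh_lin.
by apply/funext => x; rewrite !mxE.
Qed.

Lemma Dh2_0 d : Dh2 A T d (fun=> 0).
Proof.
move=> j; rewrite (_ : (fun x => _) = fun=> 0); first exact: Dh0.
by apply/funext => x; rewrite mxE.
Qed.

Lemma Dh2_L2 d (u : R * R -> 'rV[R]_2) : Dh2 A T d u -> L2mx A u.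
Proof. by move=> Du i j; rewrite ord1; have [] := Du j. Qed.

Lemma L2mx_row (M : R * R -> 'M[R]_2) i : L2mx A M -> L2mx A (fun x => row i (M x)).
Proof.
move=> LM k j; rewrite (_ : (fun x => _) = fun x => M x i j)//.
by apply/funext => x; rewrite mxE.
Qed.

Lemma HZh_lin a M N : HZh A T p M -> HZh A T p N -> HZh A T p (fun x => a *: M x + N x).
Proof.
move=> [[LM sM dM] [P [pP sP MP vP]]] [[LN sN dN] [Q [pQ sQ NQ vQ]]].
split.
  split; first exact: L2mx_lin.
    by apply: filterS2 sM sN => x H1 H2 Ax; rewrite linearP /= H1// H2.
  move=> i; have [d Hd] := dM i; have [e He] := dN i.
  exists (fun x => a * d x + e x).
  rewrite (_ : (fun x => _) = fun x => a *: row i (M x) + row i (N x)).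
    by apply: (weak_div_lin A_open A_bounded) => //; exact: L2mx_row.
  by apply/funext => x; rewrite linearP.
exists (fun k x => a *: P k x + Q k x); split.
- move=> k i j; apply: (poly2_eq (poly2D (poly2Z a (pP k i j)) (pQ k i j))) => x.
  by rewrite !mxE.
- by move=> k x; rewrite linearP /= sP sQ.
- by move=> k; apply: filterS2 (MP k) (NQ k) => x H1 H2 Tx; rewrite H1// H2.
- by move=> k l b c e; rewrite (vP _ _ _ _ e) (vQ _ _ _ _ e).
Qed.

Lemma weak_div0 : is_weak_div A (fun=> 0) (fun=> 0 : R).
Proof.
split=> [|f tf]; first exact: L2_cst.
rewrite -[in RHS]/(dotL A _ _) dotL0 oppr0 -(dotL0 A (fun=> 0)).
by apply: eq_Rintegral => x _; rewrite ip_row !mxE !mul0r addr0.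
Qed.

Lemma HZh0 : HZh A T p (fun=> 0).
Proof.
rewrite (_ : (fun=> 0) = fun x => pw T (fun=> fun=> 0) x *: (0 : 'M[R]_2)); last first.
  by apply/funext => x; rewrite scaler0.
apply: HZh_pw => //; first by rewrite linear0.
  by move=> k; exact: poly2_0.
move=> r; exists (fun=> 0); rewrite (_ : (fun x => _) = fun=> 0); first exact: weak_div0.
by apply/funext => x; rewrite linear0 scaler0.
Qed.

Lemma RTh_lin d a u v : RTh A T d u -> RTh A T d v ->
  RTh A T d (fun x => a *: u x + v x).
Proof.
move=> [[Lu [e He]] Pu] [[Lv [f Hf]] Pv]; split.
  split; first exact: L2mx_lin.
  exists (fun x => a * e x + f x); exact: (weak_div_lin A_open A_bounded).
move=> l; have [P [Q [pP pQ uPQ]]] := Pu l; have [P' [Q' [pP' pQ' vPQ]]] := Pv l.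
exists (fun x => a *: P x + P' x), (fun x => a * Q x + Q' x); split.
- move=> j; apply: (poly2_eq (poly2D (poly2Z a (pP j)) (pP' j))) => x.
  by rewrite !mxE.
- by apply: poly2D => //; exact: poly2Z.
- apply: filterS2 uPQ vPQ => x H1 H2 Tx; rewrite H1// H2//.
  by rewrite scalerDl -scalerA scalerDr addrACA.
Qed.

Lemma RTh0 d : RTh A T d (fun=> 0).
Proof.
split.
  split; last by exists (fun=> 0); exact: weak_div0.
  move=> i j; rewrite (_ : (fun x => _) = fun=> 0); first exact: L2_cst.
  by apply/funext => x; rewrite mxE.
move=> l; exists (fun=> 0), (fun=> 0); split.
- by move=> j; apply: (poly2_eq (poly2_0 _)) => x; rewrite mxE.
- exact: poly2_0.
- by apply: aeonW => x _; rewrite scale0r addr0.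
Qed.

(** The triangular range of exponents of [poly2] is padded to a square, so that coefficients are
    indexed by a finite type. *)
Definition monomials (c : 'I_p.+1 -> 'I_p.+1 -> R) (x : R * R) : R :=
  \sum_i \sum_j c i j * x.1 ^+ i * x.2 ^+ j.

Lemma poly2_monomials f : poly2 p f -> exists c, f =1 monomials c.
Proof.
move=> [c fE]; exists (fun i j => if (i + j <= p)%N then c i j else 0) => x.
rewrite fE; apply: eq_bigr => i _ /=.
have le : ((p - i).+1 <= p.+1)%N by rewrite ltnS leq_subr.
rewrite (big_ord_widen _ (fun j => c i j * x.1 ^+ i * x.2 ^+ j) le) big_mkcond /=.
apply: eq_bigr => j _; rewrite ltnS leq_subRL; last by rewrite -ltnS.
by case: ifP => // _; rewrite !mul0r.
Qed.

Section Coordinates.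
Variables (V : zmodType) (sc : R -> V -> V) (J : finType).
Variables (comp : V -> J -> R * R -> R) (S : V -> Prop).
Hypothesis comp0 : forall j x, comp 0 j x = 0.
Hypothesis comp_lin : forall a s s' j x,
  comp (sc a s + s') j x = a * comp s j x + comp s' j x.
Hypothesis comp_poly : forall s j l, S s ->
  exists2 Q, poly2 p Q & ae_eq_on (triangle (T l)) (comp s j) Q.

Definition coords (s : V) (c : J * 'I_n * 'I_p.+1 * 'I_p.+1 -> R) :=
  forall j l, ae_eq_on (triangle (T l)) (comp s j)
    (monomials (fun i i' => c (j, l, i, i'))).

Lemma coords0 : coords 0 (fun=> 0).
Proof.
move=> j l; apply: aeonW => x _; rewrite comp0 /monomials.
by rewrite big1// => i _; rewrite big1// => i' _; rewrite !mul0r.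
Qed.

Lemma coords_lin a s s' c c' : coords s c -> coords s' c' ->
  coords (sc a s + s') (fun i => a * c i + c' i).
Proof.
move=> H H' j l; apply: filterS2 (H j l) (H' j l) => x E E' Tx.
rewrite comp_lin E// E'// /monomials mulr_sumr -big_split; apply: eq_bigr => i _ /=.
by rewrite mulr_sumr -big_split; apply: eq_bigr => i' _ /=; ring.
Qed.

Lemma coords_ex s : S s -> exists c, coords s c.
Proof.
move=> Ss.
have [|c Hc] := @choice _ _ (fun (jl : J * 'I_n) c =>
   ae_eq_on (triangle (T jl.2)) (comp s jl.1) (monomials c)).
  move=> [j l]; have [Q /poly2_monomials[c QE] E] := comp_poly j l Ss.
  by exists c => /=; move: E; rewrite (funext QE).
exists (fun i => c i.1.1 i.1.2 i.2) => j l; exact: (Hc (j, l)).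
Qed.

Lemma coords_null s : coords s (fun=> 0) -> forall j, ae_eq_on A (comp s j) (fun=> 0).
Proof.
move=> H j; apply: (aeon_cover (mesh_subset T_conforming)) => l.
apply: aeon_trans (H j l) _; apply: aeonW => x _; rewrite /monomials.
by rewrite big1// => i _; rewrite big1// => i' _; rewrite !mul0r.
Qed.

End Coordinates.

Lemma Uh_comp_poly u l : Uh A T p u ->
  exists2 Q, poly2 p Q & ae_eq_on (triangle (T l)) u Q.
Proof. by move=> [_ /(_ l)[Q pQ uQ] _]; exists Q => //; apply: aeonW. Qed.

Lemma Dh_comp_poly u l : Dh A T p.-1 u ->
  exists2 Q, poly2 p Q & ae_eq_on (triangle (T l)) u Q.
Proof.
by move=> [_ /(_ l)[Q pQ uQ]]; exists Q => //; apply: poly2_le pQ; exact: leq_pred.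
Qed.

Lemma HZh_comp_poly M i j l : HZh A T p M ->
  exists2 Q, poly2 p Q & ae_eq_on (triangle (T l)) (fun x => M x i j) Q.
Proof.
move=> [_ [P [pP _ MP _]]]; exists (fun x => P l x i j) => //.
exact: (aeon_comp (op := fun N : 'M[R]_2 => N i j) (MP l)).
Qed.

Lemma RTh_comp_poly q i l : (0 < p)%N -> RTh A T p.-1 q ->
  exists2 Q, poly2 p Q & ae_eq_on (triangle (T l)) (fun x => q x 0 i) Q.
Proof.
move=> p0 [_ /(_ l)[P [Q [pP pQ qE]]]].
exists (fun x => P x 0 i + Q x * (if i == 0 then x.1 else x.2)).
  apply: poly2D; first by apply: poly2_le (pP i); exact: leq_pred.
  (* The factor [x] of the Raviart-Thomas shape functions raises the degree to p, the common bound
     for all the fields. *)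
  apply: (@poly2_le _ (p.-1 + 1)); first by rewrite addn1 prednK.
  have pc : poly2 1 (fun x : R * R => if i == 0 then x.1 else x.2).
    by case: (i == 0); [exact: poly2_fst|exact: poly2_snd].
  exact: poly2M pQ pc.
apply: (aeon_comp (op := fun N : 'rV[R]_2 => N 0 i) qE) => // x _.
by rewrite !mxE.
Qed.

End FiniteElementSpaces.

Section Forms.
Context {R : realType}.
Notation mu := (leb2 R).
Variables (A : set (R * R)) (n : nat) (T : 'I_n -> 'I_3 -> R * R) (p : nat).
Hypothesis A_bounded : bounded_set A.
Hypothesis A_polygonal : polygonal_domain A.
Hypothesis T_conforming : conforming_triangulation A T.

Let A_open : open A.
Proof. exact: (mesh_open A_polygonal). Qed.
Let mA : measurable (A : set (plane R)).
Proof. exact: (mesh_measurable A_polygonal). Qed.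

Definition integrable_on (f : R * R -> R) := mu.-integrable A (EFin \o f).

Lemma integrable_onD f g : integrable_on f -> integrable_on g ->
  integrable_on (fun x => f x + g x).
Proof. exact: integrableD. Qed.

Lemma integrable_onZ a f : integrable_on f -> integrable_on (fun x => a * f x).
Proof. exact: integrableZl. Qed.

Lemma integrable_onM f g : L2 A f -> L2 A g -> integrable_on (fun x => f x * g x).
Proof. exact: L2_integrableM. Qed.

Lemma integrable_on_ip a b (M N : R * R -> 'M[R]_(a, b)) : L2mx A M -> L2mx A N ->
  integrable_on (fun x => ip (M x) (N x)).
Proof. exact: integrable_ip. Qed.

Lemma RintegralD_on f g : integrable_on f -> integrable_on g ->
  \int[mu]_(x in A) (f x + g x) = \int[mu]_(x in A) f x + \int[mu]_(x in A) g x.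
Proof. exact: RintegralD. Qed.

Lemma RintegralZ_on a f : integrable_on f ->
  \int[mu]_(x in A) (a * f x) = a * \int[mu]_(x in A) f x.
Proof. by move=> If; rewrite RintegralZl. Qed.

Lemma wDiv_lin a M N r : HZh A T p M -> HZh A T p N ->
  ae_eq_on A (fun x => wDiv A (fun y => a *: M y + N y) x 0 r)
    (fun x => a * wDiv A M x 0 r + wDiv A N x 0 r).
Proof.
move=> HM HN; have [[LM _ /(_ r) dM] _] := HM; have [[LN _ /(_ r) dN] _] := HN.
have E (Q : R * R -> 'M[R]_2) : (fun x => wDiv A Q x 0 r) = wdiv A (fun y => row r (Q y)).
  by apply/funext => x; rewrite mxE.
rewrite E (_ : (fun y => _) = fun y => a *: row r (M y) + row r (N y)); last first.
  by apply/funext => y; rewrite linearP.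
have W := wdiv_lin_ae A_open A_bounded a (L2mx_row r LM) (L2mx_row r LN) dM dN.
apply: (aeon_trans W).
by apply: aeonW => x _; rewrite -!E.
Qed.

Lemma wdiv_null q : L2mx A q -> (exists d, is_weak_div A q d) ->
  (forall j, ae_eq_on A (fun x => q x 0 j) (fun=> 0)) -> ae_eq_on A (wdiv A q) (fun=> 0).
Proof.
move=> Lq /wdivP dq q0.
have L0 : L2mx A (fun=> 0 : 'rV[R]_2).
  move=> i j; rewrite (_ : (fun x => _) = fun=> 0); first exact: L2_cst.
  by apply/funext => x; rewrite mxE.
apply: (weak_div_unique_ae A_open A_bounded Lq L0 _ dq (weak_div0 A_bounded A_polygonal)).
apply: filterS2 (q0 0) (q0 1) => x H0 H1 Ax; apply/rowP; apply: ord2P.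
  by rewrite H0// mxE.
by rewrite H1// mxE.
Qed.

Lemma wDiv_null M r : HZh A T p M ->
  (forall i j, ae_eq_on A (fun x => M x i j) (fun=> 0)) ->
  ae_eq_on A (fun x => wDiv A M x 0 r) (fun=> 0).
Proof.
move=> [[LM _ /(_ r) dM] _] M0.
rewrite (_ : (fun x => _) = wdiv A (fun y => row r (M y))); last first.
  by apply/funext => x; rewrite mxE.
apply: wdiv_null dM _; first exact: L2mx_row.
move=> j; rewrite (_ : (fun x => _) = fun x => M x r j)//.
by apply/funext => x; rewrite mxE.
Qed.

Lemma wgrad_null u i : L2 A u -> (exists d : R * R -> 'rV[R]_2, is_weak_grad A u d) ->
  ae_eq_on A u (fun=> 0) -> ae_eq_on A (fun x => wgrad A u x 0 i) (fun=> 0).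
Proof.
move=> Lu /wgradP/(weak_grad_div Lu)/(_ i) du u0.
apply: (weak_div_unique_ae A_open A_bounded (L2mx_delta A_open i Lu) _ _ du
  (weak_div0 A_bounded A_polygonal)).
  move=> k j; rewrite (_ : (fun x => _) = fun=> 0); first exact: L2_cst.
  by apply/funext => x; rewrite mxE.
by apply: filterS u0 => x H Ax; rewrite H// scale0r.
Qed.

Lemma mxtrace2E (S : 'M[R]_2) : \tr S = S 0 0 + S 1 1.
Proof. exact: sum2E. Qed.

Lemma mxtrace_null (M : R * R -> 'M[R]_2) :
  (forall i j, ae_eq_on A (fun x => M x i j) (fun=> 0)) ->
  ae_eq_on A (fun x => \tr (M x)) (fun=> 0).
Proof.
move=> M0; apply: filterS2 (M0 0 0) (M0 1 1) => x H0 H1 Ax.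
by rewrite mxtrace2E [X in X + _](H0 Ax) [X in _ + X](H1 Ax) addr0.
Qed.

Lemma row_same (u v : R * R -> 'rV[R]_2) :
  (forall i, ae_eq_on A (fun x => (u - v) x 0 i) (fun=> 0)) -> ae_eq_on A u v.
Proof.
move=> u0; apply: filterS2 (u0 0) (u0 1) => x H0 H1 Ax.
apply/eqP; rewrite -subr_eq0; apply/eqP/rowP; apply: ord2P; rewrite [RHS]mxE.
  exact: H0.
exact: H1.
Qed.

Lemma matrix_same (M N : R * R -> 'M[R]_2) :
  (forall i j, ae_eq_on A (fun x => (M - N) x i j) (fun=> 0)) -> ae_eq_on A M N.
Proof.
move=> M0; have row0 i : ae_eq_on A (fun x => row i (M x)) (fun x => row i (N x)).
  apply: row_same => j; apply: filterS (M0 i j) => x H Ax.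
  by rewrite -[RHS](H Ax) /= !mxE.
by apply: filterS2 (row0 0) (row0 1) => x H0 H1 Ax; apply/row_matrixP; apply: ord2P;
  [exact: H0|exact: H1].
Qed.

Section Compliance.
Variables E nu : R.

Definition lame1 := 12%:R / E * (1 + nu).
Definition lame2 := 12%:R / E * nu.

Lemma complianceE (S : 'M[R]_2) i j :
  compliance E nu S i j = lame1 * S i j - lame2 * \tr S * (i == j)%:R.
Proof.
rewrite /compliance !mxE /lame1 /lame2.
by case: (i == j); rewrite ?mulr1n ?mulr0n /=; ring.
Qed.

Lemma L2_mxtrace M : L2mx A M -> L2 A (fun x => \tr (M x : 'M[R]_2)).
Proof.
by move=> LM; apply: L2_sum => // i; exact: LM.
Qed.

(** The compliance energy as a combination of scalar L^2 products, in which the trace is a function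
    of its own. *)
Definition moment_form (M N : R * R -> 'M[R]_2) : R :=
  \sum_i \sum_j lame1 * dotL A (fun x => M x i j) (fun x => N x i j)
  - lame2 * dotL A (fun x => \tr (M x)) (fun x => \tr (N x)).

Lemma L2mx_compliance M : L2mx A M -> L2mx A (fun x => compliance E nu (M x)).
Proof.
move=> LM i j; rewrite (_ : (fun x => _) = fun x =>
    (- lame2 * (i == j)%:R) * \tr (M x) + lame1 * M x i j).
  apply: L2_lin => //; first exact: L2_mxtrace.
  by apply: L2Z => //; exact: LM.
by apply/funext => x; rewrite complianceE; ring.
Qed.

Lemma Rintegral_compliance M N : L2mx A M -> L2mx A N ->
  \int[mu]_(x in A) ip (N x) (compliance E nu (M x)) = moment_form M N.
Proof.
move=> LM LN; rewrite (Rintegral_ip A_open LN (L2mx_compliance LM)).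
have H i j : dotL A (fun x => N x i j) (fun x => compliance E nu (M x) i j) =
    lame1 * dotL A (fun x => M x i j) (fun x => N x i j)
    - lame2 * ((i == j)%:R * dotL A (fun x => \tr (M x)) (fun x => N x i j)).
  rewrite (_ : (fun x => compliance _ _ _ _ _) = fun x =>
      (- lame2 * (i == j)%:R) * \tr (M x) + lame1 * M x i j); last first.
    by apply/funext => x; rewrite complianceE; ring.
  rewrite dotLC (dotLl A_open)//; [|exact: L2_mxtrace|exact: L2Z].
  by rewrite dotLZ//; ring.
rewrite /moment_form; under eq_bigr do under eq_bigr do rewrite H.
under eq_bigr do rewrite sumrB; rewrite sumrB; congr (_ - _).
rewrite (dotLC A (fun x => \tr (M x)) (fun x => \tr (N x))).
rewrite (_ : (fun x => \tr (N x)) = fun x => 1 * N x 0 0 + N x 1 1); last first.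
  by apply/funext => x; rewrite mul1r mxtrace2E.
rewrite (dotLl A_open)//; last exact: L2_mxtrace.
rewrite !sum2E !(dotLC A _ (fun x => \tr (M x))) /=; ring.
Qed.

Lemma moment_form_coercive kA M : 0 < kA ->
  (forall S : 'M[R]_2, S^T = S -> kA * ip S S <= ip S (compliance E nu S)) ->
  HZh A T p M ->
  kA * (\sum_i \sum_j dotL A (fun x => M x i j) (fun x => M x i j)) <= moment_form M M.
Proof.
move=> kA0 pos [[LM sM _] _].
rewrite -Rintegral_compliance// -(Rintegral_ip A_open LM LM) -RintegralZ_on; last first.
  exact: integrable_on_ip.
rewrite -subr_ge0 -mulN1r -RintegralZ_on; last first.
  by apply: integrable_onZ; exact: integrable_on_ip.
have i1 : integrable_on (fun x => ip (M x) (compliance E nu (M x))).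
  by apply: integrable_on_ip => //; exact: L2mx_compliance.
have i2 : integrable_on (fun x => -1 * (kA * ip (M x) (M x))).
  by apply: integrable_onZ; apply: integrable_onZ; exact: integrable_on_ip.
rewrite -RintegralD_on//; apply: Rintegral_ge0_ae => //.
  apply/measurable_EFinP; exact: (measurable_int mu (integrable_onD i1 i2)).
(* [M] is symmetric only almost everywhere, and the bound concerns symmetric matrices. *)
by apply: filterS sM => x H Ax; rewrite mulN1r subr_ge0; apply: pos; exact: H.
Qed.

Lemma moment_form_eq0 kA M : 0 < kA ->
  (forall S : 'M[R]_2, S^T = S -> kA * ip S S <= ip S (compliance E nu S)) ->
  HZh A T p M -> 0 <= moment_form M M /\
  (moment_form M M = 0 -> forall i j, ae_eq_on A (fun x => M x i j) (fun=> 0)).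
Proof.
move=> kA0 pos HM; have coer := moment_form_coercive kA0 pos HM.
have [[LM _ _] _] := HM; have ge0 f : 0 <= dotL A f f by exact: dotL_ge0.
have row_ge0 i : 0 <= \sum_j dotL A (fun x => M x i j) (fun x => M x i j).
  exact: sumr_ge0.
have sum_ge0 : 0 <= \sum_i \sum_j dotL A (fun x => M x i j) (fun x => M x i j).
  exact: sumr_ge0.
split=> [|m0 i j]; first by apply: le_trans coer; rewrite mulr_ge0// ltW.
apply: (dotL_eq0 A_open); first exact: LM.
move: coer; rewrite m0 pmulr_rle0// => sum_le0.
have s0 : \sum_i \sum_j dotL A (fun x => M x i j) (fun x => M x i j) = 0.
  by apply: le_anti; rewrite sum_le0 sum_ge0.
have row0 := psumr_eq0P (fun i _ => row_ge0 i) s0 (i := i) isT.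
exact: (psumr_eq0P _ row0).
Qed.

End Compliance.

Lemma sqrt_sum_sqr_le (a b : R) : 0 <= a -> 0 <= b -> Num.sqrt (a ^+ 2 + b ^+ 2) <= a + b.
Proof.
move=> a0 b0; rewrite -[leRHS]ger0_norm ?addr_ge0// -sqrtr_sqr ler_sqrt ?sqr_ge0//.
by rewrite sqrrD -addrA lerD2l lerDr mulrn_wge0// mulr_ge0.
Qed.

Lemma L2mxnorm_row_le (v : R * R -> 'rV[R]_2) : L2mx A v ->
  L2mxnorm A v <= L2norm A (fun x => v x 0 0) + L2norm A (fun x => v x 0 1).
Proof.
move=> Lv; apply: le_trans (sqrt_sum_sqr_le (L2norm_ge0 _ _) (L2norm_ge0 _ _)).
rewrite -[leLHS]ger0_norm ?sqrtr_ge0// -sqrtr_sqr.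
by rewrite (L2mxnorm_sqr A_open Lv) big_ord1 sum2E !L2norm_sqr.
Qed.

Lemma L2mxnorm_mx_le (M : R * R -> 'M[R]_2) : L2mx A M ->
  L2mxnorm A M <= L2norm A (fun x => M x 0 0) + L2norm A (fun x => M x 0 1) +
    (L2norm A (fun x => M x 1 0) + L2norm A (fun x => M x 1 1)).
Proof.
move=> LM; have Lr i : L2mx A (fun x => row i (M x)) by exact: L2mx_row.
have E i j : (fun x => row i (M x) 0 j) = fun x => M x i j.
  by apply/funext => x; rewrite mxE.
have := L2mxnorm_row_le (Lr 0); have := L2mxnorm_row_le (Lr 1); rewrite !E => r1 r0.
apply: le_trans (lerD r0 r1).
apply: le_trans (sqrt_sum_sqr_le (sqrtr_ge0 _) (sqrtr_ge0 _)).
rewrite -[leLHS]ger0_norm ?sqrtr_ge0// -sqrtr_sqr.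
rewrite (L2mxnorm_sqr A_open LM) -![Num.sqrt (Rintegral _ _ _)]/(L2mxnorm A _).
by rewrite !(L2mxnorm_sqr A_open (Lr _)) !big_ord1 !sum2E !E.
Qed.

Lemma HDivnorm_le M : HZh A T p M ->
  HDivnorm A M <= L2norm A (fun x => M x 0 0) + L2norm A (fun x => M x 0 1) +
    (L2norm A (fun x => M x 1 0) + L2norm A (fun x => M x 1 1)) +
    (L2norm A (fun x => wDiv A M x 0 0) + L2norm A (fun x => wDiv A M x 0 1)).
Proof.
move=> HM; apply: le_trans (sqrt_sum_sqr_le (sqrtr_ge0 _) (sqrtr_ge0 _)) _.
apply: lerD; first by apply: L2mxnorm_mx_le; have [[]] := HM.
apply: L2mxnorm_row_le => i j; rewrite ord1; exact: HZ_wDiv_L2 HM.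
Qed.

End Forms.

(** * The discrete problems *)

(** The trace and the shear are combinations of the others; as separate features they make the form
    a short sum of products. *)
Inductive three_feature : Type :=
| Deflection | Rotation of 'I_2 | Moment of 'I_2 & 'I_2 | MomentTrace
| MomentDiv of 'I_2 | Slope of 'I_2 | Shear of 'I_2.

Section ThreeField.
Context {R : realType}.
Notation mu := (leb2 R).
Variables (A : set (R * R)) (n : nat) (T : 'I_n -> 'I_3 -> R * R) (p : nat).
Variables (E nu ksmu t kA : R).
Hypothesis A_bounded : bounded_set A.
Hypothesis A_polygonal : polygonal_domain A.
Hypothesis T_conforming : conforming_triangulation A T.
Hypothesis t_gt0 : 0 < t.
Hypothesis ksmu_gt0 : 0 < ksmu.
Hypothesis kA_gt0 : 0 < kA.
Hypothesis compliance_ge : forall S : 'M[R]_2, S^T = S ->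
  kA * ip S S <= ip S (compliance E nu S).

Let A_open : open A.
Proof. exact: (mesh_open A_polygonal). Qed.
Let T_nondeg k : nondeg (T k).
Proof. exact: (mesh_nondeg T_conforming). Qed.

Definition three_space (s : three_type R) :=
  [/\ Uh A T p s.1.1, Dh2 A T p.-1 s.1.2 & HZh A T p s.2].

Definition three_scale (a : R) (s : three_type R) : three_type R :=
  (fun x => a * s.1.1 x, fun x => a *: s.1.2 x, fun x => a *: s.2 x).

Definition three_features (s : three_type R) (k : three_feature) : R * R -> R :=
  match k with
  | Deflection => s.1.1
  | Rotation i => fun x => s.1.2 x 0 i
  | Moment i j => fun x => s.2 x i j
  | MomentTrace => fun x => \tr (s.2 x)
  | MomentDiv i => fun x => wDiv A s.2 x 0 i
  | Slope i => fun x => wgrad A s.1.1 x 0 i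
  | Shear i => fun x => wgrad A s.1.1 x 0 i - s.1.2 x 0 i
  end.

Notation kappa := (ksmu / t ^+ 2).

(** The sum of both equations; the halves compensate for the symmetrisation in [form]. *)
Definition three_coefficients : seq (R * (three_feature * three_feature)) :=
  [:: (lame1 E nu / 2, (Moment 0 0, Moment 0 0));
      (lame1 E nu / 2, (Moment 0 1, Moment 0 1));
      (lame1 E nu / 2, (Moment 1 0, Moment 1 0));
      (lame1 E nu / 2, (Moment 1 1, Moment 1 1));
      (- lame2 E nu / 2, (MomentTrace, MomentTrace));
      (1, (MomentDiv 0, Rotation 0)); (1, (MomentDiv 1, Rotation 1));
      (- kappa / 2, (Shear 0, Shear 0)); (- kappa / 2, (Shear 1, Shear 1))].

Notation form := (form A three_features three_coefficients).

Lemma Uh_weak_grad_ex u : Uh A T p u -> exists d : R * R -> 'rV[R]_2, is_weak_grad A u d.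
Proof.
move=> Uu; have [P [D1 [D2 [_ PC uP]]]] := Uh_pieces Uu.
by exists (pwrow T D1 D2); exact: (Uh_weak_grad A_bounded A_polygonal T_conforming Uu PC uP).
Qed.

Lemma Uh_wgrad_L2 u : Uh A T p u -> L2mx A (wgrad A u).
Proof. by move=> /Uh_weak_grad_ex/wgradP[]. Qed.

Lemma three_L2 s k : three_space s -> L2 A (three_features s k).
Proof.
case: s => [[w phi] M] [/= Uw Dphi HM]; have LM : L2mx A M by have [[]] := HM.
have Lg := Uh_wgrad_L2 Uw; have Lphi := Dh2_L2 Dphi.
case: k => [|i|i j||i|i|i] /=.
- exact: (Uh_L2 A_bounded A_polygonal T_conforming Uw).
- exact: Lphi.
- exact: LM.
- exact: L2_mxtrace.
- exact: HZ_wDiv_L2 HM.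
- exact: Lg.
- rewrite (_ : (fun x => _) = fun x => -1 * phi x 0 i + wgrad A w x 0 i).
    by apply: (L2_lin A_open); [exact: Lphi|exact: Lg].
  by apply/funext => x; rewrite mulN1r addrC.
Qed.

Lemma three_lin a s s' : three_space s -> three_space s' ->
  three_space (three_scale a s + s').
Proof.
case: s => [[w phi] M] [/= Uw Dphi HM]; case: s' => [[w' phi'] M'] [/= Uw' Dphi' HM'].
split.
- exact: (Uh_lin a Uw Uw').
- exact: (Dh2_lin A_polygonal a Dphi Dphi').
- exact: (HZh_lin A_bounded A_polygonal a HM HM').
Qed.

Lemma three_space0 : three_space 0.
Proof.
split; [exact: Uh0|exact: Dh2_0|exact: HZh0].
Qed.

Lemma three_feature_lin a s s' k : three_space s -> three_space s' ->
  ae_eq_on A (three_features (three_scale a s + s') k)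
    (fun x => a * three_features s k x + three_features s' k x).
Proof.
case: s => [[w phi] M] [/= Uw Dphi HM]; case: s' => [[w' phi'] M'] [/= Uw' Dphi' HM'].
have grad i : ae_eq_on A (fun x => wgrad A (fun y => a * w y + w' y) x 0 i)
    (fun x => a * wgrad A w x 0 i + wgrad A w' x 0 i).
  apply: (wgrad_lin_ae A_open A_bounded); last 2 first.
  - exact: Uh_weak_grad_ex.
  - exact: Uh_weak_grad_ex.
  - exact: (Uh_L2 A_bounded A_polygonal T_conforming Uw).
  - exact: (Uh_L2 A_bounded A_polygonal T_conforming Uw').
case: k => [|i|i j||i|i|i] /=.
- exact: aeon_refl.
- by apply: aeonW => x _; rewrite !mxE.
- by apply: aeonW => x _; rewrite !mxE.
- by apply: aeonW => x _; rewrite linearP.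
- exact: (wDiv_lin A_bounded A_polygonal a i HM HM').
- exact: grad.
- by apply: filterS (grad i) => x H Ax; rewrite [X in X - _]H// !mxE; ring.
Qed.

(** The independent unknowns, which carry the polynomial coordinates; by [three_null] the other
    features vanish with them. *)
Definition three_component (s : three_type R) (j : unit + ('I_2 + 'I_2 * 'I_2)) :
    R * R -> R :=
  match j with
  | inl _ => s.1.1
  | inr (inl i) => fun x => s.1.2 x 0 i
  | inr (inr ij) => fun x => s.2 x ij.1 ij.2
  end.

Lemma three_component_poly s j l : three_space s ->
  exists2 Q, poly2 p Q & ae_eq_on (triangle (T l)) (three_component s j) Q.
Proof.
move=> [Uw Dphi HM]; case: j => [_|[i|[i j]]] /=.
- exact: Uh_comp_poly Uw.
- exact: Dh_comp_poly (Dphi i).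
- exact: HZh_comp_poly HM.
Qed.

Lemma three_null s : three_space s ->
  (forall j, ae_eq_on A (three_component s j) (fun=> 0)) ->
  null A three_features s.
Proof.
move=> Ss z; have [Uw Dphi HM] := Ss.
have w0 := z (inl tt); have phi0 i := z (inr (inl i)).
have M0 i j := z (inr (inr (i, j))).
have Lw := Uh_L2 A_bounded A_polygonal T_conforming Uw.
have g0 i := wgrad_null A_bounded A_polygonal i Lw (Uh_weak_grad_ex Uw) w0.
case=> [|i|i j||i|i|i] //=.
- exact: phi0.
- exact: M0.
- exact: mxtrace_null.
- exact: (wDiv_null A_bounded A_polygonal i HM).
- by apply: filterS2 (g0 i) (phi0 i) => x H0 H1 Ax; rewrite [X in X - _](H0 Ax)
    [X in _ - X](H1 Ax) subr0.
Qed.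

Section Solutions.
Variables s d : three_type R.
Hypothesis Ss : three_space s.
Hypothesis Sd : three_space d.

Definition three_eq1 (dM : R * R -> 'M[R]_2) : R :=
  \int[mu]_(x in A) (ip (dM x) (compliance E nu (s.2 x)) + ip (wDiv A dM x) (s.1.2 x)).

Definition three_eq2 (dw : R * R -> R) (dphi : R * R -> 'rV[R]_2) : R :=
  \int[mu]_(x in A) (ip (dphi x) (wDiv A s.2 x)
    - kappa * ip (wgrad A dw x - dphi x) (wgrad A s.1.1 x - s.1.2 x)).

Lemma wDiv_L2mx M : HZh A T p M -> L2mx A (wDiv A M).
Proof. by move=> HM i j; rewrite ord1; exact: HZ_wDiv_L2 HM. Qed.

Lemma three_eq1E : three_eq1 d.2 = moment_form A E nu s.2 d.2 +
  \sum_i dotL A (three_features s (Rotation i)) (three_features d (MomentDiv i)).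
Proof.
have [Uw Dphi HM] := Ss; have [Uw' Dphi' HM'] := Sd.
have LM : L2mx A s.2 by have [[]] := HM.
have LM' : L2mx A d.2 by have [[]] := HM'.
have Lphi := Dh2_L2 Dphi; have LD := wDiv_L2mx HM'.
rewrite /three_eq1 (RintegralD_on A_polygonal); last 2 first.
- by apply: (integrable_on_ip A_polygonal) => //; exact: L2mx_compliance.
- exact: (integrable_on_ip A_polygonal).
rewrite (Rintegral_compliance A_bounded A_polygonal)//; congr (_ + _).
rewrite (Rintegral_ip A_open LD Lphi) big_ord1; apply: eq_bigr => i _.
exact: dotLC.
Qed.

Lemma three_eq2E : three_eq2 d.1.1 d.1.2 =
  \sum_i dotL A (three_features s (MomentDiv i)) (three_features d (Rotation i)) -
  kappa * \sum_i dotL A (three_features s (Shear i)) (three_features d (Shear i)).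
Proof.
have [Uw Dphi HM] := Ss; have [Uw' Dphi' HM'] := Sd.
have LD := wDiv_L2mx HM; have Lphi' := Dh2_L2 Dphi'.
have Lsh s' : three_space s' -> L2mx A (fun x => wgrad A s'.1.1 x - s'.1.2 x).
  move=> Ss' i j; rewrite ord1 (_ : (fun x => _) = three_features s' (Shear j)).
    exact: three_L2.
  by apply/funext => x; rewrite !mxE.
rewrite /three_eq2.
under eq_Rintegral => x _ do rewrite -mulNr.
rewrite (RintegralD_on A_polygonal); last 2 first.
- exact: (integrable_on_ip A_polygonal).
- apply: (integrable_onZ A_polygonal).
  by apply: (integrable_on_ip A_polygonal); exact: Lsh.
rewrite (RintegralZ_on A_polygonal); last by apply: (integrable_on_ip A_polygonal); exact: Lsh.
rewrite (Rintegral_ip A_open Lphi' LD) (Rintegral_ip A_open (Lsh _ Sd) (Lsh _ Ss)).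
rewrite !big_ord1 mulNr; congr (_ - _ * _); apply: eq_bigr => i _; first exact: dotLC.
by rewrite dotLC; apply: eq_Rintegral => x _; rewrite !mxE.
Qed.

Lemma three_formE : form s d = three_eq1 d.2 + three_eq2 d.1.1 d.1.2.
Proof.
rewrite three_eq1E three_eq2E /form /moment_form.
rewrite !big_cons big_nil !sum2E /=.
by do ?[set z := dotL _ _ _; move: z => ?]; lra.
Qed.

End Solutions.

Lemma dotL_ae0 f g : L2 A f -> L2 A g -> ae_eq_on A g (fun=> 0) -> dotL A f g = 0.
Proof.
move=> Lf Lg g0; rewrite dotLC -(dotL0 A f).
by apply: (eq_dotL A_open) => //; [exact: L2_cst|exact: aeon_refl].
Qed.

Lemma moment_form_ae0 M N : L2mx A M -> L2mx A N ->
  (forall i j, ae_eq_on A (fun x => N x i j) (fun=> 0)) -> moment_form A E nu M N = 0.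
Proof.
move=> LM LN N0; rewrite /moment_form big1 => [|i _].
  rewrite dotL_ae0 ?mulr0 ?subr0//; try exact: L2_mxtrace.
  exact: mxtrace_null.
by rewrite big1// => j _; rewrite dotL_ae0 ?mulr0.
Qed.

Lemma moment_formC M N : moment_form A E nu M N = moment_form A E nu N M.
Proof.
rewrite /moment_form dotLC; congr (_ - _).
by apply: eq_bigr => i _; apply: eq_bigr => j _; rewrite dotLC.
Qed.

Lemma three_null0 : null A three_features 0.
Proof.
apply: three_null; first exact: three_space0.
by case=> [u|[i|ij]]; apply: aeonW => x _ /=; rewrite ?mxE.
Qed.

Lemma three_eq1_0 s : three_space s -> three_eq1 s (fun=> 0) = 0.
Proof.
move=> Ss; have S0 := three_space0; have z := three_null0.
have [_ _ [[LM _ _] _]] := Ss; have [_ _ [[LM0 _ _] _]] := S0.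
rewrite (three_eq1E Ss S0) moment_form_ae0//; last by move=> i j; exact: (z (Moment i j)).
by rewrite add0r big1// => i _; apply: dotL_ae0; [exact: three_L2|exact: three_L2|exact: z].
Qed.

Lemma three_eq2_0 s : three_space s -> three_eq2 s (fun=> 0) (fun=> 0) = 0.
Proof.
move=> Ss; have S0 := three_space0; have z := three_null0.
have D k k' : dotL A (three_features s k) (three_features 0 k') = 0.
  by apply: dotL_ae0; [exact: three_L2|exact: three_L2|exact: z].
by rewrite (three_eq2E Ss S0) !big1 ?mulr0 ?subr0// => i _.
Qed.

(** Adding the two equations gives the single one; conversely each is recovered by setting the test
    fields of the other to 0. *)
Lemma three_solutionE g s : L2 A g -> three_field_solution A T p E nu ksmu t g s <->
  three_space s /\
  forall d, three_space d -> form s d = - dotL A (three_features d Deflection) g.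
Proof.
move=> Lg; split.
  move: s => [[w phi] M] [[Uw Dphi HM] e1 e2]; split=> // d Sd.
  have [Uw' Dphi' HM'] := Sd.
  by rewrite three_formE// [X in X + _]e1// add0r; exact: e2.
move=> [Ss e]; have [Uw Dphi HM] := Ss; have [U0 D0 M0] := three_space0.
have e1 dM : HZh A T p dM -> three_eq1 s dM = 0.
  move=> HdM; have Sd : three_space (fun=> 0, fun=> 0, dM) by [].
  have := e _ Sd; rewrite three_formE//= three_eq2_0// addr0 => ->.
  by rewrite dotL0 oppr0.
have e2 dw dphi : Uh A T p dw -> Dh2 A T p.-1 dphi ->
    three_eq2 s dw dphi = - dotL A dw g.
  move=> Udw Ddphi; have Sd : three_space (dw, dphi, fun=> 0) by [].
  by have := e _ Sd; rewrite three_formE//= three_eq1_0// add0r.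
by move: s Ss Uw Dphi HM e1 e2 {e} => [[w phi] M].
Qed.

Lemma gradient_free u : Uh A T p u ->
  (forall i, ae_eq_on A (fun x => wgrad A u x 0 i) (fun=> 0)) -> ae_eq_on A u (fun=> 0).
Proof.
move=> Uu g0; have [P [D1 [D2 [pP PC uP]]]] := Uh_pieces Uu.
have Lu := Uh_L2 A_bounded A_polygonal T_conforming Uu.
have W := Uh_weak_grad A_bounded A_polygonal T_conforming Uu PC uP.
have c1 k : continuous (D1 k) by have [] := PC k.
have cP k : continuous (P k) by have [] := PC k.
have D10 k x : triangle (T k) x -> D1 k x = 0.
  apply: continuous_ae0_triangle => //.
  have := wgrad_ae A_open A_bounded Lu W 0.
  move=> /aeon_sym/aeon_trans/(_ (g0 0))/(ae_triangle A_polygonal T_conforming k) H.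
  apply: aeon_trans H; apply: aeon_sym.
  apply: aeon_trans _ (pw_ae T_conforming D1 k).
  by apply: aeonW => x' _; rewrite mxE.
have [h ch [hu hn]] := Uh_zero_extension A_polygonal T_conforming Uu.
have HC k := C1M (C1M (PC k) (PC k)) C1_fst.
have := sum_triangles_lines T_nondeg (mesh_disj T_conforming) HC
  (h := fun x => h x * h x * x.1) _ _ (t := (1, 0)) _ _.
move=> /(_ _ _ _ _)H.
apply: (dotL_eq0 A_open Lu).
have -> : dotL A u u = dotL A (pw T P) u.
  apply: (eq_dotL A_open) => //; [exact: L2_pw|exact: Uh_ae|exact: aeon_refl].
rewrite (dotL_pw A_bounded A_polygonal T_conforming cP cP Lu); last first.
  by move=> k; apply: aeonW => x; exact: uP.
rewrite -[RHS]H.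
- apply: eq_bigr => k _; apply: eq_Rintegral_triangle => x Tx /=.
  by rewrite D10//; ring.
- move=> k x Tx /=; rewrite hu ?(uP k)//.
  by rewrite (mesh_cover T_conforming); exists k.
- move=> x nT; rewrite hn ?mul0r// (mesh_cover T_conforming) => -[k _]; exact: nT.
- by apply/eqP => -[/eqP]; rewrite oner_eq0.
move=> z _ s; apply: continuous_comp; first exact: continuous_line2.
apply: (@continuousM_fun _ _ (fun x => h x * h x) fst); last by move=> x; exact: cvg_fst.
exact: continuousM_fun.
Qed.

Lemma three_nondeg s : three_space s ->
  (forall d, three_space d -> form s d = 0) -> null A three_features s.
Proof.
move=> Ss f0; have [Uw Dphi HM] := Ss.
have L0 : L2 A (fun=> 0) by exact: L2_cst.
have [_ e1 e2] : [/\ [/\ Uh A T p s.1.1, Dh2 A T p.-1 s.1.2 & HZh A T p s.2],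
    forall dM, HZh A T p dM -> three_eq1 s dM = 0 &
    forall dw dphi, Uh A T p dw -> Dh2 A T p.-1 dphi ->
      three_eq2 s dw dphi = - dotL A dw (fun=> 0)].
  have : three_field_solution A T p E nu ksmu t (fun=> 0) s.
    by apply/three_solutionE => //; split=> // d Sd; rewrite f0// dotLC dotL0 oppr0.
  by case: (s) => [[w phi] M].
have LM : L2mx A s.2 by have [[]] := HM.
have kappa0 : 0 < kappa by rewrite divr_gt0// exprn_gt0.
(* Tested with the solution, both equations contain the same coupling term; eliminating it leaves
   two nonnegative terms with sum 0. *)
have E1 := e1 _ HM; have E2 := e2 _ _ Uw Dphi.
rewrite three_eq1E// in E1; rewrite three_eq2E// dotLC dotL0 oppr0 in E2.
have [posm M0] := moment_form_eq0 A_bounded A_polygonal kA_gt0 compliance_ge HM.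
have XE : \sum_i dotL A (three_features s (MomentDiv i)) (three_features s (Rotation i)) =
    \sum_i dotL A (three_features s (Rotation i)) (three_features s (MomentDiv i)).
  by apply: eq_bigr => i _; rewrite dotLC.
rewrite XE in E2; move/eqP: E2; rewrite subr_eq0 => /eqP E2; rewrite E2 in E1.
have posS : 0 <= \sum_i dotL A (three_features s (Shear i)) (three_features s (Shear i)).
  by apply: sumr_ge0 => i _; exact: dotL_ge0.
move/eqP: E1; rewrite paddr_eq0//; last by rewrite mulr_ge0// ltW.
rewrite mulf_eq0 (gt_eqF kappa0) /= => /andP[/eqP/M0{}M0 /eqP S0].
have Sh0 i : ae_eq_on A (three_features s (Shear i)) (fun=> 0).
  apply: (dotL_eq0 A_open); first exact: three_L2.
  by apply: (psumr_eq0P _ S0) => // j _; exact: dotL_ge0.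
have phi_grad i : ae_eq_on A (fun x => s.1.2 x 0 i) (fun x => wgrad A s.1.1 x 0 i).
  by apply: filterS (Sh0 i) => x H Ax; have := H Ax; rewrite /= => /eqP; rewrite subr_eq0 => /eqP.
have [P [D1 [D2 [pP PC uP]]]] := Uh_pieces Uw.
(* Its divergence is the gradient of the deflection, that is, the rotation; as the moment is 0, the
   first equation reduces to the squared norm of the rotation. *)
pose M1 x : 'M[R]_2 := pw T P x *: 1%:M.
have Lw := Uh_L2 A_bounded A_polygonal T_conforming Uw.
have agree k l x : triangle (T k) x -> triangle (T l) x -> P k x = P l x.
  by move=> Tk Tl; rewrite -(uP k)// -(uP l).
have divM1 i := weak_div_continuous A_bounded A_polygonal T_conforming
  ((1%:M : 'M[R]_2) i 0, (1%:M : 'M[R]_2) i 1) PC agree.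
have HM1 : HZh A T p M1.
  apply: (HZh_pw A_bounded A_polygonal T_conforming) => //.
  - by rewrite trmx1.
  - move=> k l a b ab; rewrite -ab; apply: agree; first exact: vertex_triangle.
    by rewrite ab; exact: vertex_triangle.
  - by move=> r; eexists; rewrite row_vec; exact: divM1.
have cP k : continuous (P k) by have [] := PC k.
have wDivM1 i : ae_eq_on A (fun x => wDiv A M1 x 0 i) (fun x => s.1.2 x 0 i).
  have rowM1 : (fun x => row i (M1 x)) = fun x => pw T P x *:
      vec ((1%:M : 'M[R]_2) i 0, (1%:M : 'M[R]_2) i 1).
    by apply/funext => x; rewrite linearZ /= row_vec.
  have := divM1 i; rewrite -rowM1 => W.
  apply: (aeon_trans (HZ_wDiv_ae A_bounded A_polygonal HM1 W)).
  apply: (@aeon_trans _ _ _ _ (fun x => wgrad A s.1.1 x 0 i)); last exact/aeon_sym/phi_grad.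
  have G := weak_grad_div Lw (wgradP (Uh_weak_grad_ex Uw)) i.
  apply: (weak_div_unique_ae A_open A_bounded _ (L2mx_delta A_open i Lw) _ W G).
    apply: L2mx_row; have [[]] := HM1 => //.
  apply: filterS (Uh_ae T_conforming uP) => x H Ax; rewrite H// linearZ /=.
  by congr (_ *: _); apply/rowP => j; rewrite !mxE eqxx eq_sym.
have phi0 i : ae_eq_on A (fun x => s.1.2 x 0 i) (fun=> 0).
  have Sd : three_space (fun=> 0, fun=> 0, M1).
    by have [U0 D0 _] := three_space0; split.
  have LM1 : L2mx A M1 by have [[]] := HM1.
  have := e1 _ HM1; rewrite (three_eq1E Ss Sd) /=.
  have -> : moment_form A E nu s.2 M1 = 0.
    by rewrite moment_formC; exact: moment_form_ae0.
  rewrite add0r => Z; apply: (dotL_eq0 A_open); first exact: (three_L2 (Rotation i) Ss).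
  have {}Z : \sum_i dotL A (fun x => s.1.2 x 0 i) (fun x => s.1.2 x 0 i) = 0.
    rewrite -[RHS]Z; apply: eq_bigr => j _.
    apply: (eq_dotL A_open); try exact: (three_L2 (Rotation j) Ss).
    - exact: (three_L2 (MomentDiv j) Sd).
    - exact: aeon_refl.
    - exact/aeon_sym/wDivM1.
  by apply: (psumr_eq0P _ Z) => // j _; exact: dotL_ge0.
have w0 : ae_eq_on A s.1.1 (fun=> 0).
  apply: gradient_free => // i; apply: aeon_trans (phi0 i).
  exact/aeon_sym/phi_grad.
apply: three_null => //; case=> [u|[i|ij]] //; first exact: phi0.
exact: M0.
Qed.

(** Deflections must agree at every point of the closure, not almost everywhere; this holds triangle
    by triangle, by continuity of the polynomial pieces. *)
Lemma three_null_same s s' : three_space s -> three_space s' ->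
  null A three_features (s - s') -> three_same A s s'.
Proof.
case: s => [[w phi] M] [/= Uw _ _]; case: s' => [[w' phi'] M'] [/= Uw' _ _] z; split.
- have [P [D1 [D2 [_ PC uP]]]] := Uh_pieces Uw.
  have [P' [D1' [D2' [_ PC' uP']]]] := Uh_pieces Uw'.
  move=> x; rewrite (mesh_cover T_conforming) => -[k _ Tx].
  have cP : continuous (fun x => P k x - P' k x).
    by apply: continuousB_fun; [have [] := PC k|have [] := PC' k].
  rewrite (uP k)// (uP' k)//; apply/eqP; rewrite -subr_eq0; apply/eqP.
  apply: (continuous_ae0_triangle (T_nondeg k) cP) => //.
  have := ae_triangle A_polygonal T_conforming k (z Deflection).
  by apply: filterS => y H Ty; rewrite -(uP k)// -(uP' k)//; exact: H.
- by apply: row_same => i; exact: (z (Rotation i)).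
- by apply: matrix_same => i j; exact: (z (Moment i j)).
Qed.

Definition three_norm_features : seq three_feature :=
  [:: Deflection; Slope 0; Slope 1; Rotation 0; Rotation 1; Moment 0 0; Moment 0 1;
      Moment 1 0; Moment 1 1; MomentDiv 0; MomentDiv 1].

Lemma three_norm_le s : three_space s ->
  three_norm A s <= \sum_(k <- three_norm_features) L2norm A (three_features s k).
Proof.
case: s => [[w phi] M] [/= Uw Dphi HM].
have h := HDivnorm_le A_polygonal HM.
have hphi := L2mxnorm_row_le A_polygonal (Dh2_L2 Dphi).
have hg := L2mxnorm_row_le A_polygonal (Uh_wgrad_L2 Uw).
have hw : H1norm A w <= L2norm A w + L2mxnorm A (wgrad A w).
  exact: (sqrt_sum_sqr_le (sqrtr_ge0 _) (sqrtr_ge0 _)).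
apply: le_trans (lerD (lerD (le_trans hw (lerD (lexx _) hg)) hphi) h) _.
by rewrite !big_cons big_nil /= addr0 -!addrA.
Qed.

Theorem three_well_posed :
  well_posed A (three_same A) (three_norm A) (three_field_solution A T p E nu ksmu t).
Proof.
apply: (abstract_well_posed A_open A_bounded (sc := three_scale) (S := three_space)
  (Phi := three_features) (K := coords T three_component (p := p))
  (B := three_coefficients) (k0 := Deflection)
  _ _ _ _ _ _ _ _ _ (r := three_norm_features)).
- exact: three_space0.
- exact: three_lin.
- exact: three_L2.
- exact: three_feature_lin.
- by apply: coords0; case=> [u|[i|ij]] x //=; rewrite mxE.
- by apply: coords_lin => a s s'; case=> [u|[i|ij]] x //=; rewrite !mxE.
- by apply: (coords_ex (S := three_space)) => s j l; exact: three_component_poly.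
- move=> s Ss Ks; apply: three_null => //; exact: (coords_null T_conforming Ks).
- exact: three_nondeg.
- move=> [[w phi] M]; congr (_, _, _); apply/funext => x /=; [exact: mulN1r|exact: scaleN1r..].
- exact: three_solutionE.
- exact: three_null_same.
- exact: three_norm_le.
Qed.

End ThreeField.

(** * The quad-field problem *)

Inductive quad_feature : Type :=
| QDeflection | QRotation of 'I_2 | QMoment of 'I_2 & 'I_2 | QMomentTrace
| QMomentDiv of 'I_2 | QShear of 'I_2 | QShearDiv.

Section QuadField.
Context {R : realType}.
Notation mu := (leb2 R).
Variables (A : set (R * R)) (n : nat) (T : 'I_n -> 'I_3 -> R * R) (p : nat).
Variables (E nu ksmu t kA : R).
Hypothesis A_bounded : bounded_set A.
Hypothesis A_polygonal : polygonal_domain A.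
Hypothesis T_conforming : conforming_triangulation A T.
Hypothesis p_ge3 : (3 <= p)%N.
Hypothesis t_gt0 : 0 < t.
Hypothesis ksmu_gt0 : 0 < ksmu.
Hypothesis kA_gt0 : 0 < kA.
Hypothesis compliance_ge : forall S : 'M[R]_2, S^T = S ->
  kA * ip S S <= ip S (compliance E nu S).

Let A_open : open A.
Proof. exact: (mesh_open A_polygonal). Qed.
Let mA : measurable (A : set (plane R)).
Proof. exact: (mesh_measurable A_polygonal). Qed.

Definition quad_space (s : quad_type R) :=
  [/\ Dh A T p.-1 s.1.1.1, Dh2 A T p.-1 s.1.1.2, HZh A T p s.1.2 & RTh A T p.-1 s.2].

Definition quad_scale (a : R) (s : quad_type R) : quad_type R :=
  (fun x => a * s.1.1.1 x, fun x => a *: s.1.1.2 x, fun x => a *: s.1.2 x,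
   fun x => a *: s.2 x).

Definition quad_features (s : quad_type R) (k : quad_feature) : R * R -> R :=
  match k with
  | QDeflection => s.1.1.1
  | QRotation i => fun x => s.1.1.2 x 0 i
  | QMoment i j => fun x => s.1.2 x i j
  | QMomentTrace => fun x => \tr (s.1.2 x)
  | QMomentDiv i => fun x => wDiv A s.1.2 x 0 i
  | QShear i => fun x => s.2 x 0 i
  | QShearDiv => wdiv A s.2
  end.

Notation kappa := (t ^+ 2 / ksmu).

Definition quad_coefficients : seq (R * (quad_feature * quad_feature)) :=
  [:: (lame1 E nu / 2, (QMoment 0 0, QMoment 0 0));
      (lame1 E nu / 2, (QMoment 0 1, QMoment 0 1));
      (lame1 E nu / 2, (QMoment 1 0, QMoment 1 0));
      (lame1 E nu / 2, (QMoment 1 1, QMoment 1 1));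
      (- lame2 E nu / 2, (QMomentTrace, QMomentTrace));
      (kappa / 2, (QShear 0, QShear 0)); (kappa / 2, (QShear 1, QShear 1));
      (1, (QMomentDiv 0, QRotation 0)); (1, (QMomentDiv 1, QRotation 1));
      (-1, (QShearDiv, QDeflection));
      (-1, (QShear 0, QRotation 0)); (-1, (QShear 1, QRotation 1))].

Notation form := (form A quad_features quad_coefficients).

Lemma RTh_L2 d q : RTh A T d q -> L2mx A q.
Proof. by move=> [[]]. Qed.

Lemma RTh_wdiv_L2 d q : RTh A T d q -> L2 A (wdiv A q).
Proof. by move=> [[_ /wdivP[]]]. Qed.

Lemma quad_L2 s k : quad_space s -> L2 A (quad_features s k).
Proof.
case: s => [[[w phi] M] q] [/= Dw Dphi HM Rq]; have LM : L2mx A M by have [[]] := HM.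
case: k => [|i|i j||i|i|] /=.
- by have [] := Dw.
- exact: (Dh2_L2 Dphi).
- exact: LM.
- exact: L2_mxtrace.
- exact: HZ_wDiv_L2 HM.
- exact: (RTh_L2 Rq).
- exact: RTh_wdiv_L2 Rq.
Qed.

Lemma quad_lin a s s' : quad_space s -> quad_space s' ->
  quad_space (quad_scale a s + s').
Proof.
case: s => [[[w phi] M] q] [/= Dw Dphi HM Rq].
case: s' => [[[w' phi'] M'] q'] [/= Dw' Dphi' HM' Rq']; split.
- exact: (Dh_lin A_polygonal a Dw Dw').
- exact: (Dh2_lin A_polygonal a Dphi Dphi').
- exact: (HZh_lin A_bounded A_polygonal a HM HM').
- exact: (RTh_lin A_bounded A_polygonal a Rq Rq').
Qed.

Lemma quad_space0 : quad_space 0.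
Proof. by split; [exact: Dh0|exact: Dh2_0|exact: HZh0|exact: RTh0]. Qed.

Lemma quad_feature_lin a s s' k : quad_space s -> quad_space s' ->
  ae_eq_on A (quad_features (quad_scale a s + s') k)
    (fun x => a * quad_features s k x + quad_features s' k x).
Proof.
case: s => [[[w phi] M] q] [/= Dw Dphi HM Rq].
case: s' => [[[w' phi'] M'] q'] [/= Dw' Dphi' HM' Rq'].
case: k => [|i|i j||i|i|] /=.
- exact: aeon_refl.
- by apply: aeonW => x _; rewrite !mxE.
- by apply: aeonW => x _; rewrite !mxE.
- by apply: aeonW => x _; rewrite linearP.
- exact: (wDiv_lin A_bounded A_polygonal a i HM HM').
- by apply: aeonW => x _; rewrite !mxE.
- apply: (wdiv_lin_ae A_open A_bounded); [exact: RTh_L2 Rq|exact: RTh_L2 Rq'| |].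
  + by have [[]] := Rq.
  + by have [[]] := Rq'.
Qed.

Definition quad_component (s : quad_type R)
    (j : unit + ('I_2 + ('I_2 * 'I_2 + 'I_2))) : R * R -> R :=
  match j with
  | inl _ => s.1.1.1
  | inr (inl i) => fun x => s.1.1.2 x 0 i
  | inr (inr (inl ij)) => fun x => s.1.2 x ij.1 ij.2
  | inr (inr (inr i)) => fun x => s.2 x 0 i
  end.

Lemma quad_component_poly s j l : quad_space s ->
  exists2 Q, poly2 p Q & ae_eq_on (triangle (T l)) (quad_component s j) Q.
Proof.
move=> [Dw Dphi HM Rq]; case: j => [_|[i|[[i j]|i]]] /=.
- exact: Dh_comp_poly Dw.
- exact: Dh_comp_poly (Dphi i).
- exact: HZh_comp_poly HM.
- by apply: RTh_comp_poly Rq; exact: leq_trans p_ge3.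
Qed.

Lemma quad_null s : quad_space s ->
  (forall j, ae_eq_on A (quad_component s j) (fun=> 0)) -> null A quad_features s.
Proof.
move=> Ss z; have [Dw Dphi HM Rq] := Ss.
have w0 := z (inl tt); have phi0 i := z (inr (inl i)).
have M0 i j := z (inr (inr (inl (i, j)))); have q0 i := z (inr (inr (inr i))).
case=> [|i|i j||i|i|] //=.
- exact: phi0.
- exact: M0.
- exact: mxtrace_null.
- exact: (wDiv_null A_bounded A_polygonal i HM).
- exact: q0.
- apply: (wdiv_null A_bounded A_polygonal (RTh_L2 Rq)) => //.
  by have [[]] := Rq.
Qed.

Definition quad_eq1 (s : quad_type R) (dM : R * R -> 'M[R]_2) (dq : R * R -> 'rV[R]_2) : R :=
  \int[mu]_(x in A) (ip (dM x) (compliance E nu (s.1.2 x)) + kappa * ip (dq x) (s.2 x)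
     + ip (wDiv A dM x) (s.1.1.2 x) - wdiv A dq x * s.1.1.1 x - ip (dq x) (s.1.1.2 x)).

Definition quad_eq2 (s : quad_type R) (dw : R * R -> R) (dphi : R * R -> 'rV[R]_2) : R :=
  \int[mu]_(x in A) (ip (dphi x) (wDiv A s.1.2 x) - dw x * wdiv A s.2 x
     - ip (dphi x) (s.2 x)).

Lemma RintegralB_on f g : integrable_on A f -> integrable_on A g ->
  \int[mu]_(x in A) (f x - g x) = \int[mu]_(x in A) f x - \int[mu]_(x in A) g x.
Proof. exact: RintegralB. Qed.

Lemma integrable_onB f g : integrable_on A f -> integrable_on A g ->
  integrable_on A (fun x => f x - g x).
Proof. exact: integrableB. Qed.

Lemma Rintegral_ip_row (u v : R * R -> 'rV[R]_2) : L2mx A u -> L2mx A v ->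
  \int[mu]_(x in A) ip (u x) (v x) =
  \sum_i dotL A (fun x => v x 0 i) (fun x => u x 0 i).
Proof.
move=> Lu Lv; rewrite (Rintegral_ip A_open Lu Lv) big_ord1.
by apply: eq_bigr => i _; exact: dotLC.
Qed.

Section Equations.
Variables s d : quad_type R.
Hypothesis Ss : quad_space s.
Hypothesis Sd : quad_space d.
Notation "<< k | l >>" := (dotL A (quad_features s k) (quad_features d l)).

Lemma quad_eq1E : quad_eq1 s d.1.2 d.2 = moment_form A E nu s.1.2 d.1.2
  + kappa * (\sum_i << QShear i | QShear i >>)
  + \sum_i << QRotation i | QMomentDiv i >> - << QDeflection | QShearDiv >>
  - \sum_i << QRotation i | QShear i >>.
Proof.
have [Dw Dphi HM Rq] := Ss; have [_ _ HM' Rq'] := Sd.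
have LM : L2mx A s.1.2 by have [[]] := HM.
have LM' : L2mx A d.1.2 by have [[]] := HM'.
have Lphi := Dh2_L2 Dphi; have LD := wDiv_L2mx HM'.
have Lq := RTh_L2 Rq; have Lq' := RTh_L2 Rq'.
have Lw : L2 A s.1.1.1 by have [] := Dw.
have i1 := integrable_on_ip A_polygonal LM' (L2mx_compliance A_bounded A_polygonal E nu LM).
have i2 := integrable_onZ A_polygonal kappa (integrable_on_ip A_polygonal Lq' Lq).
have i3 := integrable_on_ip A_polygonal LD Lphi.
have i4 := integrable_onM A_polygonal (RTh_wdiv_L2 Rq') Lw.
have i5 := integrable_on_ip A_polygonal Lq' Lphi.
rewrite /quad_eq1.
rewrite RintegralB_on//; last first.
  by apply: integrable_onB => //; apply: integrable_onD => //; exact: integrable_onD.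
rewrite RintegralB_on//; last by apply: integrable_onD => //; exact: integrable_onD.
rewrite (RintegralD_on A_polygonal)//; last exact: integrable_onD.
rewrite (RintegralD_on A_polygonal)// (RintegralZ_on A_polygonal); last exact: integrable_on_ip.
rewrite (Rintegral_compliance A_bounded A_polygonal)// !Rintegral_ip_row//.
by rewrite [in LHS]/(\int[_]_(_ in _) (wdiv _ _ _ * _)) -[X in _ - X - _]/(dotL A _ _) dotLC.
Qed.

Lemma quad_eq2E : quad_eq2 s d.1.1.1 d.1.1.2 =
  \sum_i << QMomentDiv i | QRotation i >> - << QShearDiv | QDeflection >>
  - \sum_i << QShear i | QRotation i >>.
Proof.
have [_ _ HM Rq] := Ss; have [Dw Dphi _ _] := Sd.
have Lphi := Dh2_L2 Dphi; have LD := wDiv_L2mx HM.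
have Lq := RTh_L2 Rq; have Lw : L2 A d.1.1.1 by have [] := Dw.
have i3 := integrable_on_ip A_polygonal Lphi LD.
have i4 := integrable_onM A_polygonal Lw (RTh_wdiv_L2 Rq).
have i5 := integrable_on_ip A_polygonal Lphi Lq.
rewrite /quad_eq2 RintegralB_on//; last exact: integrable_onB.
rewrite RintegralB_on// !Rintegral_ip_row//.
by rewrite -[X in _ - X - _]/(dotL A _ _) dotLC.
Qed.

Lemma quad_formE : form s d = quad_eq1 s d.1.2 d.2 + quad_eq2 s d.1.1.1 d.1.1.2.
Proof.
rewrite quad_eq1E quad_eq2E /form /moment_form.
rewrite !big_cons big_nil !sum2E /=.
by do ?[set z := dotL _ _ _; move: z => ?]; lra.
Qed.

End Equations.

Lemma quad_null0 : null A quad_features 0.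
Proof.
apply: quad_null; first exact: quad_space0.
by case=> [u|[i|[ij|i]]]; apply: aeonW => x _ /=; rewrite ?mxE.
Qed.

Lemma quad_dot0 s k l : quad_space s ->
  dotL A (quad_features s k) (quad_features 0 l) = 0.
Proof.
move=> Ss; have S0 := quad_space0.
by apply: (dotL_ae0 A_bounded A_polygonal); [exact: quad_L2|exact: quad_L2|exact: quad_null0].
Qed.

Lemma quad_eq1_0 s : quad_space s -> quad_eq1 s (fun=> 0) (fun=> 0) = 0.
Proof.
move=> Ss; have S0 := quad_space0; have z := quad_null0.
have [_ _ [[LM _ _] _] _] := Ss; have [_ _ [[LM0 _ _] _] _] := S0.
rewrite (quad_eq1E Ss S0) (moment_form_ae0 E nu A_bounded A_polygonal)//; last first.
  by move=> i j; exact: (z (QMoment i j)).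
rewrite quad_dot0// !big1 ?mulr0 ?addr0 ?subr0// => i _; exact: quad_dot0.
Qed.

Lemma quad_eq2_0 s : quad_space s -> quad_eq2 s (fun=> 0) (fun=> 0) = 0.
Proof.
move=> Ss; rewrite (quad_eq2E Ss quad_space0) quad_dot0// !big1 ?subr0// => i _;
  exact: quad_dot0.
Qed.

Lemma quad_solutionE g s : L2 A g -> quad_field_solution A T p E nu ksmu t g s <->
  quad_space s /\
  forall d, quad_space d -> form s d = - dotL A (quad_features d QDeflection) g.
Proof.
move=> Lg; split.
  move: s => [[[w phi] M] q] [[Dw Dphi HM Rq] e1 e2]; split=> // d Sd.
  have [Dw' Dphi' HM' Rq'] := Sd.
  by rewrite quad_formE// [X in X + _]e1// add0r; exact: e2.
move=> [Ss e]; have [Dw Dphi HM Rq] := Ss; have [Dw0 D0 M0 R0] := quad_space0.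
have e1 dM dq : HZh A T p dM -> RTh A T p.-1 dq -> quad_eq1 s dM dq = 0.
  move=> HdM Rdq; have Sd : quad_space (fun=> 0, fun=> 0, dM, dq) by [].
  have := e _ Sd; rewrite quad_formE//= quad_eq2_0// addr0 => ->.
  by rewrite dotL0 oppr0.
have e2 dw dphi : Dh A T p.-1 dw -> Dh2 A T p.-1 dphi ->
    quad_eq2 s dw dphi = - dotL A dw g.
  move=> Ddw Ddphi; have Sd : quad_space (dw, dphi, fun=> 0, fun=> 0) by [].
  by have := e _ Sd; rewrite quad_formE//= quad_eq1_0// add0r.
by move: s Ss Dw Dphi HM Rq e1 e2 {e} => [[[w phi] M] q].
Qed.

Lemma quad_nondeg s : quad_space s ->
  (forall d, quad_space d -> form s d = 0) -> null A quad_features s.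
Proof.
move=> Ss f0; have [Dw Dphi HM Rq] := Ss; have S0 := quad_space0.
have [Dw0 Dphi0 HM0 Rq0] := S0.
have eqs d : quad_space d -> quad_eq1 s d.1.2 d.2 = 0 /\ quad_eq2 s d.1.1.1 d.1.1.2 = 0.
  move=> [Dw' Dphi' HM' Rq']; split.
    have Sd : quad_space (fun=> 0, fun=> 0, d.1.2, d.2) by [].
    by have := f0 _ Sd; rewrite quad_formE//= quad_eq2_0// addr0.
  have Sd : quad_space (d.1.1.1, d.1.1.2, fun=> 0, fun=> 0) by [].
  by have := f0 _ Sd; rewrite quad_formE//= quad_eq1_0// add0r.
have LM : L2mx A s.1.2 by have [[]] := HM.
have kappa0 : 0 < kappa by rewrite divr_gt0// exprn_gt0.
have [E1 E2] := eqs s Ss.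
rewrite quad_eq1E// in E1; rewrite quad_eq2E// in E2.
have [posm M0] := moment_form_eq0 A_bounded A_polygonal kA_gt0 compliance_ge HM.
have {}E2 : \sum_i dotL A (quad_features s (QRotation i)) (quad_features s (QMomentDiv i))
    - dotL A (quad_features s QDeflection) (quad_features s QShearDiv)
    - \sum_i dotL A (quad_features s (QRotation i)) (quad_features s (QShear i)) = 0.
  rewrite -[RHS]E2; congr (_ - _ - _); last by apply: eq_bigr => i _; rewrite dotLC.
    by apply: eq_bigr => i _; rewrite dotLC.
  exact: dotLC.
(* The mixed terms of the first equation, tested with the solution, are the left-hand side of the
   second and cancel. *)
have tot : moment_form A E nu s.1.2 s.1.2 + kappa *
    (\sum_i dotL A (quad_features s (QShear i)) (quad_features s (QShear i))) = 0.
  have e (a b c x y : R) : a + b + c - x - y = a + b + (c - x - y) by rewrite !addrA.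
  by rewrite e E2 addr0 in E1.
have posS : 0 <= \sum_i dotL A (quad_features s (QShear i)) (quad_features s (QShear i)).
  by apply: sumr_ge0 => i _; exact: dotL_ge0.
move/eqP: tot; rewrite paddr_eq0//; last by rewrite mulr_ge0// ltW.
rewrite mulf_eq0 (gt_eqF kappa0) /= => /andP[/eqP/M0{}M0 /eqP Sh0].
have q0 i : ae_eq_on A (quad_features s (QShear i)) (fun=> 0).
  apply: (dotL_eq0 A_open); first exact: quad_L2.
  by apply: (psumr_eq0P _ Sh0) => // j _; exact: dotL_ge0.
have moment0 N : L2mx A N -> moment_form A E nu s.1.2 N = 0.
  by move=> LN; rewrite moment_formC; exact: (moment_form_ae0 E nu A_bounded A_polygonal).
have dot0 k d l : ae_eq_on A (quad_features s k) (fun=> 0) -> quad_space d ->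
    dotL A (quad_features s k) (quad_features d l) = 0.
  move=> k0 Sd; rewrite dotLC.
  by apply: (dotL_ae0 A_bounded A_polygonal) => //; exact: quad_L2.
(* With zero moment, the first equation tested with moments alone is orthogonality to the discrete
   divergences. *)
have phi0 i : ae_eq_on A (fun x => s.1.1.2 x 0 i) (fun=> 0).
  apply: (HZ_kernel A_bounded A_polygonal T_conforming p_ge3 Dphi) => dM HdM.
  have Sd : quad_space (fun=> 0, fun=> 0, dM, fun=> 0) by [].
  have [+ _] := eqs _ Sd; rewrite (quad_eq1E Ss Sd) moment0; last by have [[]] := HdM.
  rewrite [\sum_i dotL A (quad_features s (QShear i)) _]big1; last first.
    by move=> j _; apply: dot0.
  rewrite [\sum_i dotL A (quad_features s (QRotation i)) (quad_features _ (QShear i))]big1; last first.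
    by move=> j _; exact: (quad_dot0 (QRotation j) (QShear j) Ss).
  rewrite [dotL A (quad_features s QDeflection) _](quad_dot0 QDeflection QShearDiv Ss).
  rewrite mulr0 addr0 add0r !subr0 => z; rewrite -[RHS]z; apply: eq_bigr => j _; exact: dotLC.
(* Shear tests couple to the deflection and to the rotation, so the latter has to be eliminated
   before. *)
have w0 : ae_eq_on A s.1.1.1 (fun=> 0).
  apply: (RT_kernel A_bounded A_polygonal T_conforming p_ge3 Dw) => dq Rdq.
  have Sd : quad_space (fun=> 0, fun=> 0, fun=> 0, dq) by [].
  have [+ _] := eqs _ Sd; rewrite (quad_eq1E Ss Sd) moment0; last by have [[]] := HM0.
  rewrite [\sum_i dotL A (quad_features s (QShear i)) _]big1; last first.
    by move=> j _; apply: dot0.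
  rewrite [\sum_i dotL A (quad_features s (QRotation i)) (quad_features _ (QMomentDiv i))]big1; last first.
    by move=> j _; exact: (quad_dot0 (QRotation j) (QMomentDiv j) Ss).
  rewrite [\sum_i dotL A (quad_features s (QRotation i)) (quad_features _ (QShear i))]big1; last first.
    by move=> j _; apply: dot0 => //; exact: phi0.
  rewrite mulr0 !addr0 add0r subr0 => /eqP; rewrite oppr_eq0 => /eqP z.
  by rewrite dotLC; exact: z.
apply: quad_null => //; case=> [u|[i|[ij|i]]] //.
- exact: phi0.
- exact: M0.
- exact: q0.
Qed.

Lemma quad_null_same s s' : null A quad_features (s - s') -> quad_same A s s'.
Proof.
case: s => [[[w phi] M] q]; case: s' => [[[w' phi'] M'] q'] z.
split.
- by apply: filterS (z QDeflection) => x H Ax; apply/eqP; rewrite -subr_eq0; apply/eqP; exact: H.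
- by apply: row_same => i; exact: (z (QRotation i)).
- by apply: matrix_same => i j; exact: (z (QMoment i j)).
- by apply: row_same => i; exact: (z (QShear i)).
Qed.

Definition quad_norm_features : seq quad_feature :=
  [:: QDeflection; QRotation 0; QRotation 1; QMoment 0 0; QMoment 0 1;
      QMoment 1 0; QMoment 1 1; QMomentDiv 0; QMomentDiv 1; QShear 0; QShear 1;
      QShearDiv].

Lemma quad_norm_le s : quad_space s ->
  quad_norm A s <= \sum_(k <- quad_norm_features) L2norm A (quad_features s k).
Proof.
case: s => [[[w phi] M] q] [/= Dw Dphi HM Rq].
have h := HDivnorm_le A_polygonal HM.
have hphi := L2mxnorm_row_le A_polygonal (Dh2_L2 Dphi).
have hq := L2mxnorm_row_le A_polygonal (RTh_L2 Rq).
have hd : Hdivnorm A q <= L2mxnorm A q + L2norm A (wdiv A q).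
  exact: (sqrt_sum_sqr_le (sqrtr_ge0 _) (sqrtr_ge0 _)).
apply: le_trans (lerD (lerD (lerD (lexx _) hphi) h) (le_trans hd (lerD hq (lexx _)))) _.
by rewrite !big_cons big_nil /= addr0 -!addrA.
Qed.

Theorem quad_well_posed :
  well_posed A (quad_same A) (quad_norm A) (quad_field_solution A T p E nu ksmu t).
Proof.
apply: (abstract_well_posed A_open A_bounded (sc := quad_scale) (S := quad_space)
  (Phi := quad_features) (K := coords T quad_component (p := p))
  (B := quad_coefficients) (k0 := QDeflection)
  _ _ _ _ _ _ _ _ _ (r := quad_norm_features)).
- exact: quad_space0.
- exact: quad_lin.
- exact: quad_L2.
- exact: quad_feature_lin.
- by apply: coords0; case=> [u|[i|[ij|i]]] x //=; rewrite mxE.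
- by apply: coords_lin => a s s'; case=> [u|[i|[ij|i]]] x //=; rewrite !mxE.
- by apply: (coords_ex (S := quad_space)) => s j l; exact: quad_component_poly.
- move=> s Ss Ks; apply: quad_null => //; exact: (coords_null T_conforming Ks).
- exact: quad_nondeg.
- move=> [[[w phi] M] q]; congr (_, _, _, _); apply/funext => x /=;
    [exact: mulN1r|exact: scaleN1r..].
- exact: quad_solutionE.
- by move=> s s' _ _; exact: quad_null_same.
- exact: quad_norm_le.
Qed.

End QuadField.

Theorem theorem3p1 (R : realType) (A : set (R * R)) (n : nat)
    (T : 'I_n -> 'I_3 -> R * R) (p : nat) (t ksmu E nu kA cA : R)
    (A_bounded : bounded_set A)
    (A_contractible : contractible A)
    (A_polygonal : polygonal_domain A)
    (T_conforming : conforming_triangulation A T)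
    (p_ge3 : (3 <= p)%N)
    (t_gt0 : 0 < t)
    (ksmu_gt0 : 0 < ksmu)
    (kA_gt0 : 0 < kA)
    (cA_gt0 : 0 < cA)
    (compliance_pos : forall S : 'M[R]_2, S^T = S ->
       kA * ip S S <= ip S (compliance E nu S) <= cA * ip S S) :
  well_posed A (three_same A) (three_norm A)
    (three_field_solution A T p E nu ksmu t) /\
  well_posed A (quad_same A) (quad_norm A)
    (quad_field_solution A T p E nu ksmu t).
Proof.
have compliance_ge (S : 'M[R]_2) : S^T = S -> kA * ip S S <= ip S (compliance E nu S).
  by move=> /compliance_pos/andP[].
split.
  exact: (three_well_posed p A_bounded A_polygonal T_conforming t_gt0 ksmu_gt0 kA_gt0
    compliance_ge).
exact: (quad_well_posed A_bounded A_polygonal T_conforming p_ge3 t_gt0 ksmu_gt0 kA_gt0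
  compliance_ge).
Qed.
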